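(* Let $\mathcal{F}(g,e,w,b,n,D)$ be the set of sequenced orientable face-bipartite maps of genus $g$ with $e$ edges, $w$ white faces, $b$ black faces, with the root vertex of degree $2n$ and with the list of half-degrees of the distinguished vertices equal to $D=[d_1,\dots,d_{|D|}]$. The set $\mathcal{F}(g,e,w,b,n,D)$ satisfies the bijective decomposition $$\mathcal{F}(g,e,w,b,n,D)=\sum_{\substack{g_1+g_2=g\\ e_1+e_2=e-1\\ w_1+b_2=b\\ w_2+b_1=w\\ n_1+n_2=n-1\\ D_1\subseteq D}} \mathcal{F}(g_1,e_1,w_1,b_1,n_1,D_1)\times \mathcal{F}(g_2,e_2,w_2,b_2,n_2,D-D_1)$$ $$+\ \sum_{p=1}^{n-2}\mathcal{F}(g-1,e-1,b,w,n-1-p,p.D)\times\{1,\dots,p\}\ +\ \sum_{p=n}^{e-1}\mathcal{F}(g,e-1,b,w,p,D)$$ $$+\ \sum_{j=1}^{|D|}\mathcal{F}(g,e-1,b,w,d_j+n-1,D-\{d_j\})\ +\ \Delta_{(g,e,w,b,n,D)=(0,0,1,0,0,[\,])},$$ where $+$ and $\sum$ denote disjoint union of sets and the equality sign stands for a bijection between the two sides.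
   Context: A (combinatorial) map is a triple $(\Omega,R,L)$ where $\Omega$ is a finite set of darts, $R$ is a permutation of $\Omega$, $L$ is a fixed-point-free involution of $\Omega$, and the group $\langle R,L\rangle$ acts transitively on $\Omega$. The orbits of $R$, $L$ and $RL$ ($L$ followed by $R$) are the vertices, edges and faces; the degree of a vertex is the number of darts in it. The genus $g$ is given by $v-e+f=2(1-g)$, with $v,e,f$ the numbers of vertices, edges and faces. By convention there is also a unique empty map (no darts), with $v=f=1$ and $g=e=0$; its single vertex has degree $0$. A rooted map is the empty map or a nonempty map with a distinguished dart, the root; the root vertex is the vertex containing the root (for the empty map, its only vertex). A face-bipartite map is a map whose faces are coloured white and black so that two faces sharing an edge (i.e. the faces containing $d$ and $L(d)$, for any dart $d$) always have different colours; all its vertices then have even degree. In a rooted face-bipartite map the root must belong to a white face; the empty map has one white face and no black face. A sequenced face-bipartite map is a rooted face-bipartite map in which some vertices other than the root vertex (possibly none) are distinguished and labelled $1,\dots,k$, where $k$ is the number of distinguished vertices; its list of half-degrees is $[d_1,\dots,d_k]$, where $2d_i$ is the degree of the distinguished vertex labelled $i$. Such objects are considered up to isomorphism (bijections of darts commuting with $R$ and $L$ and preserving the root, the colours and the labelled distinguished vertices). List conventions: $D_1\subseteq D$ means that $D_1$ is a sublist of $D$, sublists being counted with multiplicity (so that e.g. $[1]$ occurs twice as a sublist of $[1,1,2]$), and $D-D_1$ is the complementary sublist; $D-\{d_j\}$ is $D$ with its $j$-th element removed; $p.D$ is $D$ with $p$ put in front; $[\,]$ is the empty list. A disjoint union over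 an empty range is the empty set, and sets $\mathcal{F}(\dots)$ with a negative parameter are empty. $\Delta_\varphi$ is the singleton containing the empty map if $\varphi$ is true and the empty set otherwise.
   Formalization: For e > 0 the formal statement assumes n > 0 and all half-degrees in D positive; without this the identity fails, e.g. F(0,1,0,1,0,[]) is empty while the third sum contains the empty map. *)

(* Defs.v *)
From mathcomp Require Import all_boot all_order all_algebra all_fingroup.

Set Implicit Arguments.
Unset Strict Implicit.
Unset Printing Implicit Defensive.

Import Order.TTheory GRing.Theory Num.Theory.
Local Open Scope ring_scope.

(* Transitivity in the sense of mathcomp forces the set of darts to be
   nonempty; the empty map is added separately in [smap]. *)
Record cmap := CMap {
  dart : finType;
  mapR : {perm dart};
  mapL : {perm dart};
  mapL_invol : forall d, mapL (mapL d) = d;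
  mapL_free : forall d, mapL d <> d;
  map_trans : [transitive <<[set mapR; mapL]>>%g, on [set: dart] | 'P]
}.

Section Cells.
Variable M : cmap.

Definition vertices : {set {set dart M}} := porbits (mapR M).
Definition edges : {set {set dart M}} := porbits (mapL M).

(* The product of {perm T} applies its left factor first, so that
   (mapL M * mapR M) d = mapR M (mapL M d). *)
Definition mapRL : {perm dart M} := (mapL M * mapR M)%g.
Definition faces : {set {set dart M}} := porbits mapRL.

Definition vertex_of (d : dart M) : {set dart M} := porbit (mapR M) d.
Definition face_of (d : dart M) : {set dart M} := porbit mapRL d.

(* A colouring is given by its set W of white faces; the others are black. *)
Definition face_bipartite (W : {set {set dart M}}) : Prop :=
  W \subset faces /\
  forall d, (face_of d \in W) <> (face_of (mapL M d) \in W).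

End Cells.

(* The distinguished vertices are listed in the order of their labels. *)
Record seqmap := SeqMap {
  under :> cmap;
  root : dart under;
  white : {set {set dart under}};
  dist : seq {set dart under};
  white_bipartite : face_bipartite white;
  root_white : face_of root \in white;
  dist_uniq : uniq dist;
  dist_vertices : {subset dist <= vertices under};
  dist_root : vertex_of root \notin dist
}.

Inductive smap := EmptyMap | DartMap of seqmap.

Definition nb_vertices (m : smap) : nat :=
  if m is DartMap M then #|vertices M| else 1.
Definition nb_edges (m : smap) : nat :=
  if m is DartMap M then #|edges M| else 0.
Definition nb_faces (m : smap) : nat :=
  if m is DartMap M then #|faces M| else 1.
Definition nb_white (m : smap) : nat :=
  if m is DartMap M then #|white M| else 1.
Definition nb_black (m : smap) : nat :=
  if m is DartMap M then #|faces M :\: white M| else 0.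
Definition root_degree (m : smap) : nat :=
  if m is DartMap M then #|vertex_of (root M)| else 0.
Definition dist_degrees (m : smap) : seq nat :=
  if m is DartMap M then [seq #|v| | v : {set dart M} <- dist M] else [::].

Definition has_genus (m : smap) (g : int) : Prop :=
  (nb_vertices m)%:Z - (nb_edges m)%:Z + (nb_faces m)%:Z = 2 * (1 - g).

Definition seqmap_iso (M N : seqmap) : Prop :=
  exists f : dart M -> dart N,
    [/\ bijective f,
        forall d, f (mapR M d) = mapR N (f d) &
        forall d, f (mapL M d) = mapL N (f d)] /\
    [/\ f (root M) = root N,
        [set f @: (F : {set dart M}) | F in white M] = white N &
        [seq f @: (v : {set dart M}) | v : {set dart M} <- dist M] = dist N].

Definition iso (m m' : smap) : Prop :=
  match m, m' with
  | EmptyMap, EmptyMap => True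
  | DartMap M, DartMap N => seqmap_iso M N
  | _, _ => False
  end.

(* Parameters are integers: no map has a negative number of edges or of
   faces, a negative (half-)degree or (Euler's inequality) a negative genus, so
   the corresponding sets [Fset] are empty. *)
Definition has_params (g e w b n : int) (D : seq int) (m : smap) : Prop :=
  [/\ has_genus m g, (nb_edges m)%:Z = e &
      [/\ (nb_white m)%:Z = w, (nb_black m)%:Z = b,
          (root_degree m)%:Z = 2 * n &
          [seq k%:Z | k <- dist_degrees m] = [seq 2 * d | d <- D]]].

(* Maps up to isomorphism: an element is an isomorphism class, represented by
   its membership predicate [iso m]. *)
Definition Fset (g e w b n : int) (D : seq int) : Type :=
  {C : smap -> Prop | exists2 m, has_params g e w b n D m & C = iso m}.

Definition Delta (phi : Prop) : Type :=
  {C : smap -> Prop | phi /\ C = iso EmptyMap}.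

Definition irange (a b : int) : Type := {p : int | a <= p <= b}.

(* The sublist D1 is given by a set of positions of D (a mask), so that sublists
   are counted with multiplicity. *)
Record splitting (g e w b n : int) (D : seq int) := Splitting {
  sg1 : int; sg2 : int;
  se1 : int; se2 : int;
  sw1 : int; sw2 : int;
  sb1 : int; sb2 : int;
  sn1 : int; sn2 : int;
  smask : (size D).-tuple bool;
  _ : sg1 + sg2 = g;
  _ : se1 + se2 = e - 1;
  _ : sw1 + sb2 = b;
  _ : sw2 + sb1 = w;
  _ : sn1 + sn2 = n - 1
}.

Section Splitting.
Variables (g e w b n : int) (D : seq int) (s : splitting g e w b n D).
Definition sD1 : seq int := mask (smask s) D.
Definition sD2 : seq int := mask (map negb (smask s)) D.
End Splitting.

(* Positions are numbered from 0. *)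
Definition remove_at (j : nat) (D : seq int) : seq int :=
  take j D ++ drop j.+1 D.

(* Main.v *)
Require Import Defs.
From mathcomp Require Import all_boot all_order all_algebra all_fingroup.
From mathcomp Require Import zify boolp.

(** The bijection removes the root edge by contraction. Write d for the root and
    d' = L d for its opposite. In the pair of permutations (L, RL), contraction
    leaves d and d' out of their cycles: faces survive, except those of degree one
    formed by d or d' alone. On the vertex permutation R it has the effect of
    composing with the transposition of d and d' and then leaving both out
    ([contraction]): if the edge is a loop its vertex is cut in two, and if it is a
    link its ends are merged.

    The colouring of faces makes the colours of the darts alternate along L and
    along R. Hence all vertices have even degree, and the darts a and b that follow
    d and d' around their vertices are black and white, respectively. What remains
    after contraction is a structure with two marked darts a and b ([cutmap]), and
    the map can be reconstructed from it ([glue_exists], [root_cut_reduces]) up to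
    isomorphism ([iso_of_cut_iso], [cut_iso_of_iso]). The terms of the
    decomposition classify these remainders.

    - If a and b are not connected, or one of them is missing, the remainder is a
      pair of maps rooted at a and b, a missing dart standing for the empty map
      ([disconnected_is_sum]). Roots are white whereas a is black, so colours are
      exchanged in the map rooted at a, here and below.
    - If a and b are connected but on different vertices, the remainder is one map
      rooted at a, of genus g - 1, together with a dart b on another vertex, which
      becomes the first distinguished one. By its colour, b is one of half of the
      2p darts of this vertex, whence the factor p.
    - If a and b are on one vertex, the edge was a link, and b lies 2n - 1 steps
      after a, so that a map rooted at a determines b. The far end of the edge
      was either undistinguished or distinguished with some label j.

    The last term accounts for the empty map, which has no root edge.

    Classes of maps up to isomorphism are handled through a relation between the
    elements of the right-hand side and those of the left-hand side ([glues]),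
    which is total and injective in both directions. The only delicate point is
    the number in {1, ..., p}: it must designate a dart in a way that depends on
    the class only. Darts are numbered in one chosen representative of each class,
    and the rigidity of rooted maps ([rooted_map_rigid]) makes this sound. *)

Set Implicit Arguments.
Unset Strict Implicit.
Unset Printing Implicit Defensive.
Import Order.TTheory GRing.Theory Num.Theory.

(** * Orbits of permutations *)

Section Orbits.

Lemma inj_surj_bij (A B : finType) (f : A -> B) :
  injective f -> (forall y, exists x, f x = y) -> bijective f.
Proof.
move=> fI /fin_all_exists[g gE]; exists g => // x.
by apply: fI; rewrite gE.
Qed.

Lemma leq_card_imset_factor (A B C : finType) (f : A -> B) (g : A -> C)
    (P : {set A}) :
  {in P &, forall x y, f x = f y -> g x = g y} -> #|g @: P| <= #|f @: P|.
Proof.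
move=> fg.
pose h u := omap g [pick x in P | f x == u].
rewrite -(card_imset _ Some_inj).
apply: leq_trans (leq_imset_card h _); apply: subset_leq_card.
apply/subsetP => _ /imsetP[_ /imsetP[x Px ->] ->].
apply/imsetP; exists (f x); first exact: imset_f.
rewrite /h; case: pickP => [y /andP[Py /eqP fy] | /(_ x)]; last by rewrite Px eqxx.
by congr Some; apply: fg.
Qed.

(** Both images are the quotient of P by the same equivalence relation. *)
Lemma card_imset_kernel (A B C : finType) (f : A -> B) (g : A -> C)
    (P : {set A}) :
  {in P &, forall x y, (f x == f y) = (g x == g y)} -> #|f @: P| = #|g @: P|.
Proof.
move=> fg; apply/eqP; rewrite eqn_leq !leq_card_imset_factor // => x y Px Py /eqP.
  by rewrite fg // => /eqP.
by rewrite -fg // => /eqP.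
Qed.

Lemma mem_porbit_next (T : finType) (s : {perm T}) x : s x \in porbit s x.
Proof. by have := mem_porbit s 1 x; rewrite expg1. Qed.

Lemma porbit_next (T : finType) (s : {perm T}) x : porbit s (s x) = porbit s x.
Proof. by have := porbit_perm s 1 x; rewrite expg1. Qed.

Lemma mem_next_porbit (T : finType) (s : {perm T}) x y :
  (s y \in porbit s x) = (y \in porbit s x).
Proof. by rewrite porbit_sym porbit_next porbit_sym. Qed.

Lemma porbit_ind (T : finType) (s : {perm T}) (A : T -> Prop) x :
  (forall y, y \in porbit s x -> A y -> A (s y)) -> A x ->
  forall y, y \in porbit s x -> A y.
Proof.
move=> cA Ax y /porbitP[n ->]; elim: n => [|n IHn]; first by rewrite expg0 perm1.
by rewrite expgSr permM; apply: cA => //; apply: mem_porbit.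
Qed.

Lemma porbit_emb (T T' : finType) (s : {perm T}) (s' : {perm T'}) (i : T' -> T) x :
  (forall y, y \in porbit s' x -> s (i y) = i (s' y)) ->
  porbit s (i x) = i @: porbit s' x.
Proof.
move=> si; apply/setP => y; apply/idP/imsetP.
  move: y; apply: porbit_ind; last by exists x => //; apply: porbit_id.
  move=> _ _ [z xz ->]; exists (s' z); last exact: si.
  by rewrite mem_next_porbit.
case=> z xz ->; move: z xz.
apply: (@porbit_ind _ _ (fun z => i z \in porbit s (i x))) => [z xz IH|]; last exact:
  porbit_id.
by rewrite -si // mem_next_porbit.
Qed.

Lemma porbit_emb_inj (T T' : finType) (s : {perm T}) (s' : {perm T'}) (i : T' -> T) :
  injective i -> (forall y, s (i y) = i (s' y)) ->
  forall x y, (i y \in porbit s (i x)) = (y \in porbit s' x).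
Proof.
by move=> iI si x y; rewrite (porbit_emb (s' := s')) ?mem_imset.
Qed.

(** The predicate C is meant to be a union of orbits, for instance the darts
    of one colour under the face permutation: one notion counts the
    vertices, all faces, and the faces of one colour. *)
Definition orbit_count (T : finType) (s : {perm T}) (C : pred T) : nat :=
  #|[set porbit s y | y in [set y | C y]]|.

Lemma card_porbits (T : finType) (s : {perm T}) : #|porbits s| = orbit_count s predT.
Proof.
apply: eq_card => A; rewrite /porbits; apply/imsetP/imsetP.
  by case=> x _ ->; exists x; rewrite ?inE.
by case=> x _ ->; exists x; rewrite ?inE.
Qed.

Lemma eq_orbit_count (T : finType) (s : {perm T}) (C D : pred T) :
  C =1 D -> orbit_count s C = orbit_count s D.
Proof.
by move=> CD; rewrite /orbit_count; congr #|pred_of_set (imset _ _)|; rewrite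
  (_ : [set y | C y] = [set y | D y]) //; apply/setP => x; rewrite !inE.
Qed.

Lemma orbit_count_emb (T T' : finType) (s : {perm T}) (s' : {perm T'}) (i : T' -> T)
    (C : pred T') :
  (forall x y, C x -> C y -> (i y \in porbit s (i x)) = (y \in porbit s' x)) ->
  #|[set porbit s (i y) | y in [set y | C y]]| = orbit_count s' C.
Proof.
move=> iP; apply: card_imset_kernel => x y; rewrite !inE => Cx Cy.
by rewrite !eq_porbit_mem iP.
Qed.

End Orbits.

(** * Cutting two points out of the cycles of a permutation *)

Section Bypass.
Variables T T' : finType.

Definition omem (o : option T') (A : {set T'}) : bool :=
  if o is Some x then x \in A else false.

(** The cycles of [s'] are those of [s] with the points [d] and [d'] left
    out; [o] and [o'] are what follows [d] and [d'], with [None] for a fixed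
    point. As [o] and [o'] range over the smaller type, [d] and [d'] never
    follow one another, so that at most one point is skipped at a time. *)
Record bypass (s : {perm T}) (s' : {perm T'}) (i : T' -> T) (d d' : T)
    (o o' : option T') : Prop := Bypass {
  bypass_inj : injective i;
  bypass_neq : d != d';
  bypass_d : forall x, i x != d;
  bypass_d' : forall x, i x != d';
  bypass_cov : forall y, [\/ y = d, y = d' | exists x, y = i x];
  bypass_opt : forall x, o = Some x -> o' = Some x -> False;
  bypass_i : forall x, s (i x) = if o == Some (s' x) then d else
                               if o' == Some (s' x) then d' else i (s' x);
  bypass_sd : s d = oapp i d o;
  bypass_sd' : s d' = oapp i d' o' }.

Variables (s : {perm T}) (s' : {perm T'}) (i : T' -> T) (d d' : T).
Variables (o o' : option T').
Hypothesis H : bypass s s' i d d' o o'.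

(** Leaving points out of a cycle keeps the others in cyclic order, and a
    skipped point lies on the cycle of its successor. *)
Lemma mem_bypass_porbit x y :
  (y \in porbit s (i x)) =
  [|| y \in i @: porbit s' x, (y == d) && omem o (porbit s' x)
    | (y == d') && omem o' (porbit s' x)].
Proof.
have iI := bypass_inj H; have dF z : i z == d = false by apply/negbTE/(bypass_d H).
have d'F z : i z == d' = false by apply/negbTE/(bypass_d' H).
have dd : d == d' = false := negbTE (bypass_neq H).
have step z : z \in porbit s (i x) -> s z \in porbit s (i x).
  by rewrite mem_next_porbit.
apply/idP/idP; last first.
  have iP z : z \in porbit s' x -> i z \in porbit s (i x).
    move: z; apply: porbit_ind; last exact: porbit_id.
    move=> z xz IH; have := bypass_i H z; case: eqP => [ob|_].
      by move=> E; have := step _ (step _ IH); rewrite E (bypass_sd H) ob.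
    case: eqP => [ob|_ <-]; last exact: step.
    by move=> E; have := step _ (step _ IH); rewrite E (bypass_sd' H) ob.
  case/or3P=> [/imsetP[z xz ->] | /andP[/eqP-> ] | /andP[/eqP-> ]].
  - exact: iP.
  - rewrite /omem; case oE: o => [z|//] xz.
    by rewrite -mem_next_porbit (bypass_sd H) oE /= iP.
  - rewrite /omem; case oE: o' => [z|//] xz.
    by rewrite -mem_next_porbit (bypass_sd' H) oE /= iP.
move: y; apply: porbit_ind => [y _|]; last by rewrite imset_f ?porbit_id.
case/or3P=> [/imsetP[z xz ->] | /andP[/eqP-> ] | /andP[/eqP-> ]].
- have xsz : s' z \in porbit s' x by rewrite mem_next_porbit.
  rewrite (bypass_i H); case: (eqVneq o) => [->|_]; first by rewrite /= eqxx xsz orbT.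
  case: (eqVneq o') => [->|_]; first by rewrite /= eqxx xsz !orbT.
  by rewrite imset_f.
- rewrite /omem (bypass_sd H); case oE: o => [z|//] xz /=; by rewrite imset_f.
- rewrite /omem (bypass_sd' H); case oE: o' => [z|//] xz /=; by rewrite imset_f.
Qed.

Lemma mem_bypass_porbit_i x y :
  (i y \in porbit s (i x)) = (y \in porbit s' x).
Proof.
rewrite mem_bypass_porbit mem_imset ?(bypass_inj H) //; last exact: bypass_inj H.
by rewrite (negbTE (bypass_d H _)) (negbTE (bypass_d' H _)) !orbF.
Qed.

Lemma porbit_fixed (u : {perm T}) x : u x = x -> porbit u x = [set x].
Proof.
move=> ux; apply/setP=> y; rewrite inE; apply/idP/eqP => [|->]; last exact: porbit_id.
by move: y; apply: porbit_ind => // y _ ->.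
Qed.

(** Only a cycle reduced to [d] or to [d'] disappears. *)
Lemma orbit_count_bypass (C : pred T) : (forall x, C (s x) = C x) ->
  orbit_count s C = orbit_count s' (C \o i) + ((o == None) && C d) + ((o' == None) && C d').
Proof.
move=> Cs.
pose X := [set porbit s (i x) | x in [set x | C (i x)]].
pose Y (b : bool) y := if b then [set porbit s y] else set0.
have cY b y : #|Y b y| = b by rewrite /Y; case: b; rewrite ?cards1 ?cards0.
rewrite /orbit_count.
have -> : [set porbit s y | y in [set y | C y]] =
   X :|: Y ((o == None) && C d) d :|: Y ((o' == None) && C d') d'.
  apply/setP=> A; rewrite !inE; apply/imsetP/idP; last first.
    case/orP=> [/orP[/imsetP[x] |]|].
    - by rewrite inE => Cx ->; exists (i x); rewrite ?inE.
    - rewrite /Y; case: ifP => [/andP[_ Cd]|]; rewrite !inE // => /eqP ->.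
      by exists d; rewrite ?inE.
    - rewrite /Y; case: ifP => [/andP[_ Cd]|]; rewrite !inE // => /eqP ->.
      by exists d'; rewrite ?inE.
  have inX x : C (i x) -> porbit s (i x) \in X by move=> Cx; rewrite imset_f ?inE.
  case=> y; rewrite inE => Cy ->; case: (bypass_cov H y) Cy => [->|->|[x ->]] Cy.
  - case oE: o => [x|] /=; last by rewrite /Y Cy porbit_fixed ?inE ?eqxx ?orbT //
    (bypass_sd H) oE.
    by rewrite -porbit_next (bypass_sd H) oE /= inX // -[i x]/(oapp i d (Some x)) -oE
      -(bypass_sd H) Cs.
  - case oE: o' => [x|] /=; last by rewrite /Y Cy porbit_fixed ?inE ?eqxx ?orbT //
    (bypass_sd' H) oE.
    by rewrite -porbit_next (bypass_sd' H) oE /= inX // -[i x]/(oapp i d' (Some x)) -oE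
      -(bypass_sd' H) Cs.
  - by rewrite inX.
have XY x b y : (y \notin porbit s (i x)) -> porbit s (i x) \notin Y b y.
  rewrite /Y; case: b; rewrite !inE //; apply: contra => /eqP ->.
  exact: porbit_id.
have dX x : o = None -> d \notin porbit s (i x).
  move=> oE; rewrite porbit_sym porbit_fixed ?inE ?(bypass_d H) //.
  by rewrite (bypass_sd H) oE.
have d'X x : o' = None -> d' \notin porbit s (i x).
  move=> oE; rewrite porbit_sym porbit_fixed ?inE ?(bypass_d' H) //.
  by rewrite (bypass_sd' H) oE.
rewrite !cardsU !cY.
have -> : X :&: Y ((o == None) && C d) d = set0.
  apply/setP=> A; rewrite !inE; apply/negbTE/negP=> /andP[/imsetP[x _ ->]].
  case: eqP => [oE|_]; last by rewrite inE.
  by apply/negP; apply: XY; apply: dX.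
have -> : (X :|: Y ((o == None) && C d) d) :&: Y ((o' == None) && C d') d' = set0.
  apply/setP=> A; rewrite !inE; apply/negbTE/negP=> /andP[/orP[/imsetP[x _ ->]|]].
    case: eqP => [oE|_]; last by rewrite inE.
    by apply/negP; apply: XY; apply: d'X.
  rewrite /Y; case: ifP => [/andP[/eqP oE _]|_]; rewrite inE // => /eqP ->.
  case: ifP => _; rewrite inE // eq_porbit_mem porbit_sym porbit_fixed.
    by rewrite inE eq_sym (negbTE (bypass_neq H)).
  by rewrite (bypass_sd H) oE.
rewrite !cards0 !subn0; congr (_ + _ + _).
exact: orbit_count_emb (fun x y _ _ => mem_bypass_porbit_i x y).
Qed.

End Bypass.

(** * Vertex cycles under contraction of an edge *)

Section Contraction.

Lemma iter_porbit_inj (T : finType) (s : {perm T}) x m n :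
  m < #|porbit s x| -> n < #|porbit s x| -> iter m s x = iter n s x -> m = n.
Proof.
move=> mx nx E; apply/eqP.
rewrite -(nth_uniq x _ _ (uniq_traject_porbit s x)) ?size_traject //.
by rewrite !nth_traject // E.
Qed.

Lemma iter_mem_porbit (T : finType) (s : {perm T}) x m : iter m s x \in porbit s x.
Proof. by rewrite -permX mem_porbit. Qed.

Lemma mem_porbit_iter (T : finType) (s : {perm T}) x y :
  y \in porbit s x -> exists2 m, m < #|porbit s x| & y = iter m s x.
Proof. by rewrite porbit_traject => /trajectP. Qed.

Variables T T' : finType.

(** Contraction of the edge with darts [d] and [d'], seen on the rotation R
    of the darts around vertices. Composing R with the transposition of [d]
    and [d'] joins their vertex cycles when these differ (a link), and cuts
    their common cycle in two when they agree (a loop); the two darts are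
    then left out. The options a and b are the darts that follow [d] and
    [d'] around their vertices: the transposition exchanges the successors,
    which is why b comes before a. *)
Definition contraction (R : {perm T}) (R' : {perm T'}) (i : T' -> T) (d d' : T)
    (a b : option T') : Prop :=
  bypass (tperm d d' * R)%g R' i d d' b a.

Lemma contraction_i R R' i d d' a b x : contraction R R' i d d' a b ->
  R (i x) = if b == Some (R' x) then d else
            if a == Some (R' x) then d' else i (R' x).
Proof.
move=> H; have := bypass_i H x; rewrite permM tpermD // eq_sym.
  exact: bypass_d H x.
exact: bypass_d' H x.
Qed.

Lemma contraction_d R R' i d d' a b : contraction R R' i d d' a b -> R d = oapp i d' a.
Proof. by move=> H; have := bypass_sd' H; rewrite permM tpermR. Qed.

Lemma contraction_d' R R' i d d' a b : contraction R R' i d d' a b -> R d' = oapp i d b.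
Proof. by move=> H; have := bypass_sd H; rewrite permM tpermL. Qed.

Lemma contraction_sym R R' i d d' a b : contraction R R' i d d' a b -> contraction R R' i
  d' d b a.
Proof.
move=> H; split; try by case: H.
- by rewrite eq_sym (bypass_neq H).
- by move=> y; case: (bypass_cov H y); [constructor 2 | constructor 1 | constructor 3].
- by move=> x ax bx; apply: (bypass_opt H bx ax).
- move=> x; rewrite tpermC (bypass_i H); case: (eqVneq b) => [bE|//].
  by case: (eqVneq a) => [aE|//]; case: (bypass_opt H bE aE).
- by rewrite tpermC (bypass_sd' H).
- by rewrite tpermC (bypass_sd H).
Qed.

Section FirstRun.
Variables (R : {perm T}) (R' : {perm T'}) (i : T' -> T) (d d' : T).

(** The rotations R and [R'] agree along the run of darts that starts after
    [d], as long as it reaches neither end. *)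
Lemma contraction_run a b x k : contraction R R' i d d' (Some x) b -> a = Some x ->
  (forall m, 0 < m < k -> iter m R' x != x /\ b != Some (iter m R' x)) ->
  forall m, m < k -> iter m.+1 R d = i (iter m R' x).
Proof.
move=> H aE Hk; elim=> [|m IHm] lt_mk; first by rewrite /= (contraction_d H).
rewrite iterS IHm 1?ltnW // (contraction_i _ H) -iterS.
have [//|mx mb] := Hk m.+1; rewrite (negbTE mb).
by rewrite (inj_eq Some_inj) eq_sym (negbTE mx).
Qed.

(** When b lies k steps after a = x on one vertex cycle, the run from a
    stops just before b and closes up at [d]: the cycle was the join of two
    vertices. *)
Lemma contraction_link x k : 0 < k < #|porbit R' x| ->
  contraction R R' i d d' (Some x) (Some (iter k R' x)) ->
  porbit R d =i d :: map i (traject R' x k) /\ #|porbit R d| = k.+1.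
Proof.
case/andP=> k_gt0 lt_kx H.
have kx m : m <= k -> m < #|porbit R' x| by move=> mk; apply: leq_ltn_trans lt_kx.
have run := contraction_run H erefl (k := k) _.
have {run} run : forall m, m < k -> iter m.+1 R d = i (iter m R' x).
  apply: run => m /andP[m0 mk]; split.
    apply/eqP => /(iter_porbit_inj (n := 0)); rewrite (kx m (ltnW mk)) => /(_ isT).
    by rewrite (kx 0) // => /(_ isT) mE; rewrite mE in m0.
  apply/eqP => -[/iter_porbit_inj]; rewrite lt_kx (kx m (ltnW mk)) => /(_ isT isT) E.
  by rewrite E ltnn in mk.
(* The run has darts 0 to k - 1; the last one precedes b, so it returns to d. *)
have last_d : R (i (iter k.-1 R' x)) = d.
  by rewrite (contraction_i _ H) -iterS prednK // eqxx.
have E : porbit R d =i d :: map i (traject R' x k).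
  move=> y; apply/idP/idP.
    move: y; apply: porbit_ind => [y _|]; last by rewrite inE eqxx.
    rewrite inE => /predU1P[->|/mapP[_ /trajectP[m lt_mk ->] ->]].
      rewrite (contraction_d H) inE -[oapp _ _ _]/(i x) map_f ?orbT //.
      by apply/trajectP; exists 0.
    have [mE|mk] := eqVneq m.+1 k.
      by rewrite (_ : m = k.-1) ?last_d ?inE ?eqxx // -mE.
    have lt_m1k : m.+1 < k by rewrite ltn_neqAle mk.
    rewrite -run // -iterS run // inE map_f ?orbT //.
    by apply/trajectP; exists m.+1.
  rewrite inE => /predU1P[->|/mapP[_ /trajectP[m lt_mk ->] ->]]; first exact: porbit_id.
  by rewrite -run // iter_mem_porbit.
split=> //.
rewrite (eq_card E) (card_uniqP _) /= ?size_map ?size_traject //.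
apply/andP; split.
  by apply/mapP=> -[y _ /eqP]; rewrite eq_sym (negbTE (bypass_d H y)).
rewrite map_inj_uniq; last exact: bypass_inj H.
have := uniq_traject_porbit R' x.
rewrite -(subnK (ltnW lt_kx)) addnC.
by rewrite trajectD cat_uniq => /andP[].
Qed.

End FirstRun.

Section Exchange.
Variables (R : {perm T}) (R' : {perm T'}) (i : T' -> T) (d d' : T).

(** The roles of [d] and [d'] can be exchanged, so the rest of the cycle is
    the vertex of [d']. *)
Lemma contraction_link_card x k : 0 < k < #|porbit R' x| ->
  contraction R R' i d d' (Some x) (Some (iter k R' x)) ->
  [/\ d' \notin porbit R d, #|porbit R d| = k.+1 &
      #|porbit R d'| = (#|porbit R' x| - k).+1].
Proof.
move=> kx H; have [E cE] := contraction_link kx H; split=> //.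
  rewrite E inE negb_or eq_sym (bypass_neq H).
  by apply/mapP=> -[y _ /eqP]; rewrite eq_sym (negbTE (bypass_d' H y)).
case/andP: kx => k0 kx.
have H' := contraction_sym H; set y := iter k R' x in H'.
have xy : porbit R' y = porbit R' x by apply/eqP; rewrite eq_porbit_mem iter_mem_porbit.
have yE : x = iter (#|porbit R' x| - k) R' y by rewrite -iterD subnK ?iter_porbit // ltnW.
rewrite [in Some x]yE in H'.
suff : 0 < #|porbit R' x| - k < #|porbit R' y|.
  by move=> /contraction_link /(_ H') [].
by rewrite xy subn_gt0 kx /= ltn_subrL k0 (leq_trans _ kx).
Qed.

(** When b is not on the cycle of a, the run from a exhausts this cycle and
    leads from [d] to [d']. *)
Lemma contraction_half_loop a b : contraction R R' i d d' a b ->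
  (forall x, a = Some x -> ~~ omem b (porbit R' x)) ->
  d' \in porbit R d /\
  forall x, a = Some x -> {subset i @: porbit R' x <= porbit R d}.
Proof.
move=> H; case: a H => [x|] H ab; last first.
  by split=> //; rewrite -[d'](contraction_d H) mem_porbit_next.
have run : forall m, m < #|porbit R' x| -> iter m.+1 R d = i (iter m R' x).
  apply: contraction_run H erefl _ => m /andP[m0 mk]; split.
    apply/eqP => /(iter_porbit_inj (n := 0)).
    by rewrite mk (leq_trans _ mk) // => /(_ isT isT) E; rewrite E in m0.
  apply: contra (ab x erefl) => /eqP ->; exact: iter_mem_porbit.
have o_gt0 : 0 < #|porbit R' x| by rewrite lt0n card_porbit_neq0.
split.
  have E : iter #|porbit R' x|.+1 R d = d'.
    rewrite -(prednK o_gt0) iterS run ?prednK // (contraction_i _ H) -iterS prednK //.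
    rewrite iter_porbit eqxx; case: eqP => // bE.
    by case: (bypass_opt H bE).
  by rewrite -E iter_mem_porbit.
move=> _ [<-] y /imsetP[z /mem_porbit_iter[m lt_m ->] ->].
by rewrite -run // iter_mem_porbit.
Qed.

Lemma contraction_closed a b : contraction R R' i d d' a b ->
  forall y, y \in porbit R d ->
  [|| y == d, y == d',
    y \in i @: [set x | omem a (porbit R' x)] |
    y \in i @: [set x | omem b (porbit R' x)]].
Proof.
move=> H; apply: porbit_ind => [y _|]; last by rewrite eqxx.
have next (o : option T') (B : {set T'}) x : B = [set x | omem o (porbit R' x)] ->
   i x \in i @: B -> R' x \in B.
  move=> -> ; rewrite mem_imset ?inE; last exact: bypass_inj H.
  by rewrite porbit_next.
have R_i x : R (i x) = d \/ R (i x) = d' \/ R (i x) = i (R' x).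
  rewrite (contraction_i _ H); case: eqP; first by left.
  by case: eqP; right; [left|right].
case/or4P=> [/eqP->|/eqP->|/imsetP[x xa ->]|/imsetP[x xb ->]].
- rewrite (contraction_d H); case: (a) => [x|] /=; last by rewrite eqxx orbT.
  by apply/or4P; constructor 3; rewrite imset_f // inE porbit_id.
- rewrite (contraction_d' H); case: (b) => [x|] /=; last by rewrite eqxx.
  by apply/or4P; constructor 4; rewrite imset_f // inE porbit_id.
- case: (R_i x) => [->|[->|->]]; rewrite ?eqxx ?orbT //.
  by apply/or4P; constructor 3; rewrite imset_f //; apply: next erefl _; rewrite imset_f.
- case: (R_i x) => [->|[->|->]]; rewrite ?eqxx ?orbT //.
  by apply/or4P; constructor 4; rewrite imset_f //; apply: next erefl _; rewrite imset_f.
Qed.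

End Exchange.

Section VertexCycles.
Variables (R : {perm T}) (R' : {perm T'}) (i : T' -> T) (d d' : T).
Variables a b : option T'.
Hypothesis H : contraction R R' i d d' a b.

Definition opt_orbit_size (o : option T') := oapp (fun x => #|porbit R' x|) 0 o.

(** The runs from [d] to [d'] and from [d'] to [d] together form the vertex
    of the loop. *)
Lemma contraction_loop : (forall x, a = Some x -> ~~ omem b (porbit R' x)) ->
  d' \in porbit R d /\ #|porbit R d| = (opt_orbit_size a + opt_orbit_size b).+2.
Proof.
move=> ab; have [dd' aE] := contraction_half_loop H ab.
have ba x : b = Some x -> ~~ omem a (porbit R' x).
  move=> bE; case aE': a => [y|] //=; have := ab y aE'.
  by rewrite bE /= porbit_sym.
have [_ bE] := contraction_half_loop (contraction_sym H) ba.
have Edd' : porbit R d' = porbit R d by apply/eqP; rewrite eq_porbit_mem.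
split=> //.
pose A (o : option T') := oapp (porbit R') set0 o.
have AE o x : omem o (porbit R' x) = (x \in A o).
  by case: o => [y|] /=; rewrite ?inE // porbit_sym.
have cA o : #|A o| = opt_orbit_size o by case: o => [y|] //=; rewrite cards0.
have iI := bypass_inj H.
have -> : porbit R d = d |: (d' |: i @: (A a :|: A b)).
  apply/setP=> y; rewrite !inE imsetU inE; apply/idP/idP.
    move/(contraction_closed H).
    have E o : [set x | omem o (porbit R' x)] = A o by apply/setP=> x; rewrite inE AE.
    by rewrite !E.
  case/or4P=> [/eqP->|/eqP->||] //; first exact: porbit_id.
    by case aE': a => [x|]; [exact: aE | rewrite imset0 inE].
  by rewrite -Edd'; case bE': b => [x|]; [exact: bE | rewrite imset0 inE].
rewrite !cardsU1 !inE negb_or (bypass_neq H) /=.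
have -> : d \notin i @: (A a :|: A b).
  by apply/imsetP=> -[x _ /eqP]; rewrite eq_sym (negbTE (bypass_d H x)).
have -> : d' \notin i @: (A a :|: A b).
  by apply/imsetP=> -[x _ /eqP]; rewrite eq_sym (negbTE (bypass_d' H x)).
rewrite card_imset // cardsU !cA.
suff -> : A a :&: A b = set0 by rewrite cards0 subn0 !add1n.
apply/setP=> y; rewrite !inE.
case aE': a => [x|]; rewrite /= ?inE //; case bE': b => [z|]; rewrite /= ?inE ?andbF //.
have := ab x aE'; rewrite bE' /=; apply: contraNF => /andP[yx yz].
have /eqP <- : porbit R' y == porbit R' x by rewrite eq_porbit_mem.
by rewrite porbit_sym.
Qed.

Lemma contraction_free x : ~~ omem a (porbit R' x) -> ~~ omem b (porbit R' x) ->
  porbit R (i x) = i @: porbit R' x.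
Proof.
move=> ax bx; apply: porbit_emb => y xy; rewrite (contraction_i _ H).
have xy' : R' y \in porbit R' x by rewrite mem_next_porbit.
case: eqP => [bE|_]; first by rewrite bE /= xy' in bx.
by case: eqP => [aE|//]; rewrite aE /= xy' in ax.
Qed.

(** A vertex that contains neither end of the edge contains neither dart
    that follows an end. *)
Lemma contraction_avoid x : d \notin porbit R (i x) -> d' \notin porbit R (i x) ->
  ~~ omem a (porbit R' x) /\ ~~ omem b (porbit R' x).
Proof.
move=> dx d'x.
have sub y : y \in porbit R' x -> i y \in porbit R (i x).
  move: y; apply: porbit_ind => [y _ yx|]; last exact: porbit_id.
  have := yx; rewrite -mem_next_porbit (contraction_i _ H).
  by case: eqP => [_|_]; [rewrite (negbTE dx)| case: eqP; rewrite ?(negbTE d'x)].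
split; apply/negP.
  case aE: a => [y|//] /sub; have := contraction_d H; rewrite aE /= => <-.
  by rewrite mem_next_porbit; apply/negP.
case bE: b => [y|//] /sub; have := contraction_d' H; rewrite bE /= => <-.
by rewrite mem_next_porbit; apply/negP.
Qed.

(** Composition with a transposition changes the number of cycles by one, in
    the direction that tells links from loops. *)
Lemma contraction_orbit_count : orbit_count R predT + (d' \in porbit R d) * 2 =
  orbit_count R' predT + (a == None) + (b == None) + 1.
Proof.
have := porbits_mul_tperm R d d'; rewrite (bypass_neq H) /= -muln2.
rewrite !card_porbits (orbit_count_bypass (C := predT) H) // !andbT.
rewrite (porbit_sym R d d').
have -> : orbit_count R' (predT \o i) = orbit_count R' predT by [].
case: (_ \in _) => /=; lia.
Qed.

End VertexCycles.
End Contraction.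

(** * Permutations that alternate two colours *)

Section Colour.
Variables (T : finType) (s : {perm T}) (c : pred T).
Hypothesis cs : forall x, c (s x) = ~~ c x.

(** The permutation exchanges the two colours inside a stable set. *)
Lemma colour_half (A : {set T}) : (forall x, (s x \in A) = (x \in A)) ->
  #|A| = #|[set x in A | c x]| * 2 /\ #|A| = #|[set x in A | ~~ c x]| * 2.
Proof.
move=> sA.
have E : #|[set x in A | c x]| = #|[set x in A | ~~ c x]|.
  rewrite -(card_imset _ (@perm_inj _ s)); apply: eq_card => y.
  rewrite inE; apply/imsetP/andP.
    by case=> x; rewrite inE => /andP[Ax cx] ->; rewrite sA cs negbK.
  case=> Ay cy; exists (s^-1 y)%g; last by rewrite permKV.
  by rewrite inE -sA permKV Ay /= -[c _]negbK -cs permKV.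
have := cardsID [set x | c x] A.
have -> : A :&: [set x | c x] = [set x in A | c x] by apply/setP=> x; rewrite !inE.
have -> : A :\: [set x | c x] = [set x in A | ~~ c x].
  by apply/setP=> x; rewrite !inE andbC.
lia.
Qed.

Lemma colour_iter x k : c (iter k s x) = odd k (+) c x.
Proof. by elim: k => //= k IH; rewrite cs IH addNb. Qed.

Lemma card_porbit_even x : ~~ odd #|porbit s x|.
Proof.
by have := colour_iter x #|porbit s x|; rewrite iter_porbit; case: odd; case: (c x).
Qed.

(** Each 2-cycle contains exactly one point of either colour. *)
Lemma orbit_count_invol : (forall x, s (s x) = x) -> orbit_count s predT * 2 = #|T|.
Proof.
move=> ss; have [] := colour_half (A := setT) _; first by move=> x; rewrite !inE.
rewrite cardsT => -> _; congr (_ * 2).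
have pE x y : y \in porbit s x -> y = x \/ y = s x.
  move: y; apply: porbit_ind => [y _ [->|->]|]; rewrite ?ss; by [left|right].
have -> : orbit_count s predT = #|[set porbit s x | x in [set x in setT | c x]]|.
  apply: eq_card => A; apply/imsetP/imsetP => -[x]; last by move=> _ ->; exists x; rewrite
    ?inE.
  move=> _ ->; case cx: (c x); first by exists x; rewrite ?inE ?cx.
  by exists (s x); rewrite ?inE ?cs ?cx ?porbit_next.
apply: card_in_imset => x y; rewrite !inE /= => cx cy E.
have := porbit_id s x; rewrite E => /pE[//|xE].
by move: cx; rewrite xE cs cy.
Qed.

End Colour.

(** * Face-bipartite maps as alternately coloured darts *)

Section Seqmap.
Implicit Type M : seqmap.

(** A set of white faces is handled as a colouring of the darts. The dart
    [mapR M x] lies on the face of [mapL M x]; hence adjacent faces have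
    different colours if and only if the colour of a dart changes under
    [mapL], and then it changes under [mapR] as well. *)
Definition colour M : pred (dart M) := fun x => face_of x \in white M.

Lemma colour_L M (x : dart M) : colour (mapL M x) = ~~ colour x.
Proof.
have [_ /(_ x)] := white_bipartite M; rewrite /colour.
by case: (face_of x \in _); case: (face_of (mapL M x) \in _).
Qed.

Lemma colour_R M (x : dart M) : colour (mapR M x) = ~~ colour x.
Proof.
rewrite -colour_L /colour; suff -> : face_of (mapR M x) = face_of (mapL M x) by [].
by rewrite /face_of -(porbit_next _ (mapL M x)) permM mapL_invol.
Qed.

Lemma colour_root M : colour (Defs.root M).
Proof. exact: root_white. Qed.

Lemma colour_RL M (x : dart M) : colour (mapRL M x) = colour x.
Proof. by rewrite permM colour_R colour_L negbK. Qed.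

Lemma whiteE M : white M = [set face_of x | x in [set x | colour x]].
Proof.
have [/subsetP sub _] := white_bipartite M.
apply/setP=> A; apply/idP/imsetP => [WA|[x]]; last by rewrite inE => cx ->.
have /imsetP[x _ AE] := sub _ WA.
by exists x => //; rewrite inE /colour -[face_of x]AE.
Qed.

Lemma blackE M : faces M :\: white M = [set face_of x | x in [set x | ~~ colour x]].
Proof.
apply/setP=> A; rewrite inE; apply/andP/imsetP => [[WA /imsetP[x _ AE]]|[x]].
  by exists x => //; rewrite inE /colour -[face_of x]AE.
by rewrite inE => cx ->; split=> //; apply: imset_f.
Qed.

Lemma generated_orbit_ind (T : finType) (R L : {perm T}) (A : T -> Prop) x0 :
  (forall x, A x -> A (R x)) -> (forall x, A x -> A (L x)) -> A x0 ->
  forall x, x \in orbit 'P <<[set R; L]>>%g x0 -> A x.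
Proof.
move=> AR AL Ax0 x /orbitP[g Gg <-] {x}.
have [n [f fE ->]] := gen_prodgP Gg.
rewrite /= /aperm; elim: n f fE => [|n IHn] f fE; first by rewrite big_ord0 perm1.
rewrite big_ord_recr /= permM; have := fE ord_max; rewrite !inE => /orP[]/eqP ->.
  by apply: AR; apply: IHn => i; apply: fE.
by apply: AL; apply: IHn => i; apply: fE.
Qed.

(** Transitivity in the form of an induction principle: what holds at one
    dart and passes along both permutations holds everywhere. *)
Lemma cmap_ind (M : cmap) (A : dart M -> Prop) x0 :
  (forall x, A x -> A (mapR M x)) -> (forall x, A x -> A (mapL M x)) -> A x0 ->
  forall x, A x.
Proof.
move=> AR AL Ax0 x; apply: (generated_orbit_ind AR AL Ax0).
by rewrite (atransP (map_trans M)) ?inE.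
Qed.

Lemma transitive_of_ind (T : finType) (R L : {perm T}) x0 :
  (forall A : {set T}, x0 \in A -> (forall x, x \in A -> R x \in A) ->
      (forall x, x \in A -> L x \in A) -> forall x, x \in A) ->
  [transitive <<[set R; L]>>%g, on [set: T] | 'P].
Proof.
move=> H; apply/imsetP; exists x0; first by rewrite inE.
apply/setP=> y; rewrite inE; symmetry; apply: H => [|x|x].
- exact: orbit_refl.
- move=> xO; rewrite (orbit_trans _ xO) //; apply/orbitP; exists R => //.
  by rewrite mem_gen // !inE eqxx.
- move=> xO; rewrite (orbit_trans _ xO) //; apply/orbitP; exists L => //.
  by rewrite mem_gen // !inE eqxx orbT.
Qed.

Section Build.
Variables (T : finType) (R L : {perm T}) (c : pred T) (x0 : T) (ds : seq {set T}).
Hypotheses (Linv : forall x, L (L x) = x) (cR : forall x, c (R x) = ~~ c x)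
  (cL : forall x, c (L x) = ~~ c x) (cx0 : c x0).
Hypothesis conn : forall A : {set T}, x0 \in A -> (forall x, x \in A -> R x \in A) ->
      (forall x, x \in A -> L x \in A) -> forall x, x \in A.
Hypotheses (ds_uniq : uniq ds) (ds_sub : {subset ds <= porbits R})
  (ds_x0 : porbit R x0 \notin ds).

Lemma coloured_seqmap_free x : L x <> x.
Proof. by move=> E; have := cL x; rewrite E; case: (c x). Qed.

Definition coloured_seqmap_cmap := CMap Linv coloured_seqmap_free (transitive_of_ind conn).

Let W : {set {set dart coloured_seqmap_cmap}} :=
  [set face_of (M := coloured_seqmap_cmap) x | x in [set x : T | c x]].

(** An alternating colouring is constant on faces, because a step along a
    face changes the colour twice. *)
Lemma coloured_seqmap_mem x : (face_of (M := coloured_seqmap_cmap) x \in W) = c x.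
Proof.
apply/imsetP/idP => [[y] | cx]; last by exists x; rewrite ?inE.
rewrite inE => cy /eqP; rewrite eq_porbit_mem.
move: x; apply: (@porbit_ind _ _ c) => // z _ cz.
by rewrite permM /= cR cL negbK.
Qed.

Lemma coloured_seqmap_bip : face_bipartite W.
Proof.
split=> [|x]; last by rewrite !coloured_seqmap_mem /= cL; case: (c x).
by apply/subsetP=> _ /imsetP[x _ ->]; apply: imset_f.
Qed.

Lemma coloured_seqmap_root : face_of (M := coloured_seqmap_cmap) x0 \in W.
Proof. by rewrite coloured_seqmap_mem. Qed.

(** The converse of [colour]: an alternating colouring of the darts yields
    the set of white faces. *)
Definition coloured_seqmap : seqmap :=
  @SeqMap coloured_seqmap_cmap x0 W ds coloured_seqmap_bip coloured_seqmap_root ds_uniq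
    ds_sub ds_x0.

Lemma colour_coloured_seqmap x : colour (M := coloured_seqmap) x = c x.
Proof. exact: coloured_seqmap_mem. Qed.

End Build.
End Seqmap.

(** * Maps, the empty one included *)

Section Smap.

(** The empty map is given an empty set of darts and no root, so that it
    need not be treated apart from here on. *)
Definition smap_dart (m : smap) : finType := if m is DartMap M then dart M else void.
Definition smap_R (m : smap) : {perm smap_dart m} :=
  match m with DartMap M => mapR M | EmptyMap => 1%g end.
Definition smap_L (m : smap) : {perm smap_dart m} :=
  match m with DartMap M => mapL M | EmptyMap => 1%g end.
Definition smap_RL (m : smap) : {perm smap_dart m} := (smap_L m * smap_R m)%g.
Definition smap_colour (m : smap) : pred (smap_dart m) :=
  match m with DartMap M => @colour M | EmptyMap => predT end.
Definition smap_root (m : smap) : option (smap_dart m) :=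
  match m with DartMap M => Some (Defs.root M) | EmptyMap => None end.
Definition smap_dist (m : smap) : seq {set smap_dart m} :=
  match m with DartMap M => dist M | EmptyMap => [::] end.

Lemma smap_colour_R m x : smap_colour (smap_R m x) = ~~ smap_colour x.
Proof. by case: m x => [[]|M] // x; apply: colour_R. Qed.

Lemma smap_colour_L m x : smap_colour (smap_L m x) = ~~ smap_colour x.
Proof. by case: m x => [[]|M] // x; apply: colour_L. Qed.

Lemma smap_L_invol m x : smap_L m (smap_L m x) = x.
Proof. by case: m x => [[]|M] // x; apply: mapL_invol. Qed.

Lemma smap_colour_root m x : smap_root m = Some x -> smap_colour x.
Proof. by case: m x => [[]|M] // x [<-]; apply: colour_root. Qed.

Lemma smap_ind m (A : smap_dart m -> Prop) :
  (forall x, A x -> A (smap_R m x)) -> (forall x, A x -> A (smap_L m x)) ->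
  (forall x, smap_root m = Some x -> A x) -> forall x, A x.
Proof.
case: m A => [|M] A AR AL Ar x; first by case: x.
by apply: (cmap_ind AR AL (Ar _ erefl)).
Qed.

Lemma smap_dist_uniq m : uniq (smap_dist m).
Proof. by case: m => //= M; apply: dist_uniq. Qed.

Lemma smap_dist_orbit m v : v \in smap_dist m -> exists x, v = porbit (smap_R m) x.
Proof. by case: m v => //= M v /dist_vertices /imsetP[x _ ->]; exists x. Qed.

Lemma smap_dist_root m v x : v \in smap_dist m -> smap_root m = Some x -> x \notin v.
Proof.
move=> vm rx; have [y vE] := smap_dist_orbit vm; apply/negP => xv.
have vr : v = porbit (smap_R m) x by apply/eqP; rewrite vE eq_porbit_mem porbit_sym -vE.
case: m x v vm rx {y vE} vr xv => //= M x v vm [<-] vE _.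
by have := dist_root M; rewrite /vertex_of -vE vm.
Qed.

Lemma orbit_count_void (T : finType) (s : {perm T}) C : #|T| = 0 -> orbit_count s C = 0.
Proof.
move=> T0; apply/eqP; rewrite -leqn0 (leq_trans (leq_imset_card _ _)) //.
by rewrite -T0 max_card.
Qed.

(** The vertex and the white face of the empty map are not orbits of darts:
    they appear as a correction when there is no root. *)
Lemma nb_verticesE m : nb_vertices m = orbit_count (smap_R m) predT + (smap_root m == None).
Proof.
by case: m => [|M] /=; rewrite ?addn0;
  [rewrite orbit_count_void // card_void | exact: card_porbits].
Qed.

Lemma nb_facesE m : nb_faces m = orbit_count (smap_RL m) predT + (smap_root m == None).
Proof.
by case: m => [|M] /=; rewrite ?addn0;
  [rewrite orbit_count_void // card_void | exact: card_porbits].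
Qed.

Lemma nb_whiteE m : nb_white m = orbit_count (smap_RL m) (@smap_colour m) +
  (smap_root m == None).
Proof.
by case: m => [|M] /=; rewrite ?addn0;
  [rewrite orbit_count_void // card_void | rewrite whiteE].
Qed.

Lemma nb_blackE m : nb_black m = orbit_count (smap_RL m) (fun x => ~~ @smap_colour m x).
Proof.
by case: m => [|M] /=; rewrite ?addn0;
  [rewrite orbit_count_void // card_void | rewrite blackE].
Qed.

Lemma nb_edgesE m : nb_edges m * 2 = #|smap_dart m|.
Proof.
case: m => [|M] /=; first by rewrite card_void.
by rewrite card_porbits (orbit_count_invol (@colour_L M) (@mapL_invol M)).
Qed.

Lemma root_degreeE m : root_degree m = opt_orbit_size (smap_R m) (smap_root m).
Proof. by case: m. Qed.

Lemma dist_degreesE m : dist_degrees m = [seq #|v| | v : {set smap_dart m} <- smap_dist m].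
Proof. by case: m. Qed.

(** The signature is multiplicative, and that of a permutation is given by
    the parity of its number of cycles. Every map has therefore an integral
    genus. *)
Lemma genus_even m : exists h, nb_vertices m + nb_edges m + nb_faces m = h * 2.
Proof.
case: m => [|M]; first by exists 1.
have E := nb_edgesE (DartMap M).
have : odd_perm (mapRL M) = odd_perm (mapL M) (+) odd_perm (mapR M) by rewrite odd_permM.
rewrite /odd_perm -/(vertices M) -/(edges M) -/(faces M) /= in E *.
rewrite -E => H; exists ((#|vertices M| + #|edges M| + #|faces M|)./2).
rewrite muln2 halfK.
have -> : odd (#|vertices M| + #|edges M| + #|faces M|) = false; last by rewrite subn0.
rewrite !oddD; move: H; rewrite muln2 odd_double.
by case: (odd #|vertices M|); case: (odd #|edges M|); case: (odd #|faces M|).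
Qed.

Lemma root_degree_even m : ~~ odd (root_degree m).
Proof.
rewrite root_degreeE; case: (smap_root m) => //= x; exact: card_porbit_even
  (@smap_colour_R m) x.
Qed.

Lemma smap_dist_even m v : v \in smap_dist m -> ~~ odd #|v|.
Proof.
by move=> /smap_dist_orbit[x ->]; exact: card_porbit_even (@smap_colour_R m) x.
Qed.

Definition commute2 (T T' : finType) (R L : {perm T}) (R' L' : {perm T'}) (f : T -> T') :=
  (forall x, f (R x) = R' (f x)) /\ (forall x, f (L x) = L' (f x)).

Definition smap_iso (m m' : smap) (f : smap_dart m -> smap_dart m') : Prop :=
  [/\ bijective f, commute2 (smap_R m) (smap_L m) (smap_R m') (smap_L m') f,
      omap f (smap_root m) = smap_root m' & [seq f @: (v : {set _}) | v <- smap_dist m] =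
        smap_dist m'].

(** The root is white and colours alternate, so they are determined by the
    two permutations. *)
Lemma smap_iso_colour m m' (f : smap_dart m -> smap_dart m') : commute2 (smap_R m)
  (smap_L m) (smap_R m') (smap_L m') f ->
   omap f (smap_root m) = smap_root m' -> forall x, smap_colour (f x) = smap_colour x.
Proof.
move=> [fR fL] fr; apply: smap_ind => [x|x|x xr].
- by rewrite fR !smap_colour_R => ->.
- by rewrite fL !smap_colour_L => ->.
rewrite (smap_colour_root xr); apply: (@smap_colour_root m').
by rewrite -fr xr.
Qed.

(** The condition on white faces can be dropped, since colours are
    determined by the root. *)
Lemma isoP m m' : iso m m' <-> exists f, @smap_iso m m' f.
Proof.
case: m m' => [|M] [|N] /=; split=> //.
- by move=> _; exists id; split=> //; exists id.
- by case=> f [].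
- by case=> f [].
- by case=> f [[fB fR fL] [fr _ fd]]; exists f; split=> //=; rewrite fr.
case=> f H; have [fB [fR fL] /= [fr] fd] := H; exists f; split=> //; split=> //.
have fc : forall x, colour (f x) = colour x.
  exact: (@smap_iso_colour (DartMap M) (DartMap N) f) (conj fR fL) (congr1 Some fr).
have fF x : mapRL N (f x) = f (mapRL M x) by rewrite !permM fR fL.
have fE x : face_of (f x) = f @: face_of x by apply: porbit_emb => y _; apply: fF.
rewrite !whiteE; apply/setP=> A; apply/imsetP/imsetP.
  case=> F /imsetP[x]; rewrite inE => cx -> ->.
  by exists (f x); rewrite ?inE ?fc ?fE.
case: fB => g fK gK; case=> y; rewrite inE => cy ->.
exists (face_of (g y)); last by rewrite -fE gK.
by apply: imset_f; rewrite inE -fc gK.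
Qed.

Lemma iso_sym m m' : iso m m' -> iso m' m.
Proof.
move/isoP=> [f [[g fK gK] [fR fL] fr fd]]; apply/isoP; exists g; split.
- by exists f.
- by split=> x; apply: (can_inj fK); rewrite ?fR ?fL !gK.
- by rewrite -fr; case: (smap_root m) => //= x; rewrite fK.
- rewrite -fd -map_comp -[RHS]map_id; apply: eq_map => v /=.
  by rewrite -imset_comp (eq_imset (g := id)) ?imset_id // => x /=; rewrite fK.
Qed.

Lemma iso_trans m1 m2 m3 : iso m1 m2 -> iso m2 m3 -> iso m1 m3.
Proof.
move=> /isoP[f [fB [fR fL] fr fd]] /isoP[h [hB [hR hL] hr hd]]; apply/isoP.
exists (h \o f); split.
- exact: bij_comp.
- by split=> x /=; rewrite ?fR ?fL ?hR ?hL.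
- by rewrite -hr -fr; case: (smap_root m1).
- by rewrite -hd -fd -map_comp; apply: eq_map => v /=; rewrite imset_comp.
Qed.

Lemma iso_refl m : iso m m.
Proof.
apply/isoP; exists id; split=> //; [by exists id| by case: smap_root |].
by rewrite -[RHS]map_id; apply: eq_map => v; rewrite imset_id.
Qed.

Lemma orbit_count_bij (T T' : finType) (s : {perm T}) (s' : {perm T'}) (f : T -> T') C :
  bijective f -> (forall x, f (s x) = s' (f x)) -> orbit_count s' C = orbit_count s
    (C \o f).
Proof.
move=> [g fK gK] fs; rewrite -(orbit_count_emb (s := s') (i := f)); last first.
  by move=> x y _ _; rewrite (porbit_emb_inj (s' := s)) //; apply: can_inj fK.
apply: eq_card => A; apply/imsetP/imsetP => -[x]; rewrite inE => /= Cx ->.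
  by exists (g x); rewrite ?inE /= gK.
by exists (f x); rewrite ?inE.
Qed.

Lemma iso_counts m m' : iso m m' ->
  [/\ nb_vertices m = nb_vertices m', nb_edges m = nb_edges m',
      nb_faces m = nb_faces m', nb_white m = nb_white m' & nb_black m = nb_black m'] /\
  root_degree m = root_degree m' /\ dist_degrees m = dist_degrees m'.
Proof.
move=> /isoP[f [fB [fR fL] fr fd]].
have fF x : f (smap_RL m x) = smap_RL m' (f x) by rewrite !permM fR fL.
have fc := smap_iso_colour (conj fR fL) fr.
have rE : (smap_root m == None) = (smap_root m' == None) by rewrite -fr; case:
  (smap_root m).
rewrite !nb_verticesE !nb_facesE !nb_whiteE !nb_blackE rE.
rewrite (orbit_count_bij predT fB fR) (orbit_count_bij predT fB fF)
  !(orbit_count_bij _ fB fF).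
split; first split=> //.
- by apply: double_inj; rewrite -!muln2 !nb_edgesE; apply: bij_eq_card fB.
- by congr addn; apply: eq_orbit_count => x /=; rewrite fc.
- by apply: eq_orbit_count => x /=; rewrite fc.
split.
  rewrite !root_degreeE -fr; case: (smap_root m) => //= x.
  by rewrite (porbit_emb (s' := smap_R m)) ?card_imset //; apply: bij_inj.
rewrite !dist_degreesE -fd -map_comp; apply: eq_map => v /=.
by rewrite card_imset //; apply: bij_inj.
Qed.

End Smap.

(** * Restoring the root edge *)

Section CutMap.

(** What is left of a rooted map when its root edge is contracted: the
    remaining darts, and the darts [cut_a] and [cut_b] that followed the
    root and its opposite around their vertices ([None] if there was no such
    remaining dart). Colours are those of the original map. *)
Record cutmap := CutMap {
  cut_dart : finType;
  cut_R : {perm cut_dart};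
  cut_L : {perm cut_dart};
  cut_colour : pred cut_dart;
  cut_a : option cut_dart;
  cut_b : option cut_dart;
  cut_dist : seq {set cut_dart}
}.

(** The remainder need not be connected, but every component meets [cut_a]
    or [cut_b], which is the content of [valid_ind]. The former root is
    white, so that colours alternate to black at [cut_a] and to white at
    [cut_b]. Distinguished vertices that contained an end of the root edge
    are no longer in the list. *)
Record cut_valid (P : cutmap) : Prop := CutValid {
  valid_L_invol : forall x, cut_L P (cut_L P x) = x;
  valid_colour_R : forall x, cut_colour (cut_R P x) = ~~ cut_colour x;
  valid_colour_L : forall x, cut_colour (cut_L P x) = ~~ cut_colour x;
  valid_a_black : forall x, cut_a P = Some x -> ~~ cut_colour x;
  valid_b_white : forall x, cut_b P = Some x -> cut_colour x;
  valid_ind : forall A : cut_dart P -> Prop,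
    (forall x, A x -> A (cut_R P x)) -> (forall x, A x -> A (cut_L P x)) ->
    (forall x, cut_a P = Some x -> A x) -> (forall x, cut_b P = Some x -> A x) ->
    forall x, A x;
  valid_dist_uniq : uniq (cut_dist P);
  valid_dist_orbit : forall v, v \in cut_dist P -> exists x, v = porbit (cut_R P) x;
  valid_dist_a : forall v x, v \in cut_dist P -> cut_a P = Some x -> x \notin v;
  valid_dist_b : forall v x, v \in cut_dist P -> cut_b P = Some x -> x \notin v }.

Definition insert_at (T : Type) (j : option nat) (v : T) (s : seq T) : seq T :=
  if j is Some k then take k s ++ v :: drop k s else s.

(** The map M is P with its root edge put back, where i embeds the remaining
    darts. A value [Some k] of j means that the end of the root edge other
    than the root vertex is distinguished, with label k. *)
Record reduces (M : seqmap) (P : cutmap) (j : option nat) (i : cut_dart P -> dart M) :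
  Prop := Reduces {
  reduces_contraction : contraction (mapR M) (cut_R P) i (Defs.root M)
    (mapL M (Defs.root M)) (cut_a P) (cut_b P);
  reduces_L : forall x, mapL M (i x) = i (cut_L P x);
  reduces_colour : forall x, colour (i x) = cut_colour x;
  reduces_dist : dist M = insert_at j (vertex_of (mapL M (Defs.root M)))
                      [seq i @: (v : {set cut_dart P}) | v <- cut_dist P];
  reduces_label : forall k, j = Some k -> k <= size (cut_dist P) }.

(** The root edge is not a loop if and only if the two marked darts end up
    on the same vertex of the remainder. *)
Definition root_link (P : cutmap) : Prop :=
  exists x y, [/\ cut_a P = Some x, cut_b P = Some y & y \in porbit (cut_R P) x].

(** The distance from [cut_a] to [cut_b] is odd since their colours differ;
    it is the degree of the root vertex minus one. *)
Lemma root_link_spec P : cut_valid P -> root_link P ->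
  exists x k, [/\ cut_a P = Some x, 0 < k < #|porbit (cut_R P) x|,
                  cut_b P = Some (iter k (cut_R P) x) & odd k].
Proof.
move=> V [x [y [xE yE /mem_porbit_iter[k lt_k kE]]]]; exists x, k.
have kO : odd k.
  have := valid_b_white V yE; rewrite kE (colour_iter (valid_colour_R V)).
  by have := valid_a_black V xE; case: (cut_colour x); case: odd.
by rewrite xE yE kE lt_k lt0n kO; split=> //; case: k kO {lt_k kE}.
Qed.

Lemma cut_dist_omem P v x : cut_valid P -> v \in cut_dist P -> x \in v ->
  [/\ v = porbit (cut_R P) x, ~~ omem (cut_a P) v & ~~ omem (cut_b P) v].
Proof.
move=> V vd xv; have [y vE] := valid_dist_orbit V vd; split.
- by apply/eqP; rewrite vE eq_porbit_mem porbit_sym -vE.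
- by case E: (cut_a P) => [z|] //=; apply: valid_dist_a E.
- by case E: (cut_b P) => [z|] //=; apply: valid_dist_b E.
Qed.

Lemma insert_at_perm (T : eqType) k (v : T) s :
  perm_eq (insert_at (Some k) v s) (v :: s).
Proof.
by rewrite /= -cat1s perm_catCA /= perm_cons cat_take_drop.
Qed.

Section Glue.
Variables (P : cutmap) (j : option nat).
Hypotheses (V : cut_valid P) (Hj : forall k, j = Some k -> k <= size (cut_dist P) /\
  root_link P).

Let T := (cut_dart P + bool)%type.

(** The restored root is [inr true] and its opposite [inr false]; each is
    inserted so as to be followed by [cut_a], respectively [cut_b]. *)
Definition glue_next (y : T) : T :=
  match y with
  | inl x => if cut_b P == Some (cut_R P x) then inr true else
             if cut_a P == Some (cut_R P x) then inr false else inl (cut_R P x)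
  | inr true => oapp inl (inr false) (cut_a P)
  | inr false => oapp inl (inr true) (cut_b P)
  end.

Definition glue_other (y : T) : T :=
  match y with inl x => inl (cut_L P x) | inr b => inr (~~ b) end.

Definition glue_colour (y : T) : bool :=
  match y with inl x => cut_colour x | inr b => b end.

Lemma cut_a_neq_b x : cut_b P = Some x -> cut_a P = Some x -> False.
Proof. by move=> /(valid_b_white V) cx /(valid_a_black V); rewrite cx. Qed.

Lemma glue_next_inj : injective glue_next.
Proof.
have E1 x : cut_b P = Some x -> (cut_a P == Some x) = false.
  by move=> bx; apply/negP => /eqP /cut_a_neq_b; apply.
move=> [x|[]] [y|[]] //=.
- case: (eqVneq (cut_b P)) => [bx|nbx].
    rewrite bx (inj_eq Some_inj) (inj_eq perm_inj); case: eqP => [->//|_].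
    by case: ifP.
  case: (eqVneq (cut_a P)) => [ax|nax].
    rewrite ax (inj_eq Some_inj) (inj_eq perm_inj).
    by case: ifP => // _; case: eqP => [->//|].
  by case: ifP => // _; case: ifP => // _ [/perm_inj->].
- case: (eqVneq (cut_b P)) => [bx|nbx]; first by case: (cut_a P).
  case: (eqVneq (cut_a P)) => [->|nax] //.
  by case: (cut_a P) nax => //= z /eqP nz [zE]; rewrite zE in nz.
- case: (eqVneq (cut_b P)) => [->|nbx] //.
  case: (eqVneq (cut_a P)) => [ax|nax]; first by case: (cut_b P).
  by case: (cut_b P) nbx => //= z /eqP nz [zE]; rewrite zE in nz.
- case: (eqVneq (cut_b P)) => [bx|nbx]; first by case: (cut_a P).
  case: (eqVneq (cut_a P)) => [->|nax] //.
  by case: (cut_a P) nax => //= z /eqP nz [zE]; rewrite zE in nz.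
- case aE: (cut_a P) => [z|] //=; case bE: (cut_b P) => [t|] //= [zt].
  by case: (@cut_a_neq_b z); rewrite ?aE ?bE ?zt.
- case: (eqVneq (cut_b P)) => [->|nbx] //.
  case: (eqVneq (cut_a P)) => [ax|nax]; first by case: (cut_b P).
  by case: (cut_b P) nbx => //= z /eqP nz [zE]; rewrite zE in nz.
- case aE: (cut_a P) => [z|] //=; case bE: (cut_b P) => [t|] //= [zt].
  by case: (@cut_a_neq_b z); rewrite ?aE ?bE ?zt.
Qed.

Lemma glue_other_invol : involutive glue_other.
Proof. by case=> [x|b] /=; rewrite ?(valid_L_invol V) ?negbK. Qed.

Definition glue_R : {perm T} := perm glue_next_inj.
Definition glue_L : {perm T} := perm (inv_inj glue_other_invol).

Lemma glue_contraction : contraction glue_R (cut_R P) inl (inr true) (inr false) (cut_a P)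
  (cut_b P).
Proof.
split=> //.
- by move=> x y [].
- by case=> [x|[]]; [constructor 3; exists x | constructor 1 | constructor 2].
- exact: cut_a_neq_b.
- by move=> x; rewrite permM tpermD // permE.
- by rewrite permM tpermL permE.
- by rewrite permM tpermR permE.
Qed.

(** A label j for the far end of the root edge is only allowed for a link:
    the far end of a loop is the root vertex, which is never distinguished. *)
Lemma glue_exists : exists M i, @reduces M P j i.
Proof.
have LE y : glue_L y = glue_other y by rewrite permE.
have RE y : glue_R y = glue_next y by rewrite permE.
have Linv x : glue_L (glue_L x) = x by rewrite !LE glue_other_invol.
have cL x : glue_colour (glue_L x) = ~~ glue_colour x.
  by rewrite LE; case: x => [x|b] //=; rewrite (valid_colour_L V).
have cR x : glue_colour (glue_R x) = ~~ glue_colour x.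
  rewrite RE; case: x => [x|[]] /=.
  - rewrite -(valid_colour_R V); case: eqP => [/(valid_b_white V) -> //|_].
    by case: eqP => [/(valid_a_black V)|//]; rewrite /= => /negbTE->.
  - by case E: (cut_a P) => [x|] //=; apply/negbTE/(valid_a_black V).
  - by case E: (cut_b P) => [x|] //=; apply: (valid_b_white V).
have conn (A : {set T}) : inr true \in A -> (forall x, x \in A -> glue_R x \in A) ->
      (forall x, x \in A -> glue_L x \in A) -> forall x, x \in A.
  move=> At AR AL; have Af : inr false \in A by have := AL _ At; rewrite LE.
  suff Ai x : inl x \in A by case=> [x|[]].
  have Aa y : cut_a P = Some y -> inl y \in A by move=> aE; have := AR _ At; rewrite RE /=
    aE.
  have Ab y : cut_b P = Some y -> inl y \in A by move=> aE; have := AR _ Af; rewrite RE /=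
    aE.
  move: x; apply: (valid_ind V) => // x Ax.
    have := AR _ Ax; rewrite RE /=; case: eqP => [bE _|_]; first exact: Ab.
    by case: eqP => [aE _|//]; exact: Aa.
  by have := AL _ Ax; rewrite LE.
have inlP v : v \in cut_dist P -> exists2 x, x \in v & inl @: v = porbit glue_R (inl x).
  move=> vd; have [x vE] := valid_dist_orbit V vd; have xv : x \in v by rewrite vE
    porbit_id.
  have [vE' va vb] := cut_dist_omem V vd xv; exists x => //.
  by rewrite (contraction_free glue_contraction) -?vE'.
pose ds0 := [seq inl @: (v : {set cut_dart P}) | v <- cut_dist P] : seq {set T}.
pose ds := insert_at j (porbit glue_R (inr false)) ds0.
have dsP v : v \in ds -> v \in ds0 \/ (v = porbit glue_R (inr false) /\ root_link P).
  rewrite /ds; case: j Hj => [k|] HH; last by left.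
  rewrite (perm_mem (insert_at_perm _ _ _)) inE => /predU1P[->|]; last by left.
  by right; split=> //; have [] := HH k erefl.
have ds0P v y : v \in ds0 -> inr y \notin v.
  by move=> /mapP[w _ ->]; apply/imsetP => -[].
have ds_uniq : uniq ds.
  have u0 : uniq ds0 by rewrite map_inj_uniq ?(valid_dist_uniq V) //; apply: imset_inj =>
    x y [].
  rewrite /ds; case: j => [k|] //; rewrite (perm_uniq (insert_at_perm _ _ _)) /= u0 andbT.
  by apply/negP => /(ds0P _ false); rewrite porbit_id.
have ds_sub : {subset ds <= porbits glue_R}.
  move=> v /dsP[/mapP[w /inlP[x _ wE] ->]|[-> _]]; first by rewrite wE imset_f.
  exact: imset_f.
have ds_d : porbit glue_R (inr true) \notin ds.
  apply/negP => /dsP[/(ds0P _ true)|[E lP]]; first by rewrite porbit_id.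
  have [x [k [aE kx bE _]]] := root_link_spec V lP.
  have := glue_contraction; rewrite aE bE => /(contraction_link_card kx)[/negP[]].
  by rewrite E porbit_id.
pose M := coloured_seqmap Linv cR cL (isT : glue_colour (inr true)) conn ds_uniq ds_sub
  ds_d.
exists M, inl; split.
- by rewrite /= LE; exact: glue_contraction.
- by move=> x; rewrite /= LE.
- by move=> x; exact: (@colour_coloured_seqmap T glue_R glue_L glue_colour (inr true) ds
  Linv cR cL isT conn ds_uniq ds_sub ds_d (inl x)).
- by rewrite /= LE.
- by move=> k /Hj[].
Qed.

End Glue.
End CutMap.

(** * Removing the root edge *)

Section RootCut.
Variable M : seqmap.
Let d := Defs.root M.
Let d' := mapL M d.
Let T := {x : dart M | (x != d) && (x != d')}.

Lemma root_cut_root : colour d /\ colour d' = false.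
Proof. by rewrite colour_L colour_root. Qed.

Lemma root_cut_dd' : d != d'.
Proof. by apply/eqP => E; have := colour_L d; rewrite -/d' -E colour_root. Qed.

Definition root_cut_next (x : dart M) : dart M :=
  if mapR M x == d then mapR M d' else if mapR M x == d' then mapR M d else mapR M x.

(** Around a vertex the colours alternate, so an end of the root edge is
    never a fixed point of the rotation. It follows that one step beyond the
    skipped dart always suffices. *)
Lemma root_cut_nextP (x : T) : (root_cut_next (val x) != d) &&
  (root_cut_next (val x) != d').
Proof.
have [cd cd'] := root_cut_root; case: x => x /= /andP[xd xd'].
have Rd'd' : mapR M d' != d'.
  by apply/eqP => E; have := colour_R d'; rewrite E cd'.
have Rdd : mapR M d != d.
  by apply/eqP => E; have := colour_R d; rewrite E cd.
rewrite /root_cut_next; case: (eqVneq (mapR M x) d) => [E|nE].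
  rewrite Rd'd' andbT; apply: contra xd' => /eqP E'.
  by apply/eqP/(@perm_inj _ (mapR M)); rewrite E E'.
case: (eqVneq (mapR M x) d') => [E|nE']; last by rewrite nE' andbT.
rewrite Rdd /=; apply: contra xd => /eqP E'.
by apply/eqP/(@perm_inj _ (mapR M)); rewrite E E'.
Qed.

Definition root_cut_R (x : T) : T := exist _ (root_cut_next (val x)) (root_cut_nextP x).

Lemma root_cut_R_inj : injective root_cut_R.
Proof.
move=> [x xP] [y yP] /(congr1 val) /= E; apply: val_inj => /=.
have [/andP[xd xd'] /andP[yd yd']] := (xP, yP).
have I := @perm_inj _ (mapR M).
move: E; rewrite /root_cut_next.
case: (eqVneq (mapR M x) d) => [Ex|_]; case: (eqVneq (mapR M y) d) => [Ey|_].
- by move=> _; apply: I; rewrite Ex Ey.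
- case: (eqVneq (mapR M y) d') => [_ /I E|_ /I E].
    by have := root_cut_dd'; rewrite E eqxx.
  by rewrite -E eqxx in yd'.
- case: (eqVneq (mapR M x) d') => [_ /I E|_ /I E].
    by have := root_cut_dd'; rewrite E eqxx.
  by rewrite E eqxx in xd'.
case: (eqVneq (mapR M x) d') => [Ex|_]; case: (eqVneq (mapR M y) d') => [Ey|_].
- by move=> _; apply: I; rewrite Ex Ey.
- by move=> /I E; rewrite -E eqxx in yd.
- by move=> /I E; rewrite E eqxx in xd.
- by move/I.
Qed.

Lemma root_cut_LP (x : T) : (mapL M (val x) != d) && (mapL M (val x) != d').
Proof.
case: x => x /= /andP[xd xd']; apply/andP; split.
  by apply: contra xd' => /eqP E; rewrite /d' -E mapL_invol.
by rewrite (inj_eq perm_inj).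
Qed.

Definition root_cut_L (x : T) : T := exist _ (mapL M (val x)) (root_cut_LP x).

Lemma root_cut_L_inj : injective root_cut_L.
Proof. by move=> x y /(congr1 val) /= /perm_inj /val_inj. Qed.

Definition root_cut_dist := rem (vertex_of d') (dist M).

(** The far end of the root edge is merged with the root vertex or, for a
    loop, is part of it: it is removed from the list of distinguished
    vertices, and its label is kept in [root_cut_j]. *)
Definition root_cut : cutmap := @CutMap T (perm root_cut_R_inj) (perm root_cut_L_inj)
  (fun x => colour (val x))
  (insub (mapR M d)) (insub (mapR M d'))
  [seq [set x : T | val x \in v] | v : {set dart M} <- root_cut_dist].

Definition root_cut_j : option nat :=
  if vertex_of d' \in dist M then Some (index (vertex_of d') (dist M)) else None.

Lemma root_cut_opt (o : option T) y : insub y = o ->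
  if o is Some z then y = val z else y = d \/ y = d'.
Proof.
move=> <-; case: insubP => [z _ <- //|]; rewrite negb_and !negbK => /orP E.
by case: E => /eqP; [left|right].
Qed.

Lemma root_cut_a_eq (z : T) : (insub (mapR M d) == Some z) = (mapR M d == val z).
Proof.
have := root_cut_opt (erefl (insub (mapR M d) : option T)); case: insub => [t|] E.
  by rewrite E (inj_eq Some_inj) (inj_eq val_inj).
have [zd zd'] : val z != d /\ val z != d' by case: z => z /= /andP[].
symmetry; apply/negbTE; apply/eqP => zE.
by move: zd zd'; rewrite -zE; case: E => ->; rewrite eqxx.
Qed.

Lemma root_cut_b_eq (z : T) : (insub (mapR M d') == Some z) = (mapR M d' == val z).
Proof.
have := root_cut_opt (erefl (insub (mapR M d') : option T)); case: insub => [t|] E.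
  by rewrite E (inj_eq Some_inj) (inj_eq val_inj).
have [zd zd'] : val z != d /\ val z != d' by case: z => z /= /andP[].
symmetry; apply/negbTE; apply/eqP => zE.
by move: zd zd'; rewrite -zE; case: E => ->; rewrite eqxx.
Qed.

Lemma root_cut_Rd : mapR M d = oapp val d' (cut_a root_cut).
Proof.
rewrite /=; have := root_cut_opt (erefl (insub (mapR M d) : option T)).
case: insub => [t|] //= [] // E.
by have := colour_R d; rewrite E; case: (colour d).
Qed.

Lemma root_cut_Rd' : mapR M d' = oapp val d (cut_b root_cut).
Proof.
rewrite /=; have := root_cut_opt (erefl (insub (mapR M d') : option T)).
case: insub => [t|] //= [] // E.
by have := colour_R d'; rewrite E; case: (colour d').
Qed.

Lemma root_cut_contraction : contraction (mapR M) (cut_R root_cut) val d d'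
  (cut_a root_cut) (cut_b root_cut).
Proof.
have I := @perm_inj _ (mapR M).
split.
- exact: val_inj.
- exact: root_cut_dd'.
- by move=> [x /= /andP[]].
- by move=> [x /= /andP[]].
- move=> y; case: (eqVneq y d) => [->|yd]; first by constructor 1.
  case: (eqVneq y d') => [->|yd']; first by constructor 2.
  by constructor 3; exists (exist _ y (introT andP (conj yd yd'))).
- move=> x /eqP; rewrite root_cut_b_eq => /eqP E /eqP; rewrite root_cut_a_eq -E => /eqP /I
  E'.
  by have := root_cut_dd'; rewrite E' eqxx.
- move=> x; rewrite permM tpermD; last 2 first.
  + by rewrite eq_sym; case: x => x /= /andP[].
  + by rewrite eq_sym; case: x => x /= /andP[].
  rewrite root_cut_b_eq root_cut_a_eq permE /= /root_cut_next.
  have [xd xd'] : val x != d /\ val x != d' by case: x => x /= /andP[].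
  case: (eqVneq (mapR M (val x)) d) => [E|nE].
    by rewrite eqxx.
  case: (eqVneq (mapR M (val x)) d') => [E|nE'].
    by rewrite !(inj_eq I) eq_sym (negbTE root_cut_dd') eqxx.
  by rewrite !(inj_eq I) ![_ == val x]eq_sym (negbTE xd) (negbTE xd').
- by rewrite permM tpermL root_cut_Rd'.
- by rewrite permM tpermR root_cut_Rd.
Qed.

Lemma root_cut_distP v : v \in root_cut_dist ->
  [/\ v \in dist M, d \notin v, d' \notin v & exists2 y : T, val y \in v & v = vertex_of
    (val y)].
Proof.
rewrite mem_rem_uniq ?dist_uniq // inE => /andP[vd' vd].
have [y _ vE] := imsetP (dist_vertices vd).
have dv : d \notin v.
  apply/negP => dv; have := dist_root M.
  suff -> : vertex_of (Defs.root M) = v by rewrite vd.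
  by apply/eqP; rewrite vE eq_porbit_mem -vE.
have d'v : d' \notin v.
  apply: contra vd' => d'v.
  by rewrite eq_sym vE eq_porbit_mem -vE.
split=> //.
have yT : (y != d) && (y != d').
  apply/andP; split; apply/eqP => E.
    by have := porbit_id (mapR M) y; rewrite -vE E (negbTE dv).
  by have := porbit_id (mapR M) y; rewrite -vE E (negbTE d'v).
by exists (exist _ y yT); rewrite //= vE porbit_id.
Qed.

Lemma root_cut_distE v : v \in root_cut_dist -> val @: [set x : T | val x \in v] = v.
Proof.
move=> /root_cut_distP[_ dv d'v _]; apply/setP=> y; apply/imsetP/idP.
  by case=> x; rewrite inE => xv ->.
move=> yv; have yT : (y != d) && (y != d').
  by apply/andP; split; apply/eqP => E; [move: dv|move: d'v]; rewrite -E yv.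
by exists (exist _ y yT); rewrite ?inE.
Qed.

Lemma root_cut_orb v : v \in root_cut_dist ->
  exists y : T, [set x : T | val x \in v] = porbit (cut_R root_cut) y /\
  ~~ omem (cut_a root_cut) (porbit (cut_R root_cut) y) /\ ~~ omem (cut_b root_cut)
    (porbit (cut_R root_cut) y).
Proof.
move=> vd; have [_ dv d'v [y _ vE]] := root_cut_distP vd; exists y.
rewrite vE in dv d'v; have [ay by_] := contraction_avoid root_cut_contraction dv d'v.
split=> //; apply: (imset_inj val_inj).
by rewrite root_cut_distE // -(contraction_free root_cut_contraction).
Qed.

Lemma root_cut_valid : cut_valid root_cut.
Proof.
split.
- by move=> x; apply: val_inj; rewrite /= !permE /= mapL_invol.
- move=> x; rewrite /= permE /= /root_cut_next.
  have [cd cd'] := root_cut_root; have := colour_R (val x).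
  case: eqP => [->|_]; first by rewrite colour_R cd' cd.
  by case: eqP => [->|_] //; rewrite colour_R cd' cd.
- by move=> x; rewrite /= permE /= colour_L.
- by move=> x /root_cut_opt /= <-; rewrite colour_R negbK colour_root.
- by move=> x /root_cut_opt /= <-; rewrite colour_R colour_L negbK colour_root.
- move=> A AR AL Aa Ab.
  (* The ends of the root edge satisfy B vacuously, as they are not remaining darts. *)
pose B (y : dart M) := forall x : T, val x = y -> A x.
  have Bd : B d by move=> x E; have := bypass_d root_cut_contraction x; rewrite E eqxx.
  have Bd' : B d' by move=> x E; have := bypass_d' root_cut_contraction x; rewrite E eqxx.
  suff BM y : B y by move=> x; apply: BM.
  move: y; apply: (@cmap_ind M B d) => // y By.
    move=> x xE; case: (bypass_cov root_cut_contraction y) => [yE|yE|[z zE]].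
    + by apply: Aa; apply/eqP; rewrite root_cut_a_eq xE yE.
    + by apply: Ab; apply/eqP; rewrite root_cut_b_eq xE yE.
    have Az := AR _ (By z (esym zE)).
    move: xE; rewrite zE (contraction_i z root_cut_contraction).
    case: eqP => [_ E|_]; first exact: Bd.
    case: eqP => [_ E|_ /val_inj-> //]; exact: Bd'.
  move=> x xE.
  have zP : (y != d) && (y != d').
    have := root_cut_LP x; rewrite xE mapL_invol.
    by [].
  have -> : x = cut_L root_cut (exist _ y zP) by apply: val_inj; rewrite /= permE.
  exact/AL/By.
- rewrite map_inj_in_uniq ?rem_uniq ?dist_uniq // => v w vd wd E.
  by rewrite -(root_cut_distE vd) E root_cut_distE.
- by move=> _ /mapP[v /root_cut_orb[y [-> _]] ->]; exists y.
- move=> _ x /mapP[v /root_cut_orb[y [-> [ay _]]] ->] aE.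
  by move: ay; rewrite aE.
- move=> _ x /mapP[v /root_cut_orb[y [-> [_ ay]]] ->] aE.
  by move: ay; rewrite aE.
Qed.

Lemma root_cut_reduces : @reduces M root_cut root_cut_j val.
Proof.
split.
- exact: root_cut_contraction.
- by move=> x; rewrite /= permE.
- by [].
- have -> : [seq val @: (v : {set T}) | v <- cut_dist root_cut] = root_cut_dist.
    rewrite -map_comp -[RHS]map_id; apply/eq_in_map => v /= vd.
    by rewrite root_cut_distE.
  rewrite /root_cut_j /root_cut_dist -/d' remE; case: ifP => [vd|vd].
    rewrite /insert_at -/d'; set k := index _ _; set v := vertex_of d'.
    have lt_k : k < size (dist M) by rewrite index_mem.
    rewrite take_size_cat ?drop_size_cat ?size_takel ?(ltnW lt_k) //.
    by rewrite -[in LHS](cat_take_drop k (dist M)) (drop_nth v) // nth_index.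
  rewrite /= memNindex ?vd // take_size drop_oversize ?cats0 //.
- move=> k; rewrite /root_cut_j; case: ifP => // vd [<-].
  by rewrite size_map size_rem // -ltnS prednK ?index_mem //
    (leq_trans _ (_ : index (vertex_of d') (dist M) < _)) ?index_mem.
Qed.

Lemma root_cut_exists : exists P j i, cut_valid P /\ @reduces M P j i.
Proof. by exists root_cut, root_cut_j, val; split;
  [exact: root_cut_valid|exact: root_cut_reduces]. Qed.

End RootCut.

(** * Parameters across the removal of the root edge *)

Section Counting.
Variables (M : seqmap) (P : cutmap) (j : option nat) (i : cut_dart P -> dart M).
Hypotheses (V : cut_valid P) (H : @reduces M P j i).

Let d := Defs.root M.
Let d' := mapL M d.

Definition cut_RL (Q : cutmap) : {perm cut_dart Q} := (cut_L Q * cut_R Q)%g.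

(** Along faces, contraction only leaves out the two darts of the edge. The
    dart after the root along its face is the one after its opposite around
    the vertex, whence the exchange of a and b. *)
Lemma reduces_bypass_RL : bypass (mapRL M) (cut_RL P) i d d' (cut_b P) (cut_a P).
Proof.
have I := reduces_contraction H; split; try by case: I.
- by move=> x; rewrite !permM (reduces_L H) (contraction_i _ I).
- by rewrite permM (contraction_d' I).
- by rewrite permM /d' mapL_invol (contraction_d I).
Qed.

Lemma reduces_nb_faces :
  nb_faces (DartMap M) = orbit_count (cut_RL P) predT + (cut_a P == None) +
    (cut_b P == None).
Proof.
by rewrite /= card_porbits (orbit_count_bypass (C := predT) reduces_bypass_RL) // !andbT
  addnAC.
Qed.

(** Only faces of degree one, formed by the root or by its opposite alone,
    disappear. That of the root is white, and it exists if nothing follows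
    the opposite of the root. *)
Lemma reduces_nb_white :
  nb_white (DartMap M) = orbit_count (cut_RL P) (@cut_colour P) + (cut_b P == None).
Proof.
rewrite /= whiteE -/(orbit_count _ (@colour M))
  (orbit_count_bypass reduces_bypass_RL (@colour_RL M)).
rewrite colour_root colour_L colour_root !andbT andbF addn0; congr addn.
by apply: eq_orbit_count => x /=; rewrite (reduces_colour H).
Qed.

Lemma reduces_nb_black :
  nb_black (DartMap M) = orbit_count (cut_RL P) (fun x => ~~ cut_colour x) +
    (cut_a P == None).
Proof.
rewrite /= blackE -/(orbit_count _ (fun x => ~~ @colour M x))
  (orbit_count_bypass reduces_bypass_RL); last first.
  by move=> x; rewrite colour_RL.
rewrite colour_root colour_L colour_root !andbF andbT addn0; congr addn.
by apply: eq_orbit_count => x /=; rewrite (reduces_colour H).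
Qed.

Lemma reduces_card : #|dart M| = #|cut_dart P| + 2.
Proof.
have I := reduces_contraction H; have iI := bypass_inj I.
rewrite -cardsT; have -> : [set: dart M] = d |: (d' |: i @: setT).
  apply/setP=> y; rewrite !inE; symmetry; case: (bypass_cov I y) => [->|->|[x ->]].
  - by rewrite eqxx.
  - by rewrite eqxx orbT.
  - by rewrite imset_f ?orbT ?inE.
rewrite !cardsU1 !inE negb_or (bypass_neq I) card_imset // cardsT.
have -> : d \notin i @: setT.
  by apply/imsetP=> -[x _ /eqP]; rewrite eq_sym (negbTE (bypass_d I x)).
have -> : d' \notin i @: setT.
  by apply/imsetP=> -[x _ /eqP]; rewrite eq_sym (negbTE (bypass_d' I x)).
lia.
Qed.

Lemma reduces_nb_edges : nb_edges (DartMap M) * 2 = #|cut_dart P| + 2.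
Proof. by rewrite nb_edgesE /= reduces_card. Qed.

Lemma reduces_dist_degrees : dist_degrees (DartMap M) =
  insert_at j #|vertex_of d'| [seq #|v| | v : {set cut_dart P} <- cut_dist P].
Proof.
have iI := bypass_inj (reduces_contraction H).
rewrite /= (reduces_dist H) -/d -/d'.
have E : [seq #|v| | v : {set dart M} <-
  [seq i @: (v : {set cut_dart P}) | v <- cut_dist P]] =
         [seq #|v| | v : {set cut_dart P} <- cut_dist P].
  by rewrite -map_comp; apply: eq_map => v /=; rewrite card_imset.
case: j => [k|] //=.
by rewrite map_cat /= map_take map_drop E.
Qed.

(** For a loop, the root vertex consists of the two ends and of the two
    cycles of the remainder that meet the marked darts. *)
Lemma reduces_loop : ~ root_link P ->
  [/\ d' \in vertex_of d,
    root_degree (DartMap M) = (opt_orbit_size (cut_R P) (cut_a P) + opt_orbit_size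
      (cut_R P) (cut_b P)).+2 &
    nb_vertices (DartMap M) + 1 = orbit_count (cut_R P) predT + (cut_a P == None) +
      (cut_b P == None)].
Proof.
move=> nl; have I := reduces_contraction H.
have [dd' cd] : d' \in porbit (mapR M) d /\
     #|porbit (mapR M) d| = (opt_orbit_size (cut_R P) (cut_a P) + opt_orbit_size (cut_R P)
       (cut_b P)).+2.
  apply: (contraction_loop I) => x aE; apply/negP; case bE: (cut_b P) => [y|//] /= yx.
  by apply: nl; exists x, y.
split; [exact: dd' | exact: cd |].
by have := contraction_orbit_count I; rewrite dd' /= card_porbits; lia.
Qed.

Lemma reduces_link x k : cut_a P = Some x -> 0 < k < #|porbit (cut_R P) x| ->
  cut_b P = Some (iter k (cut_R P) x) ->
  [/\ d' \notin vertex_of d, root_degree (DartMap M) = k.+1,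
    #|vertex_of d'| = (#|porbit (cut_R P) x| - k).+1 &
    nb_vertices (DartMap M) = orbit_count (cut_R P) predT + 1].
Proof.
move=> aE kx bE; have I := reduces_contraction H.
have I' := I; rewrite aE bE in I'; have [dd' cd cd'] := contraction_link_card kx I'.
split=> //; have := contraction_orbit_count I; rewrite (negbTE dd') /= card_porbits aE bE
  /=; lia.
Qed.

(** The far end of a loop is the root vertex, which is not distinguished. *)
Lemma reduces_label_link k : j = Some k -> root_link P.
Proof.
move=> jE; case: (EM (root_link P)) => // /reduces_loop[dd' _ _].
have := dist_root M; rewrite (reduces_dist H) jE (perm_mem (insert_at_perm _ _ _)) inE.
by rewrite eq_porbit_mem porbit_sym dd'.
Qed.

End Counting.

(** * Isomorphisms across the removal of the root edge *)

Section Transport.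

Definition cut_iso (P Q : cutmap) (f : cut_dart P -> cut_dart Q) : Prop :=
  [/\ bijective f, commute2 (cut_R P) (cut_L P) (cut_R Q) (cut_L Q) f,
      omap f (cut_a P) = cut_a Q, omap f (cut_b P) = cut_b Q &
      [seq f @: (v : {set cut_dart P}) | v <- cut_dist P] = cut_dist Q].

Lemma omap_eq (A B : eqType) (f : A -> B) (o : option A) x :
  injective f -> (omap f o == Some (f x)) = (o == Some x).
Proof. by case: o => [y|] //= fI; rewrite !(inj_eq Some_inj) (inj_eq fI). Qed.

Lemma insert_at_map (A B : Type) (f : A -> B) j x s :
  map f (insert_at j x s) = insert_at j (f x) (map f s).
Proof. by case: j => [k|] //=; rewrite map_cat /= map_take map_drop. Qed.

Lemma insert_at_inj (A : eqType) j j' (x : A) s s' :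
  (forall k, j = Some k -> k <= size s) -> (forall k, j' = Some k -> k <= size s') ->
  x \notin s -> x \notin s' -> insert_at j x s = insert_at j' x s' -> j = j' /\ s = s'.
Proof.
have nk k (t : seq A) : x \notin t -> (x \in take k t) = false.
  by move=> xt; apply: contraNF xt => /mem_take.
have idx k (t : seq A) : k <= size t -> x \notin t -> index x (insert_at (Some k) x t) = k.
  move=> kt xt; rewrite /= index_cat nk //= eqxx addn0.
  by rewrite size_takel.
have rm k (t : seq A) : x \notin t -> rem x (insert_at (Some k) x t) = t.
  move=> xt; rewrite /= remE index_cat nk //= eqxx addn0.
  rewrite take_size_cat // -cat1s catA drop_size_cat ?size_cat ?addn1 //.
  by rewrite cat_take_drop.
have ins_in k (t : seq A) : x \in insert_at (Some k) x t.
  by rewrite (perm_mem (insert_at_perm _ _ _)) inE eqxx.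
case: j j' => [k|] [k'|] jk jk' xs xs' E.
- have /esym k'E := idx _ _ (jk' k' erefl) xs'; rewrite -E idx ?jk // in k'E.
  by rewrite k'E -(rm k s xs) E -k'E rm.
- by have := ins_in k s; rewrite E (negbTE xs').
- by have := ins_in k' s'; rewrite -E (negbTE xs).
- by [].
Qed.

Lemma contraction_eq_d (T T' : finType) (R : {perm T}) (R' : {perm T'}) i d d' a b x :
  contraction R R' i d d' a b -> R (i x) = d -> b = Some (R' x).
Proof.
move=> H; rewrite (contraction_i _ H); case: eqP => [//|_]; case: ifP => _ /eqP.
  by rewrite eq_sym (negbTE (bypass_neq H)).
by rewrite (negbTE (bypass_d H _)).
Qed.

Lemma contraction_eq_d' (T T' : finType) (R : {perm T}) (R' : {perm T'}) i d d' a b x :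
  contraction R R' i d d' a b -> R (i x) = d' -> a = Some (R' x).
Proof. by move=> /contraction_sym; apply: contraction_eq_d. Qed.

Lemma contraction_eq_i (T T' : finType) (R : {perm T}) (R' : {perm T'}) i d d' a b x y :
  contraction R R' i d d' a b -> R (i x) = i y -> R' x = y.
Proof.
move=> H; rewrite (contraction_i _ H); case: ifP => [_ /eqP|_].
  by rewrite eq_sym (negbTE (bypass_d H _)).
case: ifP => [_ /eqP|_ /(bypass_inj H) //].
by rewrite eq_sym (negbTE (bypass_d' H _)).
Qed.

(** Everything in M is read off P, so an isomorphism of remainders extends
    to the root edge. *)
Lemma iso_of_cut_iso (M N : seqmap) (P Q : cutmap) j i i' f :
  @reduces M P j i -> @reduces N Q j i' -> @cut_iso P Q f -> iso (DartMap M) (DartMap N).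
Proof.
move=> HM HN [fB [fR fL] fa fb fd].
have [IM IN] := (reduces_contraction HM, reduces_contraction HN).
set d := Defs.root M in IM; set d' := mapL M d in IM.
set e := Defs.root N in IN; set e' := mapL N e in IN.
have fI := bij_inj fB.
have [F FE] : exists F : dart M -> dart N,
  forall y, [/\ y = d -> F y = e, y = d' -> F y = e' & forall x, y = i x -> F y = i' (f x)].
  apply: (@fin_all_exists (dart M) _ (fun y z =>
    [/\ y = d -> z = e, y = d' -> z = e' & forall x, y = i x -> z = i' (f x)])) => y.
  case: (bypass_cov IM y) => [yE|yE|[x yE]].
  - exists e; split=> // [|x]; rewrite yE => /eqP.
      by rewrite (negbTE (bypass_neq IM)).
    by rewrite eq_sym (negbTE (bypass_d IM x)).
  - exists e'; split=> // [|x]; rewrite yE => /eqP.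
      by rewrite eq_sym (negbTE (bypass_neq IM)).
    by rewrite eq_sym (negbTE (bypass_d' IM x)).
  - exists (i' (f x)); split; rewrite yE;
    [move/eqP|move/eqP|by move=> z /(bypass_inj IM)->].
      by rewrite (negbTE (bypass_d IM x)).
    by rewrite (negbTE (bypass_d' IM x)).
have Fd : F d = e by case: (FE d) => ->.
have Fd' : F d' = e' by case: (FE d') => _ ->.
have Fi x : F (i x) = i' (f x) by case: (FE (i x)) => _ _; apply.
have FI : injective F.
  have ee' := negbTE (bypass_neq IN); have e'e := ee'; rewrite eq_sym in e'e.
  have ie x : (i' x == e) = false by apply/negbTE/(bypass_d IN).
  have ie' x : (i' x == e') = false by apply/negbTE/(bypass_d' IN).
  have ei x : (e == i' x) = false by rewrite eq_sym ie.
  have ei' x : (e' == i' x) = false by rewrite eq_sym ie'.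
  move=> y z; case: (bypass_cov IM y) => [->|->|[x ->]];
    case: (bypass_cov IM z) => [->|->|[t ->]]; rewrite ?Fd ?Fd' ?Fi // => /eqP;
    rewrite ?ee' ?e'e ?ie ?ie' ?ei ?ei' //.
  by rewrite (inj_eq (bypass_inj IN)) (inj_eq fI) => /eqP->.
have FB : bijective F.
  by apply: inj_card_bij => //; rewrite (reduces_card HM) (reduces_card HN)
    (bij_eq_card fB).
have FR y : F (mapR M y) = mapR N (F y).
  case: (bypass_cov IM y) => [->|->|[x ->]].
  + by rewrite Fd (contraction_d IM) (contraction_d IN) -fa; case: (cut_a P) => [x|] /=;
    rewrite ?Fi ?Fd'.
  + by rewrite Fd' (contraction_d' IM) (contraction_d' IN) -fb; case: (cut_b P) => [x|]
    /=; rewrite ?Fi ?Fd.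
  + rewrite Fi (contraction_i _ IM) (contraction_i _ IN) -fa -fb -fR !omap_eq //.
    by case: ifP => // _; case: ifP => // _; rewrite Fi.
apply/isoP; exists F; split=> //=.
- split=> y; first exact: FR.
  case: (bypass_cov IM y) => [->|->|[x ->]].
  + by rewrite Fd -/d'.
  + by rewrite Fd' /d' /e' !mapL_invol.
  + by rewrite Fi (reduces_L HM) (reduces_L HN) -fL Fi.
- by rewrite -/d Fd.
rewrite (reduces_dist HM) (reduces_dist HN) -/e -/e' -/d -/d' insert_at_map -fd -!map_comp.
congr insert_at.
  by rewrite /vertex_of -Fd'; symmetry; apply: porbit_emb => z _; rewrite FR.
by apply: eq_map => v /=; rewrite -!imset_comp; apply: eq_imset => x /=; rewrite Fi.
Qed.

(** An isomorphism preserves the root, hence the root edge, the darts that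
    follow its ends and the label of its far end. *)
Lemma cut_iso_of_iso (M N : seqmap) (P Q : cutmap) j j' i i' :
  cut_valid P -> cut_valid Q -> @reduces M P j i -> @reduces N Q j' i' ->
  iso (DartMap M) (DartMap N) -> j = j' /\ exists f, @cut_iso P Q f.
Proof.
move=> VP VQ HM HN /isoP[F [FB [/= FR FL] [Fd] Fds]].
have [IM IN] := (reduces_contraction HM, reduces_contraction HN).
set d := Defs.root M in IM Fd; set d' := mapL M d in IM.
set e := Defs.root N in IN Fd; set e' := mapL N e in IN.
have FI := bij_inj FB.
have Fd' : F d' = e' by rewrite /d' /e' FL Fd.
have [f fE] : exists f, forall x, i' (f x) = F (i x).
  apply: (@fin_all_exists _ _ (fun x z => i' z = F (i x))) => x.
  case: (bypass_cov IN (F (i x))) => [E|E|[z zE]]; last by exists z.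
    by have := bypass_d IM x; rewrite -(inj_eq FI) E Fd eqxx.
  by have := bypass_d' IM x; rewrite -(inj_eq FI) E Fd' eqxx.
have iI := bypass_inj IN.
have fI : injective f by move=> x y E; apply/(bypass_inj IM)/FI; rewrite -!fE E.
have fB : bijective f.
  apply: inj_surj_bij => // y; have [G FK GK] := FB.
  have E := GK (i' y); case: (bypass_cov IM (G (i' y))) => [GE|GE|[x xE]].
  - by have := bypass_d IN y; rewrite -E GE Fd eqxx.
  - by have := bypass_d' IN y; rewrite -E GE Fd' eqxx.
  - by exists x; apply: iI; rewrite fE -xE.
have fa : omap f (cut_a P) = cut_a Q.
  have := congr1 F (contraction_d IM); rewrite FR Fd (contraction_d IN).
  case: (cut_a P) => [x|]; case: (cut_a Q) => [y|] //=; rewrite ?Fd' -?fE.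
  - by move/iI->.
  - by move/esym/eqP; rewrite (negbTE (bypass_d' IN _)).
  - by move/eqP; rewrite (negbTE (bypass_d' IN _)).
have fb : omap f (cut_b P) = cut_b Q.
  have := congr1 F (contraction_d' IM); rewrite FR Fd' (contraction_d' IN).
  case: (cut_b P) => [x|]; case: (cut_b Q) => [y|] //=; rewrite ?Fd -?fE.
  - by move/iI->.
  - by move/esym/eqP; rewrite (negbTE (bypass_d IN _)).
  - by move/eqP; rewrite (negbTE (bypass_d IN _)).
have fR x : f (cut_R P x) = cut_R Q (f x).
  have := congr1 F (contraction_i x IM); rewrite FR -fE.
  case: (eqVneq (cut_b P)) => [bE|_]; last case: (eqVneq (cut_a P)) => [aE|_].
  - by rewrite Fd => /(contraction_eq_d IN); rewrite -fb bE => -[].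
  - by rewrite Fd' => /(contraction_eq_d' IN); rewrite -fa aE => -[].
  - by rewrite -fE => /(contraction_eq_i IN).
have fL x : f (cut_L P x) = cut_L Q (f x).
  by apply: iI; rewrite fE -(reduces_L HM) FL -fE (reduces_L HN).
have jE : j = j' /\ [seq F @: (v : {set _}) | v <-
  [seq i @: (v : {set cut_dart P}) | v <- cut_dist P]]
      = [seq i' @: (v : {set cut_dart Q}) | v <- cut_dist Q].
  have d'P (v : {set cut_dart P}) : i @: v != vertex_of (mapL M d).
    by apply/eqP => E; have := porbit_id (mapR M) d'; rewrite -/(vertex_of _) -E =>
      /imsetP[x _ /eqP];
       rewrite eq_sym (negbTE (bypass_d' IM x)).
  have e'P (v : {set cut_dart Q}) : i' @: v != vertex_of (mapL N e).
    by apply/eqP => E; have := porbit_id (mapR N) e'; rewrite -/(vertex_of _) -E =>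
      /imsetP[x _ /eqP];
       rewrite eq_sym (negbTE (bypass_d' IN x)).
  have Fv : F @: vertex_of d' = vertex_of e'.
    by rewrite -Fd'; symmetry; apply: porbit_emb.
  move: Fds; rewrite (reduces_dist HM) (reduces_dist HN) -/d -/d' -/e -/e' insert_at_map Fv.
  apply: insert_at_inj => [k /(reduces_label HM)|k /(reduces_label HN)||]; rewrite
    ?size_map //.
    by apply/negP => /mapP[_ /mapP[v _ ->] E]; have := d'P v; rewrite
      -(inj_eq (imset_inj FI)) Fv E eqxx.
  by apply/negP => /mapP[v _ E]; have := e'P v; rewrite E eqxx.
case: jE => -> dE; split=> //; exists f; split=> //.
apply: (inj_map (imset_inj iI)); rewrite -dE -!map_comp.
by apply: eq_map => v /=; rewrite -!imset_comp; apply: eq_imset => x /=; rewrite fE.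
Qed.

End Transport.

(** * Merging two lists along a mask *)

Section Interleave.
Variable T : Type.

(** The list that [mask] splits into s1 and s2; the cases of incompatible
    lengths are chosen so that it is always a permutation of [s1 ++ s2]. *)
Fixpoint interleave (mu : seq bool) (s1 s2 : seq T) : seq T :=
  match mu with
  | [::] => s1 ++ s2
  | true :: mu' => if s1 is x :: s1' then x :: interleave mu' s1' s2 else s2
  | false :: mu' => if s2 is x :: s2' then x :: interleave mu' s1 s2' else s1
  end.

Lemma interleave_mask mu s : size mu = size s ->
  interleave mu (mask mu s) (mask (map negb mu) s) = s.
Proof. by elim: mu s => [|[] mu IH] [|x s] //= [/IH->]. Qed.

Lemma mask_interleave mu s1 s2 :
  size s1 = count id mu -> size s2 = count negb mu ->
  mask mu (interleave mu s1 s2) = s1 /\ mask (map negb mu) (interleave mu s1 s2) = s2.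
Proof.
elim: mu s1 s2 => [|[] mu IH] s1 s2 /=; first by move=> /size0nil-> /size0nil->.
  by case: s1 => //= x s1; rewrite !add1n add0n => -[/IH H] /H [-> ->].
by case: s2 => //= x s2; rewrite !add1n add0n => /IH H [/H[-> ->]].
Qed.

Lemma map_interleave_mask (p : pred T) mu s1 s2 :
  size s1 = count id mu -> size s2 = count negb mu ->
  all p s1 -> ~~ has p s2 -> map p (interleave mu s1 s2) = mu.
Proof.
elim: mu s1 s2 => [|[] mu IH] s1 s2 /=; first by move=> /size0nil-> /size0nil->.
  case: s1 => //= x s1; rewrite !add1n add0n => -[S1] S2 /andP[-> A1] A2.
  by rewrite IH.
case: s2 => //= x s2; rewrite !add1n add0n => S1 [S2] A1 /norP[/negbTE-> A2].
by rewrite IH.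
Qed.

End Interleave.

Lemma map_interleave (T U : Type) (f : T -> U) mu s1 s2 :
  map f (interleave mu s1 s2) = interleave mu (map f s1) (map f s2).
Proof.
elim: mu s1 s2 => [|[] mu IH] s1 s2 /=; first by rewrite map_cat.
  by case: s1 => //= x s1; rewrite IH.
by case: s2 => //= x s2; rewrite IH.
Qed.

Lemma perm_interleave (T : eqType) mu (s1 s2 : seq T) :
  perm_eq (interleave mu s1 s2) (s1 ++ s2).
Proof.
elim: mu s1 s2 => [|[] mu IH] s1 s2 //=.
  by case: s1 => //= x s1; rewrite perm_cons.
case: s2 => [|x s2] /=; first by rewrite cats0.
by rewrite perm_sym -[x :: s2]cat1s perm_catCA /= perm_cons perm_sym.
Qed.

(** * Disconnected remainders *)

Section Sum.

Definition sum_map (A B A' B' : Type) (f : A -> A') (g : B -> B') (x : A + B) : A' + B' :=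
  match x with inl y => inl (f y) | inr y => inr (g y) end.

Lemma sum_map_inj (A B A' B' : Type) (f : A -> A') (g : B -> B') :
  injective f -> injective g -> injective (sum_map f g).
Proof. by move=> fI gI [x|x] [y|y] //= [] => [/fI->|/gI->]. Qed.

Definition sum_perm (A B : finType) (s : {perm A}) (t : {perm B}) :
  {perm (A + B)%type} := perm (sum_map_inj (@perm_inj _ s) (@perm_inj _ t)).

Lemma orbit_count_sum (A B : finType) (s : {perm A}) (t : {perm B})
  (u : {perm (A + B)%type}) C :
  (forall x, u (inl x) = inl (s x)) -> (forall x, u (inr x) = inr (t x)) ->
  orbit_count u C = orbit_count s (C \o inl) + orbit_count t (C \o inr).
Proof.
move=> us ut.
have il : injective (@inl A B) by move=> x y [].
have ir : injective (@inr A B) by move=> x y [].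
rewrite -(orbit_count_emb (s := u) (i := inl)); last first.
  by move=> x y _ _; apply: porbit_emb_inj.
rewrite -(orbit_count_emb (s := u) (s' := t) (i := inr)); last first.
  by move=> x y _ _; apply: porbit_emb_inj.
set X := [set _ | y in _]; set Y := [set _ | y in _].
rewrite -cardsUI (_ : X :&: Y = set0) ?cards0 ?addn0; last first.
  apply/setP=> Z; rewrite !inE; apply/negP => /andP[/imsetP[x _ ->] /imsetP[y _ E]].
  have := porbit_id u (inl x); rewrite E (porbit_emb (s' := t)) //.
  by case/imsetP.
apply: eq_card => Z; rewrite inE; apply/imsetP/orP.
  by case=> -[x|x]; rewrite inE => Cx ->; [left|right]; apply: imset_f; rewrite inE.
by case=> /imsetP[x]; rewrite inE => Cx ->; [exists (inl x)|exists (inr x)]; rewrite ?inE.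
Qed.

Variables (m1 m2 : smap) (mu : seq bool).

(** The first piece is attached at [cut_a], which is black, whereas the root
    of a map is white: its colours are exchanged. The mask tells which
    distinguished vertices belong to the first piece. *)
Definition cut_sum : cutmap := @CutMap (smap_dart m1 + smap_dart m2)%type
  (sum_perm (smap_R m1) (smap_R m2)) (sum_perm (smap_L m1) (smap_L m2))
  (fun x => match x with inl y => ~~ smap_colour y | inr y => smap_colour y end)
  (omap inl (smap_root m1)) (omap inr (smap_root m2))
  (interleave mu [seq inl @: (v : {set smap_dart m1}) | v <- smap_dist m1]
                 [seq inr @: (v : {set smap_dart m2}) | v <- smap_dist m2]).

Lemma cut_sum_Rl x : cut_R cut_sum (inl x) = inl (smap_R m1 x).
Proof. by rewrite permE. Qed.
Lemma cut_sum_Rr x : cut_R cut_sum (inr x) = inr (smap_R m2 x).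
Proof. by rewrite permE. Qed.
Lemma cut_sum_Ll x : cut_L cut_sum (inl x) = inl (smap_L m1 x).
Proof. by rewrite permE. Qed.
Lemma cut_sum_Lr x : cut_L cut_sum (inr x) = inr (smap_L m2 x).
Proof. by rewrite permE. Qed.

Lemma cut_sum_porbitl x : porbit (cut_R cut_sum) (inl x) = inl @: porbit (smap_R m1) x.
Proof. by apply: porbit_emb => y _; rewrite cut_sum_Rl. Qed.
Lemma cut_sum_porbitr x : porbit (cut_R cut_sum) (inr x) = inr @: porbit (smap_R m2) x.
Proof. by apply: porbit_emb => y _; rewrite cut_sum_Rr. Qed.

Lemma cut_sum_nlink : ~ root_link cut_sum.
Proof.
case=> x [y [/=]]; case: (smap_root m1) => //= r1 [<-]; case: (smap_root m2) => //= r2 [<-].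
by rewrite cut_sum_porbitl => /imsetP[].
Qed.

Lemma cut_sum_distP v : v \in cut_dist cut_sum ->
  (exists2 w, w \in smap_dist m1 & v = inl @: w) \/
    (exists2 w, w \in smap_dist m2 & v = inr @: w).
Proof.
rewrite (perm_mem (perm_interleave _ _ _)) mem_cat => /orP[] /mapP[w wd ->].
  by left; exists w.
by right; exists w.
Qed.

Lemma cut_sum_valid : cut_valid cut_sum.
Proof.
have il : injective (@inl (smap_dart m1) (smap_dart m2)) by move=> x y [].
have ir : injective (@inr (smap_dart m1) (smap_dart m2)) by move=> x y [].
split.
- by move=> [x|x]; rewrite ?cut_sum_Ll ?cut_sum_Lr smap_L_invol.
- by move=> [x|x]; rewrite ?cut_sum_Rl ?cut_sum_Rr /= smap_colour_R.
- by move=> [x|x]; rewrite ?cut_sum_Ll ?cut_sum_Lr /= smap_colour_L.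
- move=> x /=; case E: (smap_root m1) => [r|] //= [<-]; rewrite negbK; exact:
  smap_colour_root E.
- move=> x /=; case E: (smap_root m2) => [r|] //= [<-]; exact: smap_colour_root E.
- move=> A AR AL Aa Ab [x|x].
    apply: (@smap_ind m1 (fun x => A (inl x))) => {x} [x /AR|x /AL|x xr].
    + by rewrite cut_sum_Rl.
    + by rewrite cut_sum_Ll.
    + by apply: Aa; rewrite /= xr.
  apply: (@smap_ind m2 (fun x => A (inr x))) => {x} [x /AR|x /AL|x xr].
  + by rewrite cut_sum_Rr.
  + by rewrite cut_sum_Lr.
  + by apply: Ab; rewrite /= xr.
- rewrite (perm_uniq (perm_interleave _ _ _)) cat_uniq.
  rewrite !map_inj_uniq ?smap_dist_uniq ?andbT /=; try exact: imset_inj.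
  apply/hasPn => _ /mapP[v vd ->]; apply/mapP => -[w _ E].
  have [x vE] := smap_dist_orbit vd.
  have : inr x \in (@inr (smap_dart m1) (smap_dart m2)) @: v by apply/imsetP; exists x;
    rewrite // vE porbit_id.
  by rewrite E => /imsetP[].
- move=> v /cut_sum_distP[] [w /smap_dist_orbit[x ->] ->]; [exists (inl x)|exists (inr x)].
    by rewrite cut_sum_porbitl.
  by rewrite cut_sum_porbitr.
- move=> v x /cut_sum_distP[] [w wd ->] /=; case E: (smap_root m1) => [r|] //= [<-].
    by rewrite mem_imset // (smap_dist_root wd E).
  by apply/imsetP => -[].
- move=> v x /cut_sum_distP[] [w wd ->] /=; case E: (smap_root m2) => [r|] //= [<-].
    by apply/imsetP => -[].
  by rewrite mem_imset // (smap_dist_root wd E).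
Qed.

Lemma cut_sum_vertices : orbit_count (cut_R cut_sum) predT = orbit_count (smap_R m1) predT
  + orbit_count (smap_R m2) predT.
Proof. exact: (orbit_count_sum predT cut_sum_Rl cut_sum_Rr). Qed.

Lemma cut_sum_faces C : orbit_count (cut_RL cut_sum) C = orbit_count (smap_RL m1)
  (C \o inl) + orbit_count (smap_RL m2) (C \o inr).
Proof.
by apply: orbit_count_sum => x; rewrite !permM ?cut_sum_Ll ?cut_sum_Lr ?cut_sum_Rl
  ?cut_sum_Rr.
Qed.

Lemma cut_sum_a : (cut_a cut_sum == None) = (smap_root m1 == None).
Proof. by rewrite /=; case: (smap_root m1). Qed.
Lemma cut_sum_b : (cut_b cut_sum == None) = (smap_root m2 == None).
Proof. by rewrite /=; case: (smap_root m2). Qed.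

(** The missing root of an empty piece supplies the vertex and the face that
    this piece is counted for. Black and white are exchanged in the first
    piece only. *)
Lemma reduces_sum_counts (M : seqmap) i : @reduces M cut_sum None i ->
  [/\ nb_vertices (DartMap M) + 1 = nb_vertices m1 + nb_vertices m2,
      nb_edges (DartMap M) = nb_edges m1 + nb_edges m2 + 1,
      nb_faces (DartMap M) = nb_faces m1 + nb_faces m2,
      nb_white (DartMap M) = nb_black m1 + nb_white m2 &
      nb_black (DartMap M) = nb_white m1 + nb_black m2] /\
  (root_degree (DartMap M) = (root_degree m1 + root_degree m2).+2 /\
   dist_degrees (DartMap M) = interleave mu (dist_degrees m1) (dist_degrees m2)).
Proof.
move=> H; have V := cut_sum_valid.
have [_ rE vE] := reduces_loop H cut_sum_nlink.
have il : injective (@inl (smap_dart m1) (smap_dart m2)) by move=> x y [].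
have ir : injective (@inr (smap_dart m1) (smap_dart m2)) by move=> x y [].
rewrite (reduces_nb_faces H) (reduces_nb_white H) (reduces_nb_black H) cut_sum_a cut_sum_b
  !cut_sum_faces.
rewrite !nb_verticesE !nb_facesE !nb_whiteE !nb_blackE.
have E1 : orbit_count (smap_RL m1) ((fun x => ~~ @cut_colour cut_sum x) \o inl) =
  orbit_count (smap_RL m1) (@smap_colour m1).
  by apply: eq_orbit_count => x /=; rewrite negbK.
have E2 : orbit_count (smap_RL m2) ((fun x => ~~ @cut_colour cut_sum x) \o inr) =
          orbit_count (smap_RL m2) (fun x => ~~ @smap_colour m2 x) by [].
have W1 : orbit_count (smap_RL m1) (@cut_colour cut_sum \o inl) = orbit_count (smap_RL m1)
  (fun x => ~~ @smap_colour m1 x) by [].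
have W2 : orbit_count (smap_RL m2) (@cut_colour cut_sum \o inr) = orbit_count (smap_RL m2)
  (@smap_colour m2) by [].
have F1 : orbit_count (smap_RL m1) (predT \o @inl _ (smap_dart m2)) = orbit_count
  (smap_RL m1) predT by [].
have F2 : orbit_count (smap_RL m2) (predT \o @inr (smap_dart m1) _) = orbit_count
  (smap_RL m2) predT by [].
rewrite E1 E2 W1 W2 F1 F2.
split; first split.
- by rewrite -nb_verticesE vE cut_sum_vertices cut_sum_a cut_sum_b addnACA addnA.
- have := reduces_nb_edges H; have := nb_edgesE m1; have := nb_edgesE m2.
  rewrite card_sum /=; lia.
- lia.
- lia.
- lia.
split.
  rewrite rE !root_degreeE; congr (_ + _).+2; rewrite /opt_orbit_size /=.
    by case: (smap_root m1) => //= x; rewrite cut_sum_porbitl card_imset.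
  by case: (smap_root m2) => //= x; rewrite cut_sum_porbitr card_imset.
rewrite (reduces_dist_degrees H) /insert_at map_interleave -!map_comp !dist_degreesE.
by congr interleave; apply: eq_map => v /=; rewrite card_imset.
Qed.

End Sum.

Section SumSplit.

Lemma inl_inj A B : injective (@inl A B). Proof. by move=> x y []. Qed.
Lemma inr_inj A B : injective (@inr A B). Proof. by move=> x y []. Qed.

(** Each side is connected to its root, so an isomorphism cannot mix the two
    sides. *)
Lemma cut_sum_side_l m1 m2 n1 n2 mu nu f :
  @cut_iso (cut_sum m1 m2 mu) (cut_sum n1 n2 nu) f ->
  exists g : smap_dart m1 -> smap_dart n1, forall x, f (inl x) = inl (g x).
Proof.
move=> [_ [fR fL] fa _ _].
apply: (@fin_all_exists _ _ (fun x z => f (inl x) = inl z)).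
apply: smap_ind => [x [z zE]|x [z zE]|x xr].
- by exists (smap_R n1 z); rewrite -(@cut_sum_Rl m1 m2 mu) fR zE cut_sum_Rl.
- by exists (smap_L n1 z); rewrite -(@cut_sum_Ll m1 m2 mu) fL zE cut_sum_Ll.
by move: fa; rewrite /= xr /=; case: (smap_root n1) => //= z [->]; exists z.
Qed.

Lemma cut_sum_side_r m1 m2 n1 n2 mu nu f :
  @cut_iso (cut_sum m1 m2 mu) (cut_sum n1 n2 nu) f ->
  exists g : smap_dart m2 -> smap_dart n2, forall x, f (inr x) = inr (g x).
Proof.
move=> [_ [fR fL] _ fb _].
apply: (@fin_all_exists _ _ (fun x z => f (inr x) = inr z)).
apply: smap_ind => [x [z zE]|x [z zE]|x xr].
- by exists (smap_R n2 z); rewrite -(@cut_sum_Rr m1 m2 mu) fR zE cut_sum_Rr.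
- by exists (smap_L n2 z); rewrite -(@cut_sum_Lr m1 m2 mu) fL zE cut_sum_Lr.
by move: fb; rewrite /= xr /=; case: (smap_root n2) => //= z [->]; exists z.
Qed.

Lemma mask_cut_sum m1 m2 mu : size (smap_dist m1) = count id mu -> size (smap_dist m2) =
  count negb mu ->
  mask mu (cut_dist (cut_sum m1 m2 mu)) =
    [seq inl @: (v : {set smap_dart m1}) | v <- smap_dist m1] /\
  mask (map negb mu) (cut_dist (cut_sum m1 m2 mu)) =
    [seq inr @: (v : {set smap_dart m2}) | v <- smap_dist m2].
Proof. by move=> S1 S2; apply: mask_interleave; rewrite size_map. Qed.

Lemma cut_sum_inj m1 m2 n1 n2 mu nu f :
  size (smap_dist m1) = count id mu -> size (smap_dist m2) = count negb mu ->
  size (smap_dist n1) = count id nu -> size (smap_dist n2) = count negb nu ->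
  @cut_iso (cut_sum m1 m2 mu) (cut_sum n1 n2 nu) f ->
  [/\ mu = nu, iso m1 n1 & iso m2 n2].
Proof.
move=> S1 S2 S1' S2' H; have [g gE] := cut_sum_side_l H; have [h hE] := cut_sum_side_r H.
have [fB [fR fL] fa fb fd] := H.
have fI := bij_inj fB; have [f' fK f'K] := fB.
have gI : injective g by move=> x y E; have /fI[] : f (inl x) = f (inl y) by rewrite !gE E.
have hI : injective h by move=> x y E; have /fI[] : f (inr x) = f (inr y) by rewrite !hE E.
have gB : bijective g.
  apply: inj_surj_bij => // y; have := f'K (inl y).
  by case: (f' _) => [x|x]; rewrite ?gE ?hE // => -[<-]; exists x.
have hB : bijective h.
  apply: inj_surj_bij => // y; have := f'K (inr y).
  by case: (f' _) => [x|x]; rewrite ?gE ?hE // => -[<-]; exists x.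
(* The mask is recovered as the list of sides of the distinguished vertices. *)
pose left (n1 n2 : smap) (v : {set smap_dart n1 + smap_dart n2}) := [exists x, inl x \in v].
have left_l k1 k2 (w : {set smap_dart k1}) : w \in smap_dist k1 -> left k1 k2 (inl @: w).
  move=> /smap_dist_orbit[x ->]; apply/existsP; exists x.
  by apply: imset_f; apply: porbit_id.
have left_r k1 k2 (w : {set smap_dart k2}) : ~~ left k1 k2 (inr @: w).
  by apply/existsP => -[x /imsetP[]].
have all_l k1 k2 : all (left k1 k2)
  [seq inl @: (v : {set smap_dart k1}) | v <- smap_dist k1].
  by apply/allP => _ /mapP[v vd ->]; apply: left_l.
have has_r k1 k2 : ~~ has (left k1 k2)
  [seq inr @: (v : {set smap_dart k2}) | v <- smap_dist k2].
  by apply/hasPn => _ /mapP[v vd ->]; apply: left_r.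
have mapmu k1 k2 la : size (smap_dist k1) = count id la -> size (smap_dist k2) = count
  negb la ->
    map (left k1 k2) (cut_dist (cut_sum k1 k2 la)) = la.
  by move=> Z1 Z2; apply: map_interleave_mask; rewrite ?size_map.
have fleft (v : {set cut_dart (cut_sum m1 m2 mu)}) : left n1 n2 (f @: v) = left m1 m2 v.
  apply/existsP/existsP => -[x].
    case/imsetP=> [[y|y] yv]; rewrite ?gE ?hE // => _; by exists y.
  by move=> xv; exists (g x); rewrite -gE imset_f.
have munu : mu = nu.
  rewrite -(mapmu n1 n2 nu) // -fd -map_comp -[LHS](mapmu m1 m2) //.
  by apply: eq_map => v /=; rewrite fleft.
split=> //.
  apply/isoP; exists g; split=> //.
  - by split=> x; apply: (@inl_inj _ (smap_dart n2)); rewrite -gE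
    -1?(@cut_sum_Rl m1 m2 mu) -1?(@cut_sum_Ll m1 m2 mu) ?fR ?fL gE ?cut_sum_Rl ?cut_sum_Ll.
  - move: fa => /=; case: (smap_root m1) => [x|]; case: (smap_root n1) => [y|] //=.
    by rewrite gE => -[->].
  have [E1 _] := mask_cut_sum S1 S2; have [E1' _] := mask_cut_sum S1' S2'.
  have := congr1 (mask mu) fd; rewrite -map_mask E1 munu E1' -map_comp => E.
  apply: (inj_map (imset_inj (@inl_inj _ (smap_dart n2)))); rewrite -E -map_comp.
  by apply: eq_map => v /=; rewrite -!imset_comp; apply: eq_imset => x /=; rewrite gE.
apply/isoP; exists h; split=> //.
- by split=> x; apply: (@inr_inj (smap_dart n1)); rewrite -hE -1?(@cut_sum_Rr m1 m2 mu)
  -1?(@cut_sum_Lr m1 m2 mu) ?fR ?fL hE ?cut_sum_Rr ?cut_sum_Lr.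
- move: fb => /=; case: (smap_root m2) => [x|]; case: (smap_root n2) => [y|] //=.
  by rewrite hE => -[->].
have [_ E1] := mask_cut_sum S1 S2; have [_ E1'] := mask_cut_sum S1' S2'.
have := congr1 (mask (map negb mu)) fd; rewrite -map_mask E1 munu E1' -map_comp => E.
apply: (inj_map (imset_inj (@inr_inj (smap_dart n1) _))); rewrite -E -map_comp.
by apply: eq_map => v /=; rewrite -!imset_comp; apply: eq_imset => x /=; rewrite hE.
Qed.

Lemma reduces_comp (M : seqmap) (P Q : cutmap) j i f :
  @reduces M P j i -> @cut_iso Q P f -> (forall x, cut_colour (f x) = cut_colour x) ->
    @reduces M Q j (i \o f).
Proof.
move=> H [fB [fR fL] fa fb fd] fc; have I := reduces_contraction H; have fI := bij_inj fB.
split.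
- split.
  + exact: inj_comp (bypass_inj I) fI.
  + exact: bypass_neq I.
  + by move=> x; apply: bypass_d I _.
  + by move=> x; apply: bypass_d' I _.
  + move=> y; have [g fK gK] := fB.
    case: (bypass_cov I y) => [->|->|[x ->]]; [constructor 1|constructor 2|constructor 3]
      => //.
    by exists (g x); rewrite /= gK.
  + move=> x bx ax; apply: (bypass_opt I (x := f x)).
      by rewrite -fb bx.
    by rewrite -fa ax.
  + by move=> x; rewrite /= (bypass_i I) -fa -fb -fR !omap_eq.
  + by rewrite (bypass_sd I) -fb; case: (cut_b Q).
  + by rewrite (bypass_sd' I) -fa; case: (cut_a Q).
- by move=> x /=; rewrite (reduces_L H) fL.
- by move=> x /=; rewrite (reduces_colour H) fc.
- rewrite (reduces_dist H) -fd -map_comp; congr insert_at.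
  by apply: eq_map => v /=; rewrite -imset_comp.
- by move=> k /(reduces_label H); rewrite -fd size_map.
Qed.

End SumSplit.

(** * Splitting a disconnected remainder *)

Section Piece.
Variables (P : cutmap).
Hypothesis V : cut_valid P.

Let G : {group {perm cut_dart P}} := <<[set cut_R P; cut_L P]>>%G.

Definition component (o : option (cut_dart P)) : {set cut_dart P} :=
  if o is Some x then orbit 'P G x else set0.

Lemma component_R o x : (cut_R P x \in component o) = (x \in component o).
Proof.
case: o => [y|] /=; rewrite ?inE // -[cut_R P x]/('P%act x (cut_R P)).
by rewrite orbit_sym orbit_act ?mem_gen ?inE ?eqxx // orbit_sym.
Qed.

Lemma component_L o x : (cut_L P x \in component o) = (x \in component o).
Proof.
case: o => [y|] /=; rewrite ?inE // -[cut_L P x]/('P%act x (cut_L P)).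
by rewrite orbit_sym orbit_act ?mem_gen ?inE ?eqxx ?orbT // orbit_sym.
Qed.

Lemma component_porbit o x : x \in component o -> porbit (cut_R P) x \subset component o.
Proof.
move=> xo; apply/subsetP => y; move: y.
by apply: porbit_ind => // y _; rewrite component_R.
Qed.

(** The component of the marked dart o as a map of its own, embedded by u.
    The flag flip says whether colours are exchanged so that the root
    becomes white. *)
Definition piece_of (o : option (cut_dart P)) (flip : bool) (m : smap)
  (u : smap_dart m -> cut_dart P) :=
  [/\ injective u, commute2 (smap_R m) (smap_L m) (cut_R P) (cut_L P) u, omap u
    (smap_root m) = o,
      forall x, smap_colour x = flip (+) cut_colour (u x) & forall y, y \in component o ->
        exists x, u x = y] /\
  ((forall x, u x \in component o) /\
  [seq u @: (v : {set smap_dart m}) | v <- smap_dist m] =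
    [seq v : {set cut_dart P} <- cut_dist P | v \subset component o]).

(** An absent marked dart gives the empty map. *)
Lemma piece_exists (o : option (cut_dart P)) (flip : bool) :
  (forall x, o = Some x -> flip (+) cut_colour x) ->
  (forall v x, v \in cut_dist P -> o = Some x -> x \notin v) ->
  exists m u, @piece_of o flip m u.
Proof.
case: o => [x0|] Hc Hd; last first.
  exists EmptyMap, (fun x : void => match x with end); split; first split=> //.
  - by move=> y; rewrite inE.
  split; first by case.
  symmetry; apply/eqP; rewrite -size_eq0 size_filter -leqn0 leqNgt -has_count.
  apply/hasPn => v vd; have [x ->] := valid_dist_orbit V vd.
  by apply/negP => /subsetP/(_ x (porbit_id _ _)); rewrite inE.
set A := component (Some x0).
have x0A : x0 \in A by apply: orbit_refl.
pose T := {x : cut_dart P | x \in A}.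
have TR (x : T) : cut_R P (val x) \in A by rewrite component_R; case: x.
have TL (x : T) : cut_L P (val x) \in A by rewrite component_L; case: x.
pose r (x : T) : T := exist _ (cut_R P (val x)) (TR x).
pose l (x : T) : T := exist _ (cut_L P (val x)) (TL x).
have rI : injective r by move=> x y /(congr1 val) /= /perm_inj /val_inj.
have lI : injective l by move=> x y /(congr1 val) /= /perm_inj /val_inj.
pose R := perm rI; pose L := perm lI.
have RE x : val (R x) = cut_R P (val x) by rewrite permE.
have LE x : val (L x) = cut_L P (val x) by rewrite permE.
pose c (x : T) := flip (+) cut_colour (val x).
have Linv x : L (L x) = x by apply: val_inj; rewrite !LE (valid_L_invol V).
have cR x : c (R x) = ~~ c x by rewrite /c RE (valid_colour_R V) addbN.
have cL x : c (L x) = ~~ c x by rewrite /c LE (valid_colour_L V) addbN.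
pose r0 : T := exist _ x0 x0A.
have cr : c r0 by apply: Hc.
have conn (B : {set T}) : r0 \in B -> (forall x, x \in B -> R x \in B) ->
    (forall x, x \in B -> L x \in B) -> forall x, x \in B.
  move=> Br BR BL x.
  suff BA y : y \in A -> forall z : T, val z = y -> z \in B.
    by apply: (BA (val x)) => //; case: (x).
  move: y; apply: (@generated_orbit_ind _ _ _
    (fun y => forall x : T, val x = y -> x \in B)).
  - move=> y By z zE; have yA : y \in A by rewrite -(component_R (Some x0)) -zE; case: (z).
    have -> : z = R (exist _ y yA) by apply: val_inj; rewrite RE.
    exact/BR/By.
  - move=> y By z zE; have yA : y \in A by rewrite -(component_L (Some x0)) -zE; case: (z).
    have -> : z = L (exist _ y yA) by apply: val_inj; rewrite LE.
    exact/BL/By.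
  - by move=> z zE; rewrite (_ : z = r0) //; apply: val_inj.
pose ds0 := [seq v : {set cut_dart P} <- cut_dist P | v \subset A].
pose ds := [seq [set x : T | val x \in v] | v : {set cut_dart P} <- ds0].
have dsE v : v \in ds0 -> val @: [set x : T | val x \in v] = v.
  rewrite mem_filter => /andP[/subsetP vA _]; apply/setP=> y; apply/imsetP/idP.
    by case=> x; rewrite inE => xv ->.
  by move=> yv; exists (exist _ y (vA y yv)); rewrite ?inE.
have orbE x : porbit (cut_R P) (val x) = val @: porbit R x by apply: porbit_emb => y _;
  rewrite RE.
have dsP v : v \in ds0 -> exists2 x : T, v = porbit (cut_R P) (val x) &
  [set x : T | val x \in v] = porbit R x.
  move=> vd; have := vd; rewrite mem_filter =>
    /andP[/subsetP vA /(valid_dist_orbit V)[y yE]].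
  have yA : y \in A by apply: vA; rewrite yE porbit_id.
  exists (exist _ y yA); first by rewrite yE.
  by apply: (imset_inj val_inj); rewrite dsE // -orbE.
have ds_uniq : uniq ds.
  rewrite map_inj_in_uniq ?filter_uniq ?(valid_dist_uniq V) // => v w vd wd E.
  by rewrite -(dsE v vd) E dsE.
have ds_sub : {subset ds <= porbits R}.
  by move=> _ /mapP[v /dsP[x _ ->] ->]; apply: imset_f.
have ds_x0 : porbit R r0 \notin ds.
  apply/mapP => -[v vd E]; have := vd; rewrite mem_filter => /andP[_ vP].
  have := Hd v x0 vP erefl; rewrite -(dsE v vd) -E -orbE.
  by rewrite porbit_id.
pose M := coloured_seqmap Linv cR cL cr conn ds_uniq ds_sub ds_x0.
exists (DartMap M), val; split; first split.
- exact: val_inj.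
- by split=> x /=; rewrite ?RE ?LE.
- by [].
- by move=> x; exact: (@colour_coloured_seqmap T R L c r0 ds Linv cR cL cr conn ds_uniq
  ds_sub ds_x0 x).
- by move=> y yA; exists (exist _ y yA).
split; first by case.
rewrite /= -map_comp -[RHS]map_id; apply/eq_in_map => v vd /=.
by rewrite dsE.
Qed.

Definition cut_connected : Prop :=
  exists x y, [/\ cut_a P = Some x, cut_b P = Some y & y \in component (Some x)].

Lemma root_link_connected : root_link P -> cut_connected.
Proof.
move=> [x [y [xE yE yx]]]; exists x, y; split=> //.
by apply: (subsetP (component_porbit _) _ yx); apply: orbit_refl.
Qed.

Lemma component_disj x : ~ cut_connected -> x \in component (cut_a P) -> x \in component
  (cut_b P) -> False.
Proof.
move=> nc; case aE: (cut_a P) => [a|]; case bE: (cut_b P) => [b|]; rewrite ?inE //.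
move=> xa xb; apply: nc; exists a, b; split=> //.
by rewrite /= orbit_sym; apply: orbit_trans xb; rewrite orbit_sym.
Qed.

Lemma component_cov x : x \in component (cut_a P) \/ x \in component (cut_b P).
Proof.
move: x; apply: (valid_ind V) => x; rewrite ?component_R ?component_L //.
  by move=> ->; left; apply: orbit_refl.
by move=> ->; right; apply: orbit_refl.
Qed.

(** Every component contains a marked dart, so there are at most two
    components when the marked darts are not connected. *)
Lemma disconnected_is_sum : ~ cut_connected -> exists m1 m2 mu f,
  [/\ @cut_iso (cut_sum m1 m2 mu) P f, forall x, cut_colour (f x) = cut_colour x,
     size mu = size (cut_dist P),
     dist_degrees m1 = mask mu [seq #|v| | v : {set cut_dart P} <- cut_dist P] &
     dist_degrees m2 = mask (map negb mu) [seq #|v| | v : {set cut_dart P} <- cut_dist P]].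
Proof.
move=> nc.
have [m1 [u1 [[u1I [u1R u1L] u1r u1c u1s] [u1A u1d]]]] : exists m u, @piece_of (cut_a P)
  true m u.
  apply: piece_exists => [x E|v x vd E]; first exact: (valid_a_black V E).
  exact: (valid_dist_a V vd E).
have [m2 [u2 [[u2I [u2R u2L] u2r u2c u2s] [u2A u2d]]]] : exists m u, @piece_of (cut_b P)
  false m u.
  apply: piece_exists => [x E|v x vd E]; first exact: (valid_b_white V E).
  exact: (valid_dist_b V vd E).
pose mu := [seq (v : {set cut_dart P}) \subset component (cut_a P) | v <- cut_dist P].
pose f (x : smap_dart m1 + smap_dart m2) := match x with inl y => u1 y | inr y => u2 y end.
have ds2 : [seq v : {set cut_dart P} <- cut_dist P | v \subset component (cut_b P)] =
           [seq v : {set cut_dart P} <- cut_dist P | ~~ (v \subset component (cut_a P))].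
  apply: eq_in_filter => v vd; have [x vE] := valid_dist_orbit V vd.
  have xv : x \in v by rewrite vE porbit_id.
  case: (component_cov x) => xc.
    rewrite [in RHS]vE component_porbit //=; apply/negP => /subsetP/(_ x xv).
    exact: component_disj.
  rewrite [in LHS]vE component_porbit //; symmetry; apply/negP => /subsetP/(_ x xv) xa.
  exact: component_disj xa xc.
have ds1m : [seq v : {set cut_dart P} <- cut_dist P | v \subset component (cut_a P)] =
  mask mu (cut_dist P).
  by rewrite filter_mask.
have ds2m : [seq v : {set cut_dart P} <- cut_dist P | v \subset component (cut_b P)] =
  mask (map negb mu) (cut_dist P).
  by rewrite ds2 filter_mask /mu -map_comp.
exists m1, m2, mu, f; split.
- split.
  + apply: inj_surj_bij.
      move=> [x|x] [y|y] /= E; rewrite ?(u1I _ _ E) ?(u2I _ _ E) //.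
        by case: (component_disj nc (u1A x)); rewrite E.
      by case: (component_disj nc (u1A y)); rewrite -E.
    move=> y; case: (component_cov y) => [/u1s[x <-]|/u2s[x <-]];
      [by exists (inl x)|by exists (inr x)].
  + by split=> [] [x|x]; rewrite ?cut_sum_Rl ?cut_sum_Rr ?cut_sum_Ll ?cut_sum_Lr /= ?u1R
    ?u2R ?u1L ?u2L.
  + by rewrite -u1r /=; case: (smap_root m1).
  + by rewrite -u2r /=; case: (smap_root m2).
  + rewrite /= map_interleave -!map_comp.
    rewrite -[RHS](interleave_mask (mu := mu)) ?size_map // -ds1m -ds2m -u1d -u2d.
    by congr interleave; apply: eq_map => v /=; rewrite -imset_comp.
- by case=> x /=; [rewrite u1c /= negbK | rewrite u2c].
- by rewrite size_map.
- rewrite dist_degreesE -map_mask -ds1m -u1d -map_comp; apply: eq_map => v /=.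
  by rewrite card_imset.
- rewrite dist_degreesE -map_mask -ds2m -u2d -map_comp; apply: eq_map => v /=.
  by rewrite card_imset.
Qed.

End Piece.

(** * Connected remainders *)

Section Bimarked.

(** A single map as a remainder: its root takes the place of [cut_a] and is
    white, whereas [cut_a] is black, so the colours are exchanged. *)
Definition bimarked (M : seqmap) (b : dart M) (ds : seq {set dart M}) : cutmap :=
  @CutMap (dart M) (mapR M) (mapL M) (fun x => ~~ colour x) (Some (Defs.root M)) (Some b)
    ds.

Lemma bimarked_valid (M : seqmap) (b : dart M) ds : ~~ colour b -> uniq ds ->
  {subset ds <= dist M} -> (forall v, v \in ds -> b \notin v) ->
  cut_valid (bimarked b ds).
Proof.
move=> cb du ds_sub db; split=> //=.
- exact: mapL_invol.
- by move=> x; rewrite colour_R.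
- by move=> x; rewrite colour_L.
- by move=> x [<-]; rewrite negbK colour_root.
- by move=> x [<-].
- by move=> A AR AL Aa _; apply: (cmap_ind AR AL (Aa _ erefl)).
- by move=> v /ds_sub; apply: (@smap_dist_orbit (DartMap M)).
- by move=> v x /ds_sub vd [<-]; apply: (@smap_dist_root (DartMap M) _ _ vd).
- by move=> v x vd [<-]; apply: db.
Qed.

Lemma bimarked_connected (M : seqmap) (b : dart M) ds : cut_connected (bimarked b ds).
Proof.
exists (Defs.root M), b; split=> //=.
by rewrite (atransP (map_trans M)) ?inE.
Qed.

Section Counts.
Variables (M N : seqmap) (b : dart N) (ds : seq {set dart N}) (j : option nat).
Variable i : cut_dart (bimarked b ds) -> dart M.
Hypothesis H : @reduces M (bimarked b ds) j i.

Lemma bimarked_counts :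
  [/\ nb_edges (DartMap M) = nb_edges (DartMap N) + 1,
      nb_faces (DartMap M) = nb_faces (DartMap N),
      nb_white (DartMap M) = nb_black (DartMap N) &
      nb_black (DartMap M) = nb_white (DartMap N)].
Proof.
rewrite (reduces_nb_faces H) (reduces_nb_white H) (reduces_nb_black H).
rewrite nb_facesE nb_whiteE nb_blackE !addn0.
have E : orbit_count (cut_RL (bimarked b ds)) (fun x => ~~ @cut_colour (bimarked b ds) x)
  = orbit_count (mapRL N) (@colour N).
  by apply: eq_orbit_count => x /=; rewrite negbK.
rewrite E; split=> //.
have := reduces_nb_edges H; have -> : #|cut_dart (bimarked b ds)| = #|smap_dart
  (DartMap N)| by [].
by rewrite -nb_edgesE; lia.
Qed.

(** The root edge is a loop whose removal splits the root vertex in two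
    without disconnecting the map, so the map has one vertex fewer than the
    remainder, and its genus is one more. *)
Lemma bimarked_loop_counts : j = None -> b \notin vertex_of (Defs.root N) ->
  [/\ nb_vertices (DartMap M) + 1 = nb_vertices (DartMap N),
      root_degree (DartMap M) = (root_degree (DartMap N) + #|vertex_of b|).+2 &
      dist_degrees (DartMap M) = [seq #|v| | v : {set dart N} <- ds]].
Proof.
move=> jE nb.
have nl : ~ root_link (bimarked b ds).
  by case=> x [y [/= [<-] [<-]]]; apply/negP.
have [_ rE vE] := reduces_loop H nl; split.
- by rewrite vE nb_verticesE !addn0.
- by rewrite rE.
by rewrite (reduces_dist_degrees H) jE.
Qed.

(** The root edge is a link; the root vertex of the remainder is cut into a
    run of k darts and the rest. *)
Lemma bimarked_link_counts k : b = iter k (mapR N) (Defs.root N) ->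
  0 < k < root_degree (DartMap N) ->
  [/\ nb_vertices (DartMap M) = nb_vertices (DartMap N) + 1,
      root_degree (DartMap M) = k.+1 &
      dist_degrees (DartMap M) =
        insert_at j (root_degree (DartMap N) - k).+1 [seq #|v| | v : {set dart N} <- ds]].
Proof.
move=> bE kP.
have [_ rE dE vE] := reduces_link H (erefl : cut_a (bimarked b ds) = Some (Defs.root N)) kP
  (congr1 Some bE : cut_b (bimarked b ds) = Some (iter k (mapR N) (Defs.root N))).
split=> //; first by rewrite vE nb_verticesE addn0.
by rewrite (reduces_dist_degrees H) dE.
Qed.
End Counts.

(** The component of [cut_a] is everything, so the remainder is a map rooted
    at [cut_a]. *)
Lemma bimarked_exists (P : cutmap) a b ds : cut_valid P -> cut_a P = Some a -> cut_b P =
  Some b ->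
  cut_connected P -> uniq ds -> (forall v, v \in ds -> exists x, v = porbit (cut_R P) x) ->
  (forall v, v \in ds -> a \notin v) ->
  exists (M : seqmap) (f : dart M -> cut_dart P),
  [/\ bijective f, commute2 (mapR M) (mapL M) (cut_R P) (cut_L P) f, f (Defs.root M) = a,
      forall x, colour x = ~~ cut_colour (f x) &
        [seq f @: (v : {set dart M}) | v <- dist M] = ds].
Proof.
move=> V aE bE [x [y [xE yE xy]]] du dorb dx.
have xa : x = a by move: xE; rewrite aE => -[].
have yb : y = b by move: yE; rewrite bE => -[].
subst x y.
have cR z : ~~ cut_colour (cut_R P z) = ~~ ~~ cut_colour z by rewrite (valid_colour_R V).
have cL z : ~~ cut_colour (cut_L P z) = ~~ ~~ cut_colour z by rewrite (valid_colour_L V).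
have conn (A : {set cut_dart P}) : a \in A -> (forall x, x \in A -> cut_R P x \in A) ->
    (forall x, x \in A -> cut_L P x \in A) -> forall x, x \in A.
  move=> Aa AR AL; apply: (valid_ind V) => // z; first by rewrite aE => -[<-].
  rewrite bE => -[<-]; exact: (generated_orbit_ind (A := fun z => z \in A) AR AL Aa xy).
have ds_sub : {subset ds <= porbits (cut_R P)}.
  by move=> v /dorb[z ->]; apply: imset_f.
have ds_a : porbit (cut_R P) a \notin ds.
  by apply/negP => /dx; rewrite porbit_id.
pose M := @coloured_seqmap (cut_dart P) (cut_R P) (cut_L P) (fun z => ~~ cut_colour z) a
  ds (valid_L_invol V) cR cL (valid_a_black V aE)
  conn du ds_sub ds_a.
exists M, id; split=> //; first by exists id.
  by move=> z; exact: (@colour_coloured_seqmap (cut_dart P) (cut_R P) (cut_L P)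
    (fun z => ~~ cut_colour z) a ds (valid_L_invol V)
     cR cL (valid_a_black V aE) conn du ds_sub ds_a z).
by rewrite -[RHS]map_id; apply: eq_map => v; rewrite imset_id.
Qed.

Lemma bimarked_iso (M N : seqmap) b b' ds ds' f :
  @cut_iso (@bimarked M b ds) (@bimarked N b' ds') f ->
  [/\ bijective f, commute2 (mapR M) (mapL M) (mapR N) (mapL N) f,
      f (Defs.root M) = Defs.root N, f b = b' &
      [seq f @: (v : {set dart M}) | v <- ds] = ds'].
Proof. by case=> fB fC [fr] [fb] fd. Qed.

Lemma iter_commute (M N : seqmap) (f : dart M -> dart N) k x :
  (forall x, f (mapR M x) = mapR N (f x)) ->
  f (iter k (mapR M) x) = iter k (mapR N) (f x).
Proof. by move=> fR; elim: k => //= k <-. Qed.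

(** The fixed darts contain the root and are stable under both permutations. *)
Lemma rooted_map_rigid (M : seqmap) (f : dart M -> dart M) :
  commute2 (mapR M) (mapL M) (mapR M) (mapL M) f -> f (Defs.root M) = Defs.root M ->
  forall x, f x = x.
Proof.
move=> [fR fL] fr; apply: (@cmap_ind M (fun x => f x = x) _ _ _ fr) => x xE.
  by rewrite fR xE.
by rewrite fL xE.
Qed.

Lemma connected_cut_iso P Q f : @cut_iso P Q f -> cut_connected P -> cut_connected Q.
Proof.
move=> [_ [fR fL] fa fb _] [x [y [xE yE xy]]]; exists (f x), (f y).
rewrite -fa -fb xE yE; split=> //.
apply: (generated_orbit_ind (A := fun z => f z \in component (Some (f x))) _ _ _ xy) =>
  [z|z|].
- by rewrite fR component_R.
- by rewrite fL component_L.
- exact: orbit_refl.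
Qed.

Lemma root_link_cut_iso P Q f : @cut_iso P Q f -> root_link P -> root_link Q.
Proof.
move=> [fB [fR fL] fa fb _] [x [y [xE yE xy]]]; exists (f x), (f y).
rewrite -fa -fb xE yE; split=> //.
by rewrite (porbit_emb (s' := cut_R P)) // imset_f.
Qed.

Lemma cut_iso_sym P Q f : @cut_iso P Q f -> exists h, @cut_iso Q P h.
Proof.
move=> [[h fK hK] [fR fL] fa fb fd]; exists h; split.
- by exists f.
- by split=> x; apply: (can_inj fK); rewrite ?fR ?fL !hK.
- by rewrite -fa; case: (cut_a P) => //= x; rewrite fK.
- by rewrite -fb; case: (cut_b P) => //= x; rewrite fK.
- rewrite -fd -map_comp -[RHS]map_id; apply: eq_map => v /=.
  by rewrite -imset_comp (eq_imset (g := id)) ?imset_id // => x /=; rewrite fK.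
Qed.

End Bimarked.

(** The bijection is obtained from a relation by choice. *)
Lemma bijective_of_relation (A B : Type) (S : A -> B -> Prop) :
  (forall a, exists b, S a b) -> (forall b, exists a, S a b) ->
  (forall a b b', S a b -> S a b' -> b = b') ->
  (forall a a' b, S a b -> S a' b -> a = a') ->
  exists f : B -> A, bijective f.
Proof.
move=> Sl Sr fl fr.
exists (fun b => projT1 (cid (Sr b))); exists (fun a => projT1 (cid (Sl a))).
  by move=> b; case: (cid (Sr b)) => a ab /=; case: cid => b' ab' /=; apply: fl ab' ab.
by move=> a; case: (cid (Sl a)) => b ab /=; case: cid => a' ab' /=; apply: fr ab' ab.
Qed.

Local Open Scope ring_scope.

(** * Isomorphism classes and their parameters *)

Section Fset.

Lemma iso_class m m' : iso m m' -> iso m = iso m'.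
Proof.
move=> mm'; apply: funext => x; apply: propext; split; last exact: iso_trans.
exact/iso_trans/iso_sym.
Qed.

Lemma has_params_iso g e w b n D m m' :
  iso m m' -> has_params g e w b n D m -> has_params g e w b n D m'.
Proof.
by move=> /iso_counts[[vE eE fE wE bE] [rE dE]]; rewrite /has_params /has_genus vE eE fE
  wE bE rE dE.
Qed.

Lemma double_map_inj : injective (map (fun d : int => 2 * d)).
Proof. by apply: inj_map => x y; lia. Qed.

Lemma has_params_inj g e w b n D g' e' w' b' n' D' m :
  has_params g e w b n D m -> has_params g' e' w' b' n' D' m ->
  [/\ g = g', e = e', w = w' & b = b'] /\ (n = n' /\ D = D').
Proof.
move=> [gE eE [wE bE rE dE]] [gE' eE' [wE' bE' rE' dE']].
split; first split.
- by move: gE gE'; rewrite /has_genus; lia.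
- by rewrite -eE.
- by rewrite -wE.
- by rewrite -bE.
split; first by move: rE rE'; lia.
by apply: double_map_inj; rewrite -dE.
Qed.

Section Class.
Variables (g e w b n : int) (D : seq int).
Notation F := (Fset g e w b n D).

Lemma Fset_mk m : has_params g e w b n D m -> exists X : F, sval X m.
Proof.
move=> Hm; have P : exists2 m0, has_params g e w b n D m0 & iso m = iso m0 by exists m.
by exists (exist _ (iso m) P); apply: iso_refl.
Qed.

Lemma Fset_rep (X : F) : exists m, sval X m.
Proof. by have [m _ E] := svalP X; exists m; rewrite E; apply: iso_refl. Qed.

Lemma Fset_params (X : F) m : sval X m -> has_params g e w b n D m.
Proof. by have [m0 Hm ->] := svalP X; move=> /has_params_iso; apply. Qed.

Lemma Fset_iso (X : F) m m' : sval X m -> sval X m' -> iso m m'.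
Proof.
by have [m0 _ ->] := svalP X; move=> /iso_sym mm0 m0m'; apply: iso_trans m0m'.
Qed.

Lemma Fset_closed (X : F) m m' : sval X m -> iso m m' -> sval X m'.
Proof. by have [m0 _ ->] := svalP X; apply: iso_trans. Qed.

Lemma Fset_eq (X Y : F) m : sval X m -> sval Y m -> X = Y.
Proof.
case: X Y => [C PC] [C' PC'] /= Cm C'm.
suff E : C = C' by subst C'; congr exist; apply: Prop_irrelevance.
case: PC PC' => [m0 _ E0] [m1 _ E1]; rewrite E0 in Cm *; rewrite E1 in C'm *.
by rewrite (iso_class Cm) (iso_class C'm).
Qed.

(** One fixed element of each isomorphism class; see [glues_loop] for its
    use. *)
Definition representative (X : F) : smap := projT1 (cid (Fset_rep X)).

Lemma representativeP (X : F) : sval X (representative X).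
Proof. exact: projT2 (cid (Fset_rep X)). Qed.

End Class.

Lemma has_genus_exists m : exists g, has_genus m g.
Proof.
have [h hE] := genus_even m; exists (1 - h%:Z + (nb_edges m)%:Z).
by rewrite /has_genus; lia.
Qed.

Lemma size_smap_dist g e w b n D m : has_params g e w b n D m -> size (smap_dist m) = size
  D.
Proof.
by move=> [_ _ [_ _ _ /(congr1 size)]]; rewrite dist_degreesE !size_map.
Qed.

(** The root vertex is counted in both pieces and the root edge in neither,
    so the Euler characteristics of the pieces add up to that of the map
    plus two: genera add. *)
Lemma params_sum g1 e1 w1 b1 n1 g2 e2 w2 b2 n2 D mu m1 m2 M i :
  has_params g1 e1 w1 b1 n1 (mask mu D) m1 ->
  has_params g2 e2 w2 b2 n2 (mask (map negb mu) D) m2 ->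
  size mu = size D -> @reduces M (cut_sum m1 m2 mu) None i ->
  has_params (g1 + g2) (e1 + e2 + 1) (b1 + w2) (w1 + b2) (n1 + n2 + 1) D (DartMap M).
Proof.
move=> [G1 E1 [W1 B1 glue_R D1]] [G2 E2 [W2 B2 R2 D2]] smu H.
have [[vE eE fE wE bE] [rE dE]] := reduces_sum_counts H.
split; [|lia|split; [lia|lia|lia|]].
  by move: G1 G2; rewrite /has_genus; lia.
by rewrite dE map_interleave D1 D2 -map_interleave interleave_mask.
Qed.

(** The genera of the pieces exist by [has_genus_exists], and their root
    degrees are even. *)
Lemma params_split g e w b n D mu m1 m2 M i :
  has_params g e w b n D (DartMap M) -> size mu = size D ->
  @reduces M (cut_sum m1 m2 mu) None i ->
  dist_degrees m1 = mask mu (dist_degrees (DartMap M)) ->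
  dist_degrees m2 = mask (map negb mu) (dist_degrees (DartMap M)) ->
  exists s : splitting g e w b n D, smask s = mu :> seq bool /\
   (has_params (sg1 s) (se1 s) (sw1 s) (sb1 s) (sn1 s) (sD1 s) m1 /\
    has_params (sg2 s) (se2 s) (sw2 s) (sb2 s) (sn2 s) (sD2 s) m2).
Proof.
move=> [G0 E0 [W0 B0 R0 D0]] smu H d1 d2.
have [[vE eE fE wE bE] [rE dE]] := reduces_sum_counts H.
have [g1 G1] := has_genus_exists m1; have [g2 G2] := has_genus_exists m2.
have r1 : exists h, root_degree m1 = (h * 2)%N.
  by exists (root_degree m1)./2; rewrite muln2 even_halfK // root_degree_even.
have r2 : exists h, root_degree m2 = (h * 2)%N.
  by exists (root_degree m2)./2; rewrite muln2 even_halfK // root_degree_even.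
case: r1 r2 => [h1 r1] [h2 r2].
have smu' : size mu == size D by apply/eqP.
have gg : g1 + g2 = g by move: G0 G1 G2; rewrite /has_genus; lia.
have ee : (nb_edges m1)%:Z + (nb_edges m2)%:Z = e - 1 by lia.
have wb : (nb_white m1)%:Z + (nb_black m2)%:Z = b by lia.
have bw : (nb_white m2)%:Z + (nb_black m1)%:Z = w by lia.
have nn : h1%:Z + h2%:Z = n - 1 by lia.
exists (Splitting (Tuple smu') gg ee wb bw nn); split=> //=; split; split=> //; split=> //=.
- by rewrite r1; lia.
- by rewrite d1 map_mask D0 -map_mask.
- by rewrite r2; lia.
- by rewrite d2 map_mask D0 -map_mask.
Qed.

Lemma cut_sum_iso m1 m2 n1 n2 mu : iso m1 n1 -> iso m2 n2 ->
  exists f, @cut_iso (cut_sum m1 m2 mu) (cut_sum n1 n2 mu) f.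
Proof.
move=> /isoP[f [[f' fK f'K] [fR fL] fr fd]] /isoP[h [[h' hK h'K] [hR hL] hr hd]].
exists (sum_map f h); split.
- by exists (sum_map f' h') => -[x|x] /=; rewrite ?fK ?f'K ?hK ?h'K.
- by split=> -[x|x]; rewrite ?cut_sum_Rl ?cut_sum_Rr ?cut_sum_Ll ?cut_sum_Lr /= ?fR ?fL
  ?hR ?hL ?cut_sum_Rl ?cut_sum_Rr ?cut_sum_Ll ?cut_sum_Lr.
- by rewrite /= -fr; case: (smap_root m1).
- by rewrite /= -hr; case: (smap_root m2).
rewrite /= map_interleave -fd -hd -!map_comp; congr interleave; apply: eq_map => v /=.
  by rewrite -!imset_comp; apply: eq_imset.
by rewrite -!imset_comp; apply: eq_imset.
Qed.

Lemma bimarked_iso_next (N N' : seqmap) k : iso (DartMap N) (DartMap N') ->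
  exists f, @cut_iso (bimarked (iter k (mapR N) (Defs.root N)) (dist N))
                     (bimarked (iter k (mapR N') (Defs.root N')) (dist N')) f.
Proof.
move=> /isoP[f [fB [fR fL] [fr] fd]]; exists f; split=> //=; first by rewrite fr.
by rewrite (iter_commute _ _ fR) fr.
Qed.

Lemma insert_remove (D : seq int) j : (j < size D)%N ->
  insert_at (Some j) D`_j (remove_at j D) = D.
Proof.
move=> jD; rewrite /insert_at /remove_at.
rewrite take_size_cat ?drop_size_cat ?size_takel ?(ltnW jD) //.
by rewrite -drop_nth // cat_take_drop.
Qed.

End Fset.

(** * The bijection *)

Section Main.
Variables (g e w b n : int) (D : seq int).
Hypothesis hpos : 0 < e -> 0 < n /\ {in D, forall d, 0 < d}.

Notation F := (Fset g e w b n D).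

Definition ProductTerm : Type := {s : splitting g e w b n D &
           (Fset (sg1 s) (se1 s) (sw1 s) (sb1 s) (sn1 s) (sD1 s) *
            Fset (sg2 s) (se2 s) (sw2 s) (sb2 s) (sn2 s) (sD2 s))%type}.
Definition LoopTerm : Type := {p : irange 1 (n - 2) &
           (Fset (g - 1) (e - 1) b w (n - 1 - sval p) (sval p :: D) *
            irange 1 (sval p))%type}.
Definition FreeTerm : Type := {p : irange n (e - 1) & Fset g (e - 1) b w (sval p) D}.
Definition MarkedTerm : Type :=
  {j : 'I_(size D) & Fset g (e - 1) b w (D`_j + n - 1) (remove_at j D)}.
Definition EmptyTerm : Type := Delta ((g, e, w, b, n, D) = (0, 0, 1, 0, 0, [::])).

(** The root edge is a loop whose removal disconnects the map, or leaves an
    empty piece. *)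
Definition glues_product (x : ProductTerm) (X : F) : Prop :=
  exists m1 m2 M i, [/\ sval (projT2 x).1 m1, sval (projT2 x).2 m2, sval X (DartMap M) &
    @reduces M (cut_sum m1 m2 (smask (projT1 x))) None i].

Definition head_blacks (N : seqmap) : {set dart N} :=
  [set x in head set0 (dist N) | ~~ colour x].
Definition head_black (N : seqmap) (k : nat) : dart N := nth (Defs.root N)
  (enum (head_blacks N)) k.-1.

(** The root edge is a loop whose removal does not disconnect the map. Of
    the two parts of its vertex, one becomes the root vertex and the other a
    new distinguished vertex, put first in the list. The loop can be put
    back at any black dart of the latter; the number in {1, ..., p}
    designates this dart in the chosen representative of the class. As
    rooted maps have no nontrivial automorphism, such a numbering is well
    defined on classes. *)
Definition glues_loop (x : LoopTerm) (X : F) : Prop :=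
  exists N M i, [/\ representative (projT2 x).1 = DartMap N, sval X (DartMap M) &
    @reduces M (bimarked (head_black N `|sval (projT2 x).2|%N) (behead (dist N))) None i].

(** The cut made to restore a root vertex of degree 2n: the root and the 2n
    - 2 darts after it stay at this vertex, and the darts from this one on
    go to the other end of the edge. *)
Definition split_dart (N : seqmap) : dart N := iter (`|n|%N).*2.-1 (mapR N) (Defs.root N).

(** The root edge is a link, and its far end is not distinguished. *)
Definition glues_free (x : FreeTerm) (X : F) : Prop :=
  exists N M i, [/\ sval (projT2 x) (DartMap N), sval X (DartMap M) &
    @reduces M (bimarked (split_dart N) (dist N)) None i].

(** The root edge is a link, and its far end is the distinguished vertex of
    label j. *)
Definition glues_marked (x : MarkedTerm) (X : F) : Prop :=
  exists N M i, [/\ sval (projT2 x) (DartMap N), sval X (DartMap M) &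
    @reduces M (bimarked (split_dart N) (dist N)) (Some (val (projT1 x))) i].

Lemma glues_product_exists x : exists X, glues_product x X.
Proof.
case: x => s [X1 X2]; pose m1 := representative X1; pose m2 := representative X2.
have [M [i H]] : exists M i, @reduces M (cut_sum m1 m2 (smask s)) None i.
  by apply: glue_exists => //; apply: cut_sum_valid.
have P := params_sum (Fset_params (representativeP X1)) (Fset_params (representativeP X2))
  (size_tuple _) H.
suff [X XM] : exists X : F, sval X (DartMap M).
  by exists X, m1, m2, M, i; split=> //; apply: representativeP.
have [gg ee wb bw nn] : [/\ sg1 s + sg2 s = g, se1 s + se2 s = e - 1,
    sw1 s + sb2 s = b, sw2 s + sb1 s = w & sn1 s + sn2 s = n - 1] by case: (s).
by apply: Fset_mk; move: P; rewrite gg ee nn wb [sb1 s + _]addrC bw !subrK.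
Qed.

Lemma dist_head_orbit (N : seqmap) v ds : dist N = v :: ds ->
  forall x, x \in v -> v = porbit (mapR N) x.
Proof.
move=> E x xv; have [y vE] : exists y, v = porbit (mapR N) y.
  by apply: (@smap_dist_orbit (DartMap N)); rewrite /= E inE eqxx.
by apply/eqP; rewrite vE eq_porbit_mem porbit_sym -vE.
Qed.

(** Half of the 2p darts of the first distinguished vertex can receive the
    loop. *)
Lemma head_blacks_half (N : seqmap) v ds : dist N = v :: ds -> #|v| =
  (#|head_blacks N| * 2)%N.
Proof.
move=> E; rewrite /head_blacks E /=; have [] // := colour_half (@colour_R N) (A := v).
have [y vE] : exists y, v = porbit (mapR N) y.
  by apply: (@smap_dist_orbit (DartMap N)); rewrite /= E inE eqxx.
by move=> x; rewrite vE mem_next_porbit.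
Qed.

Lemma head_blacksP (N : seqmap) v ds b0 : dist N = v :: ds -> b0 \in head_blacks N ->
  [/\ ~~ colour b0, v = vertex_of b0, b0 \notin vertex_of (Defs.root N) &
      forall u, u \in ds -> b0 \notin u].
Proof.
move=> E; rewrite inE E /= => /andP[bv cb].
have vb := dist_head_orbit E bv; have := dist_uniq N; rewrite E /= => /andP[vds _].
split=> //.
  have := @smap_dist_root (DartMap N) v (Defs.root N); rewrite /= E inE eqxx.
  by move=> /(_ isT erefl); rewrite {1}vb /vertex_of porbit_sym.
move=> u ud; apply: contra vds => bu; suff -> : v = u by [].
have [y uE] : exists y, u = porbit (mapR N) y.
  by apply: (@smap_dist_orbit (DartMap N)); rewrite /= E inE ud orbT.
by apply/eqP; rewrite vb uE eq_porbit_mem -uE.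
Qed.

Lemma loop_head_black (x : LoopTerm) N : representative (projT2 x).1 = DartMap N ->
  head_black N `|sval (projT2 x).2|%N \in head_blacks N /\
  exists v ds, dist N = v :: ds.
Proof.
case: x => -[p pP] [F' [k kP]] /= rE.
have := Fset_params (representativeP F'); rewrite rE => -[_ _ [_ _ _]].
case E: (dist N) => [|v ds] /=; rewrite E //= => -[vp _]; split; last by exists v, ds.
rewrite /head_black -mem_enum mem_nth // -cardE.
by have := head_blacks_half E; move: kP => /andP[] /=; lia.
Qed.

Lemma glues_loop_exists x : exists X, glues_loop x X.
Proof.
case rE : (representative (projT2 x).1) => [|N].
  by have := Fset_params (representativeP (projT2 x).1); rewrite rE => -[_ _ [_ _ _]].
have [bN [v [ds E]]] := loop_head_black rE.
have [cb vE br bds] := head_blacksP E bN.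
have sub : {subset behead (dist N) <= dist N} by move=> u; apply: mem_behead.
have V : cut_valid (bimarked (head_black N `|sval (projT2 x).2|%N) (behead (dist N))).
  apply: bimarked_valid => //; last by rewrite E.
  by have := dist_uniq N; rewrite E => /andP[].
have [M [i H]] := glue_exists (j := None) V ltac:(by []).
suff [X XM] : exists X : F, sval X (DartMap M) by exists X, N, M, i.
have [eE fE wE bE] := bimarked_counts H; have [nE rE' dE] := bimarked_loop_counts H erefl
  br.
have := Fset_params (representativeP (projT2 x).1); rewrite rE => -[G0 E0 [W0 B0 R0 D0]].
have [vD dD] : (#|v|%:Z = 2 * sval (projT1 x) /\
    [seq k%:Z | k <- [seq #|u| | u : {set dart N} <- ds]] = [seq 2 * d | d <- D]).
  by move: D0; rewrite /= E /= => -[-> ->].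
apply: Fset_mk; split.
- by move: G0; rewrite /has_genus; lia.
- by lia.
split; [lia | lia | | by rewrite dE E].
by rewrite rE'; move: vD; rewrite vE; lia.
Qed.

(** This gives access to the positivity of the half-degrees, which is only
    assumed for maps with an edge. *)
Lemma edges_gt0 (N : seqmap) g0 w0 b0 n0 D0 :
  has_params g0 (e - 1) w0 b0 n0 D0 (DartMap N) -> 0 < e.
Proof. by move=> [_ E _]; lia. Qed.

Lemma split_dart_valid (N : seqmap) : 0 < n -> cut_valid (bimarked (split_dart N) (dist N)).
Proof.
move=> n0; apply: bimarked_valid => //; first 1 last.
- exact: dist_uniq.
- move=> v vd; apply/negP => bv.
  have [y vE] := @smap_dist_orbit (DartMap N) v vd.
  have := @smap_dist_root (DartMap N) v (Defs.root N) vd erefl.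
  rewrite vE /= porbit_sym; move: bv; rewrite vE /split_dart /= => bv.
  have -> : porbit (mapR N) (Defs.root N) = porbit (mapR N) y.
    by apply/eqP; rewrite eq_porbit_mem porbit_sym; move: bv;
       rewrite -!eq_porbit_mem => /eqP <-; rewrite eq_porbit_mem iter_mem_porbit.
  by rewrite porbit_id.
rewrite /split_dart (colour_iter (@colour_R N)) colour_root.
by rewrite (_ : odd _ = true) //; move: n0; case: (n) => [[|m]|m] // _; rewrite /=
  odd_double.
Qed.

Lemma split_dart_link (N : seqmap) : root_link (bimarked (split_dart N) (dist N)).
Proof.
exists (Defs.root N), (split_dart N); split=> //.
exact: iter_mem_porbit.
Qed.

Lemma split_dart_counts (M N : seqmap) j i : 0 < n ->
  ((`|n|%N).*2 <= root_degree (DartMap N))%N -> @reduces M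
    (bimarked (split_dart N) (dist N)) j i ->
  [/\ nb_vertices (DartMap M) = (nb_vertices (DartMap N) + 1)%N,
      root_degree (DartMap M) = (`|n|%N).*2 &
      dist_degrees (DartMap M) = insert_at j (root_degree (DartMap N) - (`|n|%N).*2).+2
           (dist_degrees (DartMap N))].
Proof.
move=> n0 le_n H; have kP : (0 < (`|n|%N).*2.-1 < root_degree (DartMap N))%N by lia.
have [-> -> dE] := bimarked_link_counts H erefl kP; split=> //; first by lia.
by rewrite dE; congr insert_at; lia.
Qed.

Lemma glues_free_exists x : exists X, glues_free x X.
Proof.
case: x => -[p pP] F'; have [m Fm] := Fset_rep F'; have P := Fset_params Fm.
have e0 : 0 < e by case: P => _ E _; move: E; lia.
have [n0 _] := hpos e0; have pP' := pP; move/andP: pP' => [np pe].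
have P' := P; case: P => G0 E0 [/= W0 B0 R0 D0].
case: m Fm G0 E0 W0 B0 R0 D0 P' => [|N] Fm G0 E0 W0 B0 R0 D0 P'; first by move: R0 => /=;
  lia.
have le_n : ((`|n|%N).*2 <= root_degree (DartMap N))%N by lia.
have V := split_dart_valid N n0.
have [M [i H]] := glue_exists (j := None) V ltac:(by []).
suff [X XM] : exists X : F, sval X (DartMap M) by exists X, N, M, i.
have [eE fE wE bE] := bimarked_counts H; have [nE rE dE] := split_dart_counts n0 le_n H.
apply: Fset_mk; split.
- by move: G0; rewrite /has_genus; lia.
- by lia.
by split; [lia | lia | lia | rewrite dE].
Qed.

(** The root vertex of the smaller map has degree 2(d_j + n - 1), hence at
    least 2n as d_j >= 1: the cut leaves darts at the far end. *)
Lemma glues_marked_exists x : exists X, glues_marked x X.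
Proof.
case: x => j F'; have [m Fm] := Fset_rep F'; have P := Fset_params Fm.
have e0 : 0 < e by case: P => _ E _; move: E; lia.
have [n0 d0] := hpos e0; have dj : 0 < D`_j := d0 _ (mem_nth 0 (ltn_ord j)).
move: F' Fm P; set dj0 := D`_j in dj *; move=> F' Fm P.
have P' := P; case: P => G0 E0 [/= W0 B0 R0 D0].
case: m Fm G0 E0 W0 B0 R0 D0 P' => [|N] Fm G0 E0 W0 B0 R0 D0 P'; first by move: R0 => /=;
  lia.
have le_n : ((`|n|%N).*2 <= root_degree (DartMap N))%N by lia.
have V := split_dart_valid N n0.
have L := split_dart_link N.
have sz := size_smap_dist P'.
have jle : (j <= size (dist N))%N.
  by rewrite -[dist N]/(smap_dist (DartMap N)) sz /remove_at size_cat size_takel ?leq_addr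
    // ltnW.
have [M [i H]] : exists M i, @reduces M (bimarked (split_dart N) (dist N)) (Some (val j)) i.
  by apply: glue_exists => // k [<-].
suff [X XM] : exists X : F, sval X (DartMap M) by exists X, N, M, i.
have [eE fE wE bE] := bimarked_counts H; have [nE rE dE] := split_dart_counts n0 le_n H.
apply: Fset_mk; split.
- by move: G0; rewrite /has_genus; lia.
- by lia.
split; [lia | lia | lia | ].
rewrite dE insert_at_map D0 -[in RHS](insert_remove (ltn_ord j)) insert_at_map.
by congr insert_at; lia.
Qed.

Lemma smap_dist_half m v : v \in smap_dist m -> exists h, #|v| = (h * 2)%N.
Proof. by move=> /smap_dist_even vo; exists (#|v|./2); rewrite muln2 even_halfK. Qed.

Lemma glues_product_onto (X : F) M P i : sval X (DartMap M) -> cut_valid P -> ~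
  cut_connected P ->
  @reduces M P None i -> exists x, glues_product x X.
Proof.
move=> XM V nc H; have [m1 [m2 [mu [f [fP fc smu d1 d2]]]]] := disconnected_is_sum V nc.
have H' := reduces_comp H fP fc; have PM := Fset_params XM.
have dE : dist_degrees (DartMap M) = [seq #|v| | v : {set cut_dart P} <- cut_dist P].
  by rewrite (reduces_dist_degrees H).
have smuD : size mu = size D.
  by rewrite smu -(size_smap_dist PM) -(size_map (fun v : {set cut_dart P} => #|v|)) -dE
    dist_degreesE size_map.
rewrite -dE in d1 d2.
have [s [sE [P1 P2]]] := params_split PM smuD H' d1 d2.
have [X1 X1m] := Fset_mk P1; have [X2 X2m] := Fset_mk P2.
exists (existT _ s (X1, X2)); exists m1, m2, M; rewrite /= sE.
by exists (i \o f).
Qed.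

Lemma connected_roots P : cut_connected P -> exists x y,
  cut_a P = Some x /\ cut_b P = Some y.
Proof. by case=> x [y [? ? _]]; exists x, y. Qed.

(** The map N built on the remainder is only isomorphic to the
    representative of its class: the place of the loop is carried over by an
    isomorphism before its number is read off. *)
Lemma glues_loop_onto (X : F) M P i : sval X (DartMap M) -> cut_valid P -> cut_connected P
  ->
  ~ root_link P -> @reduces M P None i -> exists x, glues_loop x X.
Proof.
move=> XM V cP nl H; have [a [b0 [aE bE]]] := connected_roots cP.
have nb : b0 \notin porbit (cut_R P) a by apply/negP => ba; apply: nl; exists a, b0.
have [N [f [fB [fR fL] fr fc fd]]] : exists (N : seqmap) (f : dart N -> cut_dart P),
  [/\ bijective f, commute2 (mapR N) (mapL N) (cut_R P) (cut_L P) f, f (Defs.root N) = a,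
      forall x, colour x = ~~ cut_colour (f x) &
      [seq f @: (v : {set dart N}) | v <- dist N] = porbit (cut_R P) b0 :: cut_dist P].
  apply: (bimarked_exists V aE bE cP).
  - rewrite /= (valid_dist_uniq V) andbT; apply/negP => bd.
    by have := valid_dist_b V bd bE; rewrite porbit_id.
  - by move=> v; rewrite inE => /predU1P[->|/(valid_dist_orbit V)//]; exists b0.
  - move=> v; rewrite inE => /predU1P[->|vd]; first by rewrite porbit_sym.
    exact: (valid_dist_a V vd aE).
case E: (dist N) fd => [|v0 ds] //= [fv fds].
have [f' fK f'K] := fB; have fI := bij_inj fB; pose c := f' b0.
have fcE : f c = b0 by rewrite f'K.
have v0E : v0 = vertex_of c.
  apply: (imset_inj fI); rewrite fv -fcE; apply: porbit_emb => y _; by rewrite fR.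
have cB : c \in head_blacks N.
  by rewrite inE E /= v0E porbit_id fc fcE negbK (valid_b_white V bE).
have fiso : @cut_iso (bimarked c ds) P f.
  by split=> //=; rewrite ?fr ?fcE ?aE ?bE.
have fcc x : cut_colour (f x) = @cut_colour (bimarked c ds) x by rewrite /= fc negbK.
have H' := reduces_comp H fiso fcc.
have [cb vE br bds] := head_blacksP E cB.
have [eE fE wE bE'] := bimarked_counts H'; have [nE rE dE] := bimarked_loop_counts H'
  erefl br.
have PM := Fset_params XM; case: (PM) => G0 E0 [W0 B0 R0 D0].
have [h1 h1E] : exists h, root_degree (DartMap N) = (h * 2)%N.
  by exists (root_degree (DartMap N))./2; rewrite muln2 even_halfK // root_degree_even.
have [h2 h2E] : exists h, #|vertex_of c| = (h * 2)%N.
  by apply: (@smap_dist_half (DartMap N)); rewrite /= E v0E inE eqxx.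
have h1_gt0 : (0 < root_degree (DartMap N))%N by rewrite lt0n card_porbit_neq0.
have h2_gt0 : (0 < #|vertex_of c|)%N by rewrite lt0n card_porbit_neq0.
(* The upper bound holds because the new root vertex is not empty either. *)
have pP : 1 <= h2%:Z <= n - 2 by apply/andP; split; lia.
pose p : irange 1 (n - 2) := exist _ h2%:Z pP.
have PN : has_params (g - 1) (e - 1) b w (n - 1 - sval p) (sval p :: D) (DartMap N).
  split.
  - by move: G0; rewrite /has_genus; lia.
  - by lia.
  split; [lia | lia | rewrite [sval p]/=; lia |].
  rewrite /= E /= v0E h2E -D0 dE; congr cons; lia.
have [F' FN] := Fset_mk PN.
case rE' : (representative F') => [|N0].
  by have := representativeP F'; rewrite rE' => /(Fset_iso FN).
have N0N : iso (DartMap N0) (DartMap N).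
  by apply: (Fset_iso (X := F')) => //; rewrite -rE'; apply: representativeP.
have [h [hB [hR hL] /= [hr] hd]] := iffLR (isoP _ _) N0N.
have hcol : forall x, colour (h x) = colour x.
  exact: (@smap_iso_colour (DartMap N0) (DartMap N) h) (conj hR hL) (congr1 Some hr).
case E0' : (dist N0) hd => [|u0 us]; rewrite E //= => -[hu0 hus].
have [h' hK h'K] := hB; have hI := bij_inj hB.
pose c' := h' c; have hc' : h c' = c by rewrite h'K.
have c'B : c' \in head_blacks N0.
  rewrite inE E0' /= -hcol hc' cb andbT.
  by rewrite -(mem_imset _ _ hI) hu0 hc' v0E porbit_id.
(* Numbers start at 1, positions in the enumeration at 0. *)
pose k0 := index c' (enum (head_blacks N0)).
have lt_k0 : (k0 < #|head_blacks N0|)%N by rewrite cardE index_mem mem_enum.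
have := head_blacks_half E0'; rewrite -(card_imset _ hI) hu0 v0E h2E => /eqP.
rewrite eqn_mul2r /= => /eqP h2B.
have kP : 1 <= k0.+1%:Z <= h2%:Z by apply/andP; split; lia.
pose k : irange 1 (sval p) := exist _ k0.+1%:Z kP.
exists (existT _ p (F', k)).
have kthE : head_black N0 `|k0.+1%:Z|%N = c'.
  by rewrite /head_black /= nth_index // mem_enum.
have hiso : @cut_iso (bimarked c' us) P (f \o h).
  split=> /=.
  - exact: bij_comp.
  - by split=> x; rewrite /= ?hR ?hL ?fR ?fL.
  - by rewrite hr fr aE.
  - by rewrite hc' fcE bE.
  - by rewrite -fds -hus -map_comp; apply: eq_map => v /=; rewrite imset_comp.
have hcc x : cut_colour ((f \o h) x) = @cut_colour (bimarked c' us) x by rewrite /= fcc /=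
  hcol.
have H0 := reduces_comp H hiso hcc.
exists N0, M; rewrite [sval _]/= kthE E0'; exists (i \o (f \o h)).
by split.
Qed.

(** Both kinds of links come from the same remainder, a map cut at
    [split_dart]. *)
Lemma root_link_reduction (X : F) M P j i : sval X (DartMap M) -> cut_valid P -> root_link
  P ->
  @reduces M P j i -> 0 < n /\ exists (N : seqmap) i',
  @reduces M (bimarked (split_dart N) (dist N)) j i' /\
    ((`|n|%N).*2 <= root_degree (DartMap N))%N.
Proof.
move=> XM V lP H; have [a [k [aE kP bE kO]]] := root_link_spec V lP.
have cP := root_link_connected lP.
have [_ rE _ _] := reduces_link H aE kP bE.
have := Fset_params XM => -[_ _ [_ _ R0 _]].
have n0 : 0 < n by lia.
have kE : k = (`|n|%N).*2.-1 by move: R0; rewrite rE; lia.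
split=> //.
have [N [f [fB [fR fL] fr fc fd]]] : exists (N : seqmap) (f : dart N -> cut_dart P),
  [/\ bijective f, commute2 (mapR N) (mapL N) (cut_R P) (cut_L P) f, f (Defs.root N) = a,
      forall x, colour x = ~~ cut_colour (f x) &
      [seq f @: (v : {set dart N}) | v <- dist N] = cut_dist P].
  apply: (bimarked_exists V aE bE cP); first exact: valid_dist_uniq V.
    exact: valid_dist_orbit V.
  by move=> v vd; apply: (valid_dist_a V vd aE).
have fI := bij_inj fB.
exists N, (i \o f); split.
  apply: (reduces_comp H).
    split=> //=; first by rewrite fr aE.
    rewrite /split_dart bE -kE; congr Some; rewrite -fr.
    by elim: (k) => //= k1 <-; rewrite fR.
  by move=> x; rewrite /= fc negbK.
have -> : root_degree (DartMap N) = #|porbit (cut_R P) a|.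
  by rewrite /= -(card_imset _ fI) -fr; congr #|pred_of_set _|; symmetry; apply: porbit_emb.
by move: kP; rewrite kE; lia.
Qed.

(** The bound p <= e - 1 says that the degree 2p of the root vertex is at
    most the number 2(e - 1) of darts. *)
Lemma glues_free_onto (X : F) M P i : sval X (DartMap M) -> cut_valid P -> root_link P ->
  @reduces M P None i -> exists x, glues_free x X.
Proof.
move=> XM V lP H; have [n0 [N [i' [H' le_n]]]] := root_link_reduction XM V lP H.
have [eE fE wE bE] := bimarked_counts H'; have [nE rE dE] := split_dart_counts n0 le_n H'.
have := Fset_params XM => -[G0 E0 [W0 B0 R0 D0]].
have [h hE] : exists h, root_degree (DartMap N) = (h * 2)%N.
  by exists (root_degree (DartMap N))./2; rewrite muln2 even_halfK // root_degree_even.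
have le_e : (root_degree (DartMap N) <= nb_edges (DartMap N) * 2)%N.
  by rewrite nb_edgesE; apply: max_card.
have pP : n <= h%:Z <= e - 1 by apply/andP; split; lia.
pose p : irange n (e - 1) := exist _ h%:Z pP.
have PN : has_params g (e - 1) b w (sval p) D (DartMap N).
  split.
  - by move: G0; rewrite /has_genus; lia.
  - by lia.
  by split; [lia | lia | rewrite [sval p]/=; lia | rewrite -D0 dE].
have [F' FN] := Fset_mk PN.
by exists (existT _ p F'); exists N, M, i'.
Qed.

Lemma glues_marked_onto (X : F) M P k i : sval X (DartMap M) -> cut_valid P -> root_link P
  ->
  @reduces M P (Some k) i -> exists x, glues_marked x X.
Proof.
move=> XM V lP H; have [n0 [N [i' [H' le_n]]]] := root_link_reduction XM V lP H.
have [eE fE wE bE] := bimarked_counts H'; have [nE rE dE] := split_dart_counts n0 le_n H'.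
have PM := Fset_params XM; have := PM => -[G0 E0 [W0 B0 R0 D0]].
have kds := reduces_label H' erefl; rewrite /= in kds.
have szD : size D = (size (dist N)).+1.
  rewrite -(size_smap_dist PM) /= (reduces_dist H') (perm_size (insert_at_perm _ _ _)) /=.
  by rewrite size_map.
have lt_k : (k < size D)%N by rewrite szD.
pose j := Ordinal lt_k.
have ins_rem (s t : seq int) x : (k <= size t)%N -> insert_at (Some k) x t = s ->
    s`_k = x /\ remove_at k s = t.
  move=> kt <-; rewrite /remove_at /insert_at nth_cat size_takel // ltnn subnn.
  split=> //; rewrite take_size_cat ?size_takel // -cat_rcons drop_size_cat ?cat_take_drop
    //.
  by rewrite size_rcons size_takel.
have := D0; rewrite dE insert_at_map => /ins_rem[].
  by rewrite size_map dist_degreesE size_map.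
rewrite (nth_map 0) // => xE0 tE.
have xE : 2 * D`_j = (root_degree (DartMap N) - (`|n|%N).*2).+2%:Z := xE0.
clear xE0.
have PN : has_params g (e - 1) b w (D`_j + n - 1) (remove_at j D) (DartMap N).
  split.
  - by move: G0; rewrite /has_genus; lia.
  - by lia.
  split; [lia | lia | move: (D`_j) xE => dj xE; lia |].
  by rewrite -tE /remove_at map_cat map_take map_drop.
have [F' FN] := Fset_mk PN.
by exists (existT _ j F'); exists N, M, i'.
Qed.

Lemma glues_product_functional x X X' : glues_product x X -> glues_product x X' -> X = X'.
Proof.
move=> [m1 [m2 [M [i [H1 H2 XM H]]]]] [m1' [m2' [M' [i' [H1' H2' XM' H']]]]].
have [f fP] := cut_sum_iso (smask (projT1 x)) (Fset_iso H1 H1') (Fset_iso H2 H2').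
exact: Fset_eq (Fset_closed XM (iso_of_cut_iso H H' fP)) XM'.
Qed.

Lemma cut_iso_refl P : @cut_iso P P id.
Proof.
split; [by exists id | by [] | by case: (cut_a P) | by case: (cut_b P) |].
by rewrite -[RHS]map_id; apply: eq_map => v; rewrite imset_id.
Qed.

Lemma glues_loop_functional x X X' : glues_loop x X -> glues_loop x X' -> X = X'.
Proof.
move=> [N [M [i [rE XM H]]]] [N' [M' [i' [rE' XM' H']]]].
have EN : N = N' by move: rE'; rewrite rE => -[].
subst N'; apply: Fset_eq (Fset_closed XM (iso_of_cut_iso H H' _)) XM'.
exact: cut_iso_refl.
Qed.

Lemma glues_free_functional x X X' : glues_free x X -> glues_free x X' -> X = X'.
Proof.
move=> [N [M [i [FN XM H]]]] [N' [M' [i' [FN' XM' H']]]].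
have [f fP] := bimarked_iso_next (`|n|%N).*2.-1 (Fset_iso FN FN').
exact: Fset_eq (Fset_closed XM (iso_of_cut_iso H H' fP)) XM'.
Qed.

Lemma glues_marked_functional x X X' : glues_marked x X -> glues_marked x X' -> X = X'.
Proof.
move=> [N [M [i [FN XM H]]]] [N' [M' [i' [FN' XM' H']]]].
have [f fP] := bimarked_iso_next (`|n|%N).*2.-1 (Fset_iso FN FN').
exact: Fset_eq (Fset_closed XM (iso_of_cut_iso H H' fP)) XM'.
Qed.

(** The constraints of a splitting are equations, hence irrelevant. *)
Lemma splitting_eq (s t : splitting g e w b n D) :
  [/\ sg1 s = sg1 t, se1 s = se1 t, sw1 s = sw1 t, sb1 s = sb1 t & sn1 s = sn1 t] ->
  [/\ sg2 s = sg2 t, se2 s = se2 t, sw2 s = sw2 t, sb2 s = sb2 t & sn2 s = sn2 t] ->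
  smask s = smask t -> s = t.
Proof.
case: s => g1 g2 e1 e2 w1 w2 b1 b2 n1 n2 mu p1 p2 p3 p4 p5.
case: t => g1' g2' e1' e2' w1' w2' b1' b2' n1' n2' mu' q1 q2 q3 q4 q5 /=.
move=> [? ? ? ? ?] [? ? ? ? ?] ?; subst.
by congr Splitting; apply: Prop_irrelevance.
Qed.

Lemma splitting_sizes (s : splitting g e w b n D) m1 m2 :
  has_params (sg1 s) (se1 s) (sw1 s) (sb1 s) (sn1 s) (sD1 s) m1 ->
  has_params (sg2 s) (se2 s) (sw2 s) (sb2 s) (sn2 s) (sD2 s) m2 ->
  size (smap_dist m1) = count id (smask s) /\ size (smap_dist m2) = count negb (smask s).
Proof.
move=> /size_smap_dist-> /size_smap_dist->; rewrite !size_mask ?size_map ?size_tuple //.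
by rewrite count_map.
Qed.

Lemma glues_product_injective x x' X : glues_product x X -> glues_product x' X -> x = x'.
Proof.
case: x x' => [s [X1 X2]] [s' [X1' X2']].
move=> [m1 [m2 [M [i [/= H1 H2 XM H]]]]] [m1' [m2' [M' [i' [/= H1' H2' XM' H']]]]].
have V mu k1 k2 := @cut_sum_valid k1 k2 mu.
have [_ [f fP]] := cut_iso_of_iso (V _ _ _) (V _ _ _) H H' (Fset_iso XM XM').
have P1 := Fset_params H1; have P2 := Fset_params H2.
have P1' := Fset_params H1'; have P2' := Fset_params H2'.
have [z1 z2] := splitting_sizes P1 P2; have [z1' z2'] := splitting_sizes P1' P2'.
have [muE i1 i2] := cut_sum_inj z1 z2 z1' z2' fP.
have [[e1 e2 e3 e4] [e5 _]] := has_params_inj (has_params_iso i1 P1) P1'.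
have [[f1 f2 f3 f4] [f5 _]] := has_params_inj (has_params_iso i2 P2) P2'.
have ss : s = s' by apply: splitting_eq => //; apply: val_inj.
subst s'; rewrite (Fset_eq (Fset_closed H1 i1) H1').
by rewrite (Fset_eq (Fset_closed H2 i2) H2').
Qed.

Lemma loop_valid (x : LoopTerm) N : representative (projT2 x).1 = DartMap N ->
  cut_valid (bimarked (head_black N `|sval (projT2 x).2|%N) (behead (dist N))) /\
  ~ root_link (bimarked (head_black N `|sval (projT2 x).2|%N) (behead (dist N))).
Proof.
move=> rE; have [bN [v [ds E]]] := loop_head_black rE.
have [cb vE br bds] := head_blacksP E bN; split.
  apply: bimarked_valid => //; last by rewrite E.
    by have := dist_uniq N; rewrite E => /andP[].
  by move=> u; apply: mem_behead.
by case=> y [z [/= [<-] [<-]]]; apply/negP.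
Qed.

(** Isomorphic results come from the same class and hence from the same
    representative, on which the isomorphism is the identity by
    [rooted_map_rigid]: the dart, and so its number, is the same. *)
Lemma glues_loop_injective x x' X : glues_loop x X -> glues_loop x' X -> x = x'.
Proof.
move=> [N [M [i [rE XM H]]]] [N' [M' [i' [rE' XM' H']]]].
have [V _] := loop_valid rE; have [V' _] := loop_valid rE'.
have [f [fB [fR fL] fr fk fd]] : exists f : dart N -> dart N',
  [/\ bijective f, commute2 (mapR N) (mapL N) (mapR N') (mapL N') f,
    f (Defs.root N) = Defs.root N',
    f (head_black N `|sval (projT2 x).2|%N) = head_black N' `|sval (projT2 x').2|%N &
    [seq f @: (v : {set dart N}) | v <- behead (dist N)] = behead (dist N')].
  by have [_ [f /bimarked_iso fP]] := cut_iso_of_iso V V' H H' (Fset_iso XM XM'); exists f.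
have [bN [v [ds E]]] := loop_head_black rE; have [bN' [v' [ds' E']]] := loop_head_black rE'.
have [_ vE _ _] := head_blacksP E bN; have [_ vE' _ _] := head_blacksP E' bN'.
have NN' : iso (DartMap N) (DartMap N').
  apply/isoP; exists f; split=> //=; first by rewrite fr.
  rewrite E' vE' -fk; rewrite E' E /= in fd; rewrite E /= fd vE; congr cons.
  by symmetry; apply: porbit_emb => y _; rewrite fR.
have FN : sval (projT2 x).1 (DartMap N) by rewrite -rE; apply: representativeP.
have FN' : sval (projT2 x').1 (DartMap N') by rewrite -rE'; apply: representativeP.
clear H H' i i' V V' XM XM' bN' E' vE' vE fd.
have P := Fset_params FN; have P' := Fset_params FN'.
have [_ [_ [pE]]] := has_params_inj (has_params_iso NN' P) P'.
case: x x' rE rE' bN FN FN' fk {P P'} pE => [p [X1 k]] [p' [X1' k']] /= rE rE' bN FN FN'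
  fk pE.
have {pE} : p = p' by apply: val_inj.
move=> pE; subst p'.
have XX : X1 = X1' by apply: Fset_eq (Fset_closed FN NN') FN'.
subst X1'; have NN : N = N' by move: rE'; rewrite rE => -[].
subst N'; have fid := rooted_map_rigid (conj fR fL) fr; rewrite fid in fk.
suff -> : k = k' by [].
apply: val_inj => /=.
have bd (l : irange 1 (sval p)) : (`|sval l|.-1 < size (enum (head_blacks N)))%N /\ 1 <=
  sval l.
  have := Fset_params FN => -[_ _ [_ _ _]].
  rewrite /= E /= => -[vp _]; rewrite -cardE; have := head_blacks_half E.
  by case: (l) => z /= /andP[]; lia.
have [k1 k2] := bd k; have [k1' k2'] := bd k'.
move/eqP: fk; rewrite /head_black nth_uniq ?enum_uniq // => /eqP; move: k2 k2'.
move: (sval k) (sval k') => z z'; lia.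
Qed.

Lemma split_dart_inj (N N' M M' : seqmap) j j' i i' X : 0 < n ->
  sval (X : F) (DartMap M) -> sval X (DartMap M') ->
  @reduces M (bimarked (split_dart N) (dist N)) j i -> @reduces M'
    (bimarked (split_dart N') (dist N')) j' i' ->
  j = j' /\ iso (DartMap N) (DartMap N').
Proof.
move=> n0 XM XM' H H'.
have [-> [f /bimarked_iso[fB fC fr fk fd]]] :=
  cut_iso_of_iso (split_dart_valid N n0) (split_dart_valid N' n0) H H' (Fset_iso XM XM').
by split=> //; apply/isoP; exists f; split=> //=; rewrite fr.
Qed.

Lemma glues_free_injective x x' X : glues_free x X -> glues_free x' X -> x = x'.
Proof.
move=> [N [M [i [FN XM H]]]] [N' [M' [i' [FN' XM' H']]]].
have P := Fset_params FN; have P' := Fset_params FN'.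
have [n0 _] := hpos (edges_gt0 P).
have [_ NN'] := split_dart_inj n0 XM XM' H H'.
have [_ [pE _]] := has_params_inj (has_params_iso NN' P) P'.
case: x x' FN FN' pE {P P'} => [p Y] [p' Y'] /= FN FN' pE.
have {pE} : p = p' by apply: val_inj.
move=> pE; subst p'.
by rewrite (Fset_eq (Fset_closed FN NN') FN').
Qed.

Lemma glues_marked_injective x x' X : glues_marked x X -> glues_marked x' X -> x = x'.
Proof.
move=> [N [M [i [FN XM H]]]] [N' [M' [i' [FN' XM' H']]]].
have P := Fset_params FN.
have [n0 _] := hpos (edges_gt0 P).
have [[jE] NN'] := split_dart_inj n0 XM XM' H H'.
case: x x' FN FN' jE {P H H'} => [j Y] [j' Y'] /= FN FN' jE.
have {jE} : j = j' by apply: val_inj.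
move=> jE; subst j'.
by rewrite (Fset_eq (Fset_closed FN NN') FN').
Qed.

Definition Terms : Type := (ProductTerm + LoopTerm + FreeTerm + MarkedTerm +
  EmptyTerm)%type.

Definition glues (x : Terms) (X : F) : Prop :=
  match x with
  | inl (inl (inl (inl x))) => glues_product x X
  | inl (inl (inl (inr x))) => glues_loop x X
  | inl (inl (inr x)) => glues_free x X
  | inl (inr x) => glues_marked x X
  | inr _ => sval X EmptyMap
  end.

(** The summand that a remainder belongs to; invariant under isomorphism. *)
Definition cut_kind (P : cutmap) (j : option nat) : nat :=
  if `[< ~ cut_connected P >] then 0 else if `[< ~ root_link P >] then 1
  else if j is None then 2 else 3.

Definition term_tag (x : Terms) : nat :=
  match x with
  | inl (inl (inl (inl x))) => 0
  | inl (inl (inl (inr x))) => 1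
  | inl (inl (inr x)) => 2
  | inl (inr x) => 3
  | inr _ => 4
  end.

Lemma cut_sum_nconnected m1 m2 mu : ~ cut_connected (cut_sum m1 m2 mu).
Proof.
case=> x [y [/=]]; case: (smap_root m1) => //= r1 [<-]; case: (smap_root m2) => //= r2
  [<-] xy.
suff : exists z, @inr (smap_dart m1) (smap_dart m2) r2 = inl z by case.
apply: (generated_orbit_ind (A := fun t => exists z, t = @inl (smap_dart m1)
  (smap_dart m2) z) _ _ _ xy).
- by move=> _ [z ->]; exists (smap_R m1 z); rewrite permE.
- by move=> _ [z ->]; exists (smap_L m1 z); rewrite permE.
- by exists r1.
Qed.

Lemma glues_kind x X : glues x X -> term_tag x = 4 /\ sval X EmptyMap \/
  exists M P j i, [/\ sval X (DartMap M), cut_valid P, @reduces M P j i & term_tag x =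
    cut_kind P j].
Proof.
case: x => [[[[x|x]|x]|x]|x] /=; last by left.
- move=> [m1 [m2 [M [i [_ _ XM H]]]]]; right; exists M,
  (cut_sum m1 m2 (smask (projT1 x))), None, i.
  split=> //; first exact: cut_sum_valid.
  by rewrite /cut_kind asboolT //; apply: cut_sum_nconnected.
- move=> [N [M [i [rE XM H]]]]; right; have [V nl] := loop_valid rE.
  exists M, _, None, i; split; [exact: XM | exact: V | exact: H | ].
  by rewrite /cut_kind asboolF ?asboolT //; apply; apply: bimarked_connected.
- move=> [N [M [i [FN XM H]]]]; right; have P := Fset_params FN.
  have [n0 _] := hpos (edges_gt0 P).
  exists M, _, None, i; split; [exact: XM | exact: (split_dart_valid N n0) | exact: H | ].
  rewrite /cut_kind !asboolF //; last by apply; apply: bimarked_connected.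
  by apply; apply: split_dart_link.
- move=> [N [M [i [FN XM H]]]]; right; have P := Fset_params FN.
  have [n0 _] := hpos (edges_gt0 P).
  exists M, _, (Some (val (projT1 x))), i; split;
    [exact: XM | exact: (split_dart_valid N n0) | exact: H | ].
  rewrite /cut_kind !asboolF //; last by apply; apply: bimarked_connected.
  by apply; apply: split_dart_link.
Qed.

Lemma glues_tag x y X : glues x X -> glues y X -> term_tag x = term_tag y.
Proof.
case/glues_kind=> [[-> XE]|[M [P [j [i [XM V H ->]]]]]].
  by case/glues_kind=> [[-> //]|[M [P [j [i [XM _ _ _]]]]]]; case: (Fset_iso XE XM).
case/glues_kind=> [[_ XE]|[M' [P' [j' [i' [XM' V' H' ->]]]]]].
  by case: (Fset_iso XE XM).
have [<- [f fP]] := cut_iso_of_iso V V' H H' (Fset_iso XM XM').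
have [h hP] := cut_iso_sym fP.
have cE : cut_connected P = cut_connected P'.
  by apply: propext; split; [apply: connected_cut_iso fP | apply: connected_cut_iso hP].
have lE : root_link P = root_link P'.
  by apply: propext; split; [apply: root_link_cut_iso fP | apply: root_link_cut_iso hP].
by rewrite /cut_kind cE lE.
Qed.

Lemma decomposition : exists f : F -> Terms, bijective f.
Proof.
apply: (bijective_of_relation (S := glues)).
- case=> [[[[x|x]|x]|x]|[C [E CE]]] /=;
  [exact: glues_product_exists | exact: glues_loop_exists |
    exact: glues_free_exists | exact: glues_marked_exists |].
  by apply: Fset_mk; case: E => -> -> -> -> -> ->.
- move=> X; have [[|M] XM] := Fset_rep X.
    have [G0 E0 [/= W0 B0 R0 D0]] := Fset_params XM.
    have T : (g, e, w, b, n, D) = (0, 0, 1, 0, 0, [::]).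
      congr (_, _, _, _, _, _); try by lia.
        by move: G0; rewrite /has_genus /=; lia.
      by case: (D) D0.
    by exists (inr (exist _ (iso EmptyMap) (conj T erefl))).
  have [P [j [i [V H]]]] := root_cut_exists M.
  case: (EM (cut_connected P)) => cP; last first.
    have jN : j = None.
      by case jE : j => [k|//]; case: cP; apply: root_link_connected; exact:
        (reduces_label_link H jE).
    by rewrite jN in H; have [x Sx] := glues_product_onto XM V cP H; exists
      (inl (inl (inl (inl x)))).
  case: (EM (root_link P)) => lP; last first.
    have jN : j = None.
      by case jE : j => [k|//]; case: lP; exact: (reduces_label_link H jE).
    by rewrite jN in H; have [x Sx] := glues_loop_onto XM V cP lP H; exists
      (inl (inl (inl (inr x)))).
  case: j H => [k|] H.
    by have [x Sx] := glues_marked_onto XM V lP H; exists (inl (inr x)).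
  by have [x Sx] := glues_free_onto XM V lP H; exists (inl (inl (inr x))).
- case=> [[[[x|x]|x]|x]|x] X X' /=;
  [exact: glues_product_functional | exact: glues_loop_functional |
    exact: glues_free_functional | exact: glues_marked_functional | exact: Fset_eq].
- move=> x x' X S S'; have := glues_tag S S'; move: S S'.
  case: x => [[[[x|x]|x]|x]|[C CE]]; case: x' => [[[[x'|x']|x']|x']|[C' CE']] //= S S' _.
  + by rewrite (glues_product_injective S S').
  + by rewrite (glues_loop_injective S S').
  + by rewrite (glues_free_injective S S').
  + by rewrite (glues_marked_injective S S').
  + have CC : C = C' by rewrite CE.2 CE'.2.
    by subst C'; congr (inr (exist _ _ _)); apply: Prop_irrelevance.
Qed.

End Main.

Unset Implicit Arguments.

Theorem theorem2 (g e w b n : int) (D : seq int)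
    (hpos : 0 < e -> 0 < n /\ {in D, forall d, 0 < d}) :
  exists f : Fset g e w b n D ->
      {s : splitting g e w b n D &
           (Fset (sg1 s) (se1 s) (sw1 s) (sb1 s) (sn1 s) (sD1 s) *
            Fset (sg2 s) (se2 s) (sw2 s) (sb2 s) (sn2 s) (sD2 s))%type}
    + {p : irange 1 (n - 2) &
           (Fset (g - 1) (e - 1) b w (n - 1 - sval p) (sval p :: D) *
            irange 1 (sval p))%type}
    + {p : irange n (e - 1) & Fset g (e - 1) b w (sval p) D}
    + {j : 'I_(size D) & Fset g (e - 1) b w (D`_j + n - 1) (remove_at j D)}
    + Delta ((g, e, w, b, n, D) = (0, 0, 1, 0, 0, [::])),
  bijective f.
Proof. exact: decomposition hpos. Qed.
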